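(* Let $p:\mathbb{C}\to\mathbb{R}_+$ be a weight, let $\Lambda\subset\mathbb{C}$ be a discrete sequence and let $n\ge 1$ be an integer. Then the identity $\mathcal{R}_\Lambda(A_p)=X^{n-1}_p(\Lambda)$ holds if and only if $\Lambda$ is the union of $n$ interpolating sequences for $A_p$.
   Context: $\mathbb{R}_+=[0,\infty)$. A function $p:\mathbb{C}\to\mathbb{R}_+$ is called a weight if (w1) there is a constant $K>0$ such that $p(z)\ge K\ln(1+|z|^2)$ for all $z\in\mathbb{C}$; and (w2) there are constants $D_0>0$ and $E_0>0$ such that whenever $|z-w|\le 1$ one has $p(z)\le D_0\,p(w)+E_0$. $A_p$ is the algebra of all entire functions $f$ for which there exist $A,B>0$ with $|f(z)|\le A e^{Bp(z)}$ for all $z\in\mathbb{C}$. A discrete sequence (discrete subset) $\Lambda\subset\mathbb{C}$ is a set of points with no accumulation points in $\mathbb{C}$. $A_p(\Lambda)$ is the space of families $\omega(\Lambda)=\{\omega(\lambda)\}_{\lambda\in\Lambda}$ of complex numbers for which there are $A,B>0$ with $|\omega(\lambda)|\le A e^{Bp(\lambda)}$ for all $\lambda\in\Lambda$. The restriction operator is $\mathcal{R}_\Lambda:A_p\to A_p(\Lambda)$, $f\mapsto\{f(\lambda)\}_{\lambda\in\Lambda}$. $\Lambda$ is an interpolating sequence for $A_p$ if $\mathcal{R}_\Lambda(A_p)=A_p(\Lambda)$. Divided differences of a function $\omega$ on $\Lambda$ are defined inductively, for pairwise distinct points of $\Lambda$, by $\Delta^0\omega(\lambda_1)=\omega(\lambda_1)$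 and, for $j\ge1$, $$\Delta^j\omega(\lambda_1,\ldots,\lambda_{j+1})=\frac{\Delta^{j-1}\omega(\lambda_2,\ldots,\lambda_{j+1})-\Delta^{j-1}\omega(\lambda_1,\ldots,\lambda_j)}{\lambda_{j+1}-\lambda_1}.$$ For $n\ge1$, $\Lambda^n=\{(\lambda_1,\ldots,\lambda_n)\in\Lambda\times\cdots\times\Lambda:\lambda_j\ne\lambda_k\text{ if }j\ne k\}$, and $X^{n-1}_p(\Lambda)$ is the set of functions $\omega$ on $\Lambda$ such that for some $B>0$ $$\sup_{(\lambda_1,\ldots,\lambda_n)\in\Lambda^n}|\Delta^{n-1}\omega(\lambda_1,\ldots,\lambda_n)|\,e^{-B[p(\lambda_1)+\cdots+p(\lambda_n)]}<+\infty.$$ *)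

(* Defs.v *)
(* Stdlib reals with Coquelicot's complex numbers. *)
From Stdlib Require Import Reals.
From Coquelicot Require Import Coquelicot.
Open Scope R_scope.

Record weight (p : C -> R) : Prop := {
  weight_nonneg : forall z, 0 <= p z;
  weight_log :
    exists K, 0 < K /\ forall z, K * ln (1 + Cmod z ^ 2) <= p z;
  weight_doubling :
    exists D0 E0, 0 < D0 /\ 0 < E0 /\
      forall z w, Cmod (z - w) <= 1 -> p z <= D0 * p w + E0
}.

(* The normed module is given explicitly: the derivative is the complex one,
   not the real one. *)
Definition entire (f : C -> C) : Prop :=
  forall z : C, @ex_derive C_AbsRing C_NormedModule f z.

Definition in_Ap (p : C -> R) (f : C -> C) : Prop :=
  entire f /\
  exists A B, 0 < A /\ 0 < B /\ forall z, Cmod (f z) <= A * exp (B * p z).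

Definition accumulation_point (L : C -> Prop) (z : C) : Prop :=
  forall eps, 0 < eps -> exists w, L w /\ w <> z /\ Cmod (w - z) < eps.

Definition discrete (L : C -> Prop) : Prop :=
  forall z, ~ accumulation_point L z.

Definition point_of (L : C -> Prop) : Type := {z : C | L z}.

Definition pval {L : C -> Prop} (x : point_of L) : C := proj1_sig x.

Definition family_on (L : C -> Prop) : Type := point_of L -> C.

Definition restriction (L : C -> Prop) (f : C -> C) : family_on L :=
  fun x => f (pval x).

(* Membership in the image of A_p under restriction to L. *)
Definition Ap_trace (p : C -> R) (L : C -> Prop) (w : family_on L) : Prop :=
  exists f, in_Ap p f /\ forall x, restriction L f x = w x.

Definition in_Ap_seq (p : C -> R) (L : C -> Prop) (w : family_on L) : Prop :=
  exists A B, 0 < A /\ 0 < B /\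
    forall x, Cmod (w x) <= A * exp (B * p (pval x)).

Definition interpolating (p : C -> R) (L : C -> Prop) : Prop :=
  discrete L /\ forall w : family_on L, Ap_trace p L w <-> in_Ap_seq p L w.

(* A tuple of n points is given by the first n terms of a sequence. *)
Definition distinct_tuple {L : C -> Prop} (n : nat) (x : nat -> point_of L) : Prop :=
  forall i k, (i < n)%nat -> (k < n)%nat -> i <> k -> pval (x i) <> pval (x k).

(* [divdiff w j x] is the divided difference of order j of w at the j + 1 points
   x 0, ..., x j; later terms of x are irrelevant. *)
Fixpoint divdiff {L : C -> Prop} (w : family_on L) (j : nat)
    (x : nat -> point_of L) : C :=
  match j with
  | O => w (x O)
  | S j' =>
      ((divdiff w j' (fun i => x (S i)) - divdiff w j' x)
         / (pval (x (S j')) - pval (x O)))%C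
  end.

(* The space X^m_p(L). Note that [sum_f_R0 u m] has the m + 1 terms
   u 0, ..., u m.  The finiteness of the supremum is stated as the existence
   of an upper bound, so it holds trivially when L has fewer than m + 1 points. *)
Definition in_X (p : C -> R) (L : C -> Prop) (m : nat) (w : family_on L) : Prop :=
  exists B, 0 < B /\ exists M, forall x : nat -> point_of L,
    distinct_tuple (S m) x ->
    Cmod (divdiff w m x) * exp (- B * sum_f_R0 (fun i => p (pval (x i))) m) <= M.

Definition union_of_interpolating (p : C -> R) (n : nat) (L : C -> Prop) : Prop :=
  exists Ls : nat -> C -> Prop,
    (forall i, (i < n)%nat -> interpolating p (Ls i)) /\
    (forall z, L z <-> exists i, (i < n)%nat /\ Ls i z).

(* Main.v *)
(** Trace implies bounded divided differences: dividing an entire function by [z - a] at a zero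
    [a] costs only constants independent of [a], by the mean value property on unit circles. This
    property, and the stability of entire functions under locally uniform limits, come from
    Goursat's theorem applied to [f (z0 + exp w)].

    If the trace is the space of functions with bounded divided differences of order [n - 1], it
    contains every [w] with [|w x|] at most the product of the distances from [x] to its [n - 1]
    nearest neighbours. By an open mapping argument these are extended with uniform constants,
    and a function vanishing on [L] except at [x] shows that all but [n - 1] other points stay at
    distance at least [eps * exp (- B * p x)] from [x]. Hence [L] splits into clusters of at most
    [n] points; choosing one point per cluster gives [n] sequences, and values on one of them extend
    to functions constant on the clusters, which have bounded divided differences.

    Conversely, an extension to [m] of the interpolating sequences is corrected on the next one.
    For each of its points [x] there is a function vanishing on the first [m] sequences whose value
    at [x] is comparable to the product of the distances from [x] to them; multiplied by squares
    of square-summable interpolating functions these can be summed over all [x]. *)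
Require Import Defs.
From Stdlib Require Import Reals Arith Lra Lia List Permutation Relations.
From Stdlib Require Import Classical ClassicalEpsilon FunctionalExtensionality
  PropExtensionality ProofIrrelevance.
From Coquelicot Require Import Coquelicot.
Open Scope R_scope.

(** * Complex differentiability *)

(** The spaces are defined with constants depending on each function, while the constructions need
    constants common to a family. Quantitative lemmas therefore fix their constants before the
    functions, and the open mapping argument is run on data bounded by a prescribed function [phi].

    The link between values and divided differences is one term of Lagrange's formula: if [W]
    vanishes on a list [l], then the modulus of [W x] is that of the divided difference over
    [x :: l] times the product of the distances from [x] to [l]. Read in one direction it makes data
    bounded by such products admissible; in the other it bounds the error left on the next sequence.
    How many points lie near [x] is not known beforehand, so a bound of order [n - 1] must first
    yield bounds of all lower orders.

    Functions vanishing on the earlier sequences grow like [exp (B * p x)] in the parameter [x], so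
    their sum over [x] diverges in general. The interpolating factors take values [exp (q * p x)]
    with [q] large; normalising their squares by [exp (- (2 * q * p x))] gives decay in [p x]. *)

Definition Cdiff (f : C -> C) (z d : C) : Prop :=
  forall eps, 0 < eps -> exists del, 0 < del /\ forall w, Cmod (w - z) < del ->
    Cmod (f w - f z - d * (w - z))%C <= eps * Cmod (w - z).

Lemma is_derive_Cdiff f z d :
  @is_derive C_AbsRing C_NormedModule f z d <-> Cdiff f z d.
Proof.
  split.
  - intros [_ H] eps Heps.
    destruct (H z (fun P HP => HP) (mkposreal eps Heps)) as [del Hdel].
    exists del; split; [apply cond_pos|].
    intros w Hw. specialize (Hdel w Hw).
    replace (f w - f z - d * (w - z))%C with (f w - f z - (w - z) * d)%C by ring.
    exact Hdel.
  - intros H. split.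
    + apply (@is_linear_scal_l C_AbsRing C_NormedModule).
    + intros x Hx. 
      assert (Hxz : x = z).
      { apply (@is_filter_lim_locally_unique C_AbsRing (AbsRing_NormedModule C_AbsRing)) in Hx.
      now symmetry. }
      subst x. intros [eps Heps]. destruct (H eps Heps) as [del [Hd H1]].
      exists (mkposreal del Hd). intros w Hw. specialize (H1 w Hw).
      replace (f w - f z - d * (w - z))%C with (f w - f z - (w - z) * d)%C in H1 by ring.
      exact H1.
Qed.

Lemma Cdiff_const c z : Cdiff (fun _ => c) z 0.
Proof.
  intros eps Heps. exists 1. split; [lra|]. intros w _.
  replace (c - c - 0 * (w - z))%C with (RtoC 0) by ring.
  rewrite Cmod_0. pose proof (Cmod_ge_0 (w - z)). nra.
Qed.

Lemma Cdiff_id z : Cdiff (fun w => w) z 1.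
Proof.
  intros eps Heps. exists 1. split; [lra|]. intros w _.
  replace (w - z - 1 * (w - z))%C with (RtoC 0) by ring.
  rewrite Cmod_0. pose proof (Cmod_ge_0 (w - z)). nra.
Qed.

Lemma Cdiff_plus f g z d e : Cdiff f z d -> Cdiff g z e ->
  Cdiff (fun w => f w + g w)%C z (d + e).
Proof.
  intros Hf Hg eps Heps.
  destruct (Hf (eps / 2)) as [d1 [Hd1 H1]]; [lra|].
  destruct (Hg (eps / 2)) as [d2 [Hd2 H2]]; [lra|].
  exists (Rmin d1 d2). split; [now apply Rmin_pos|]. intros w Hw.
  pose proof (Rmin_l d1 d2). pose proof (Rmin_r d1 d2).
  specialize (H1 w ltac:(lra)). specialize (H2 w ltac:(lra)).
  replace (f w + g w - (f z + g z) - (d + e) * (w - z))%C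
    with ((f w - f z - d * (w - z)) + (g w - g z - e * (w - z)))%C by ring.
  eapply Rle_trans; [apply Cmod_triangle|]. lra.
Qed.

Lemma Cdiff_cont f z d : Cdiff f z d -> forall eps, 0 < eps ->
  exists del, 0 < del /\ forall w, Cmod (w - z) < del -> Cmod (f w - f z) < eps.
Proof.
  intros Hf eps Heps.
  destruct (Hf 1) as [d1 [Hd1 H1]]; [lra|].
  set (K := 1 + Cmod d). assert (HK : 0 < K) by (pose proof (Cmod_ge_0 d); unfold K; lra).
  exists (Rmin d1 (eps / K)). split; [apply Rmin_pos; auto; now apply Rdiv_lt_0_compat|].
  intros w Hw. pose proof (Rmin_l d1 (eps / K)). pose proof (Rmin_r d1 (eps / K)).
  specialize (H1 w ltac:(lra)).
  replace (f w - f z)%C with ((f w - f z - d * (w - z)) + d * (w - z))%C by ring.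
  eapply Rle_lt_trans; [apply Cmod_triangle|]. rewrite Cmod_mult.
  apply Rle_lt_trans with (K * Cmod (w - z)); [unfold K; lra|].
  apply Rlt_le_trans with (K * (eps / K)); [apply Rmult_lt_compat_l; lra|].
  apply Req_le. field. lra.
Qed.

Lemma Cdiff_mult f g z d e : Cdiff f z d -> Cdiff g z e ->
  Cdiff (fun w => f w * g w)%C z (d * g z + f z * e).
Proof.
  intros Hf Hg eps Heps.
  pose proof (Cmod_ge_0 (g z)) as Pg. pose proof (Cmod_ge_0 (f z)) as Pf.
  pose proof (Cmod_ge_0 d) as Pd.
  set (K := 2 + Cmod (g z) + Cmod (f z) + Cmod d).
  assert (HK : 0 < eps / K) by (apply Rdiv_lt_0_compat; unfold K; lra).
  destruct (Hf (eps / K)) as [d1 [Hd1 H1]]; [lra|].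
  destruct (Hg (eps / K)) as [d2 [Hd2 H2]]; [lra|].
  destruct (Cdiff_cont g z e Hg (Rmin 1 (eps / K))) as [d3 [Hd3 H3]]; [apply Rmin_pos; lra|].
  exists (Rmin d1 (Rmin d2 d3)). split; [repeat apply Rmin_pos; auto|].
  intros w Hw.
  pose proof (Rmin_l d1 (Rmin d2 d3)). pose proof (Rmin_r d1 (Rmin d2 d3)).
  pose proof (Rmin_l d2 d3). pose proof (Rmin_r d2 d3).
  specialize (H1 w ltac:(lra)). specialize (H2 w ltac:(lra)). specialize (H3 w ltac:(lra)).
  pose proof (Rmin_l 1 (eps / K)). pose proof (Rmin_r 1 (eps / K)).
  replace (f w * g w - f z * g z - (d * g z + f z * e) * (w - z))%C
    with ((f w - f z - d * (w - z)) * (g w - g z) + ((f w - f z - d * (w - z)) * g z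
       + (f z * (g w - g z - e * (w - z)) + d * (w - z) * (g w - g z))))%C by ring.
  pose proof (Cmod_ge_0 (w - z)) as Pw.
  assert (E : eps * Cmod (w - z) = eps / K * Cmod (w - z) * K).
  { field. unfold K; lra. }
  rewrite E. set (t := eps / K * Cmod (w - z)) in *. 
  assert (0 <= t) by (unfold t; nra).
  eapply Rle_trans; [apply Cmod_triangle|].
  eapply Rle_trans; [apply Rplus_le_compat_l, Cmod_triangle|].
  eapply Rle_trans; [apply Rplus_le_compat_l, Rplus_le_compat_l, Cmod_triangle|].
  rewrite !Cmod_mult.
  set (A := Cmod (f w - f z - d * (w - z))) in *.
  set (B := Cmod (g w - g z - e * (w - z))) in *.
  set (G := Cmod (g w - g z)) in *.
  assert (0 <= A) by apply Cmod_ge_0. assert (0 <= B) by apply Cmod_ge_0.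
  assert (0 <= G) by apply Cmod_ge_0.
  assert (A * G <= t) by nra.
  assert (A * Cmod (g z) <= t * Cmod (g z)) by nra.
  assert (Cmod (f z) * B <= t * Cmod (f z)) by nra.
  assert (Cmod (w - z) * G <= t) by (unfold t; nra).
  assert (Cmod d * Cmod (w - z) * G <= t * Cmod d) by nra.
  unfold K. nra.
Qed.

Lemma entire_iff f : entire f <-> forall z, exists d, Cdiff f z d.
Proof.
  split; intros H z; destruct (H z) as [d Hd]; exists d; now apply is_derive_Cdiff.
Qed.

Lemma entire_const c : entire (fun _ => c).
Proof. apply entire_iff. intros z. eexists. apply Cdiff_const. Qed.

Lemma entire_id : entire (fun z => z).
Proof. apply entire_iff. intros z. eexists. apply Cdiff_id. Qed.

Lemma entire_plus f g : entire f -> entire g -> entire (fun z => f z + g z)%C.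
Proof.
  rewrite !entire_iff. intros Hf Hg z. destruct (Hf z), (Hg z).
  eexists. apply Cdiff_plus; eassumption.
Qed.

Lemma entire_mult f g : entire f -> entire g -> entire (fun z => f z * g z)%C.
Proof.
  rewrite !entire_iff. intros Hf Hg z. destruct (Hf z), (Hg z).
  eexists. apply Cdiff_mult; eassumption.
Qed.

Lemma entire_ext f g : (forall z, f z = g z) -> entire f -> entire g.
Proof. intros H Hf. now rewrite <- (functional_extensionality f g H). Qed.

Lemma entire_minus f g : entire f -> entire g -> entire (fun z => f z - g z)%C.
Proof.
  intros Hf Hg. apply entire_ext with (fun z => f z + (-(1)) * g z)%C.
  - intros z; ring.
  - apply entire_plus; [exact Hf|]. apply (entire_mult (fun _ => _)); [apply entire_const|exact Hg].
Qed.

Lemma exp_mono x y : x <= y -> exp x <= exp y.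
Proof. intros [H| ->]; [left; now apply exp_increasing|right; trivial]. Qed.

(** * Closed forms on rectangles *)

(** If [P] failed, it would fail on a quarter, on a quarter of that, and so on; these rectangles
    shrink to a point, where the local hypothesis gives a contradiction. Used for Goursat's theorem
    and for the finiteness of bounded parts of a discrete set. *)
Lemma bisection_principle (P : R -> R -> R -> R -> Prop) :
  (forall a b c d, a <= b -> c <= d ->
     P a ((a + b) / 2) c ((c + d) / 2) -> P ((a + b) / 2) b c ((c + d) / 2) ->
     P a ((a + b) / 2) ((c + d) / 2) d -> P ((a + b) / 2) b ((c + d) / 2) d ->
     P a b c d) ->
  forall a b c d, a <= b -> c <= d ->
  (forall x y, a <= x <= b -> c <= y <= d -> exists del, 0 < del /\
     forall a' b' c' d', a' <= x <= b' -> c' <= y <= d' -> b' - a' < del -> d' - c' < del ->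
     P a' b' c' d') ->
  P a b c d.
Proof.
  intros Hsplit a b c d Hab Hcd Hloc. apply NNPP; intros Hn.
  set (bad := fun q : R * R * R * R =>
    let '(a, b, c, d) := q in a <= b /\ c <= d /\ ~ P a b c d).
  (* The failure of [P] is bundled with the rectangle, so that choosing a failing quarter is a
     function that can be iterated. *)
  assert (Hstep : forall q : {q | bad q}, {q' : {q | bad q} |
     let '(a, b, c, d) := proj1_sig q in let '(a', b', c', d') := proj1_sig q' in
     a <= a' /\ b' <= b /\ c <= c' /\ d' <= d /\
     b' - a' = (b - a) / 2 /\ d' - c' = (d - c) / 2}).
  { intros [[[[a0 b0] c0] d0] [H1 [H2 H3]]]. apply constructive_indefinite_description. simpl.
    set (m := (a0 + b0) / 2). set (k := (c0 + d0) / 2).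
    assert (Hex : exists a' b' c' d', bad (a', b', c', d') /\
      a0 <= a' /\ b' <= b0 /\ c0 <= c' /\ d' <= d0 /\
      b' - a' = (b0 - a0) / 2 /\ d' - c' = (d0 - c0) / 2).
    { apply NNPP; intros Hno. apply H3. apply Hsplit; trivial; fold m; fold k;
        apply NNPP; intros HP; apply Hno;
        [exists a0, m, c0, k|exists m, b0, c0, k|exists a0, m, k, d0|exists m, b0, k, d0];
        unfold bad, m, k in *; repeat split; trivial; lra. }
    destruct Hex as (a' & b' & c' & d' & Hb & Hr).
    exists (exist _ (a', b', c', d') Hb). exact Hr. }
  set (q0 := exist bad (a, b, c, d) (conj Hab (conj Hcd Hn))).
  set (seq := fun n => Nat.iter n (fun q => proj1_sig (Hstep q)) q0).
  set (sa := fun n => fst (fst (fst (proj1_sig (seq n))))).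
  set (sb := fun n => snd (fst (fst (proj1_sig (seq n))))).
  set (sc := fun n => snd (fst (proj1_sig (seq n)))).
  set (sd := fun n => snd (proj1_sig (seq n))).
  assert (Hbad : forall n, sa n <= sb n /\ sc n <= sd n /\ ~ P (sa n) (sb n) (sc n) (sd n)).
  { intros n. unfold sa, sb, sc, sd. destruct (seq n) as [[[[? ?] ?] ?] H]. exact H. }
  assert (HS : forall n, sa n <= sa (S n) /\ sb (S n) <= sb n /\ sc n <= sc (S n) /\
     sd (S n) <= sd n /\ sb (S n) - sa (S n) = (sb n - sa n) / 2 /\
     sd (S n) - sc (S n) = (sd n - sc n) / 2).
  { intros n. unfold sa, sb, sc, sd.
    change (seq (S n)) with (proj1_sig (Hstep (seq n))).
    destruct (Hstep (seq n)) as [[[[[? ?] ?] ?] H'] H]. simpl.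
    destruct (seq n) as [[[[? ?] ?] ?] H'']. simpl in *. exact H. }
  assert (Hmono : forall n k, sa n <= sa (n + k)%nat /\ sb (n + k)%nat <= sb n /\
     sc n <= sc (n + k)%nat /\ sd (n + k)%nat <= sd n).
  { intros n k. induction k as [|k IH]; [rewrite Nat.add_0_r; lra|].
    rewrite Nat.add_succ_r. specialize (HS (n + k)%nat). lra. }
  assert (Hcross : forall n k, sa n <= sb k /\ sc n <= sd k).
  { intros n k. pose proof (Hmono n k). pose proof (Hmono k n) as Hkn.
    rewrite (Nat.add_comm k n) in Hkn. specialize (Hbad (n + k)%nat). lra. }
  assert (Hw : forall n, sb n - sa n = (b - a) * (/ 2) ^ n /\ sd n - sc n = (d - c) * (/ 2) ^ n).
  { induction n as [|n IH]; [unfold sa, sb, sc, sd; simpl; lra|].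
    destruct (HS n) as (_ & _ & _ & _ & -> & ->). simpl. lra. }
  assert (Hlub : forall u v : nat -> R, (forall n k, u n <= v k) ->
     exists x, forall n, u n <= x <= v n).
  { intros u v Huv. destruct (completeness (fun r => exists n, r = u n)) as [x [Hx1 Hx2]].
    - exists (v O). intros r [n ->]. apply Huv.
    - exists (u O). now exists O.
    - exists x. intros n. split; [apply Hx1; now exists n|].
      apply Hx2. intros r [k ->]. apply Huv. }
  destruct (Hlub sa sb) as [x Hx]; [apply Hcross|].
  destruct (Hlub sc sd) as [y Hy]; [apply Hcross|].
  destruct (Hloc x y) as [del [Hdel HP]]; [exact (Hx O)|exact (Hy O)|].
  destruct (pow_lt_1_zero (/ 2) ltac:(rewrite Rabs_pos_eq; lra) (del / (1 + (b - a) + (d - c))))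
    as [N HN]; [apply Rdiv_lt_0_compat; lra|].
  specialize (HN N (le_n _)).
  assert (0 < (/ 2) ^ N) by (apply pow_lt; lra).
  rewrite Rabs_pos_eq in HN by lra.
  apply (Rmult_lt_compat_r (1 + (b - a) + (d - c))) in HN; [|lra].
  unfold Rdiv in HN. rewrite Rmult_assoc, Rinv_l, Rmult_1_r in HN by lra.
  destruct (Hbad N) as (_ & _ & Hbn). destruct (Hw N) as [W1 W2].
  apply Hbn. apply HP; trivial; rewrite ?W1, ?W2; nra.
Qed.

Lemma Rabs_4 r1 r2 r3 r4 e1 e2 e3 e4 : Rabs r1 <= e1 -> Rabs r2 <= e2 -> Rabs r3 <= e3 ->
  Rabs r4 <= e4 -> Rabs (r1 + r2 - r3 - r4) <= e1 + e2 + e3 + e4.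
Proof. intros. apply Rabs_le_between in H, H0, H1, H2. apply Rabs_le. lra. Qed.

(** The integral of the form P dx + Q dy along the boundary, counterclockwise. *)
Definition rect_int (P Q : R -> R -> R) (a b c d : R) : R :=
  RInt (fun x => P x c) a b + RInt (fun y => Q b y) c d
  - RInt (fun x => P x d) a b - RInt (fun y => Q a y) c d.

Lemma ex_RInt_all (f : R -> R) a b : (forall x, continuous f x) -> ex_RInt f a b.
Proof. intros H. apply (ex_RInt_continuous (V := R_CompleteNormedModule)). intros; apply H. Qed.

Section Goursat.
Variables P Q : R -> R -> R.
Hypothesis HP : forall x y, continuous (fun x => P x y) x.
Hypothesis HQ : forall x y, continuous (fun y => Q x y) y.

Lemma rect_int_split a b c d m k :
  rect_int P Q a b c d = rect_int P Q a m c k + rect_int P Q m b c k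
    + rect_int P Q a m k d + rect_int P Q m b k d.
Proof.
  unfold rect_int.
  assert (H1 : forall y, RInt (fun x => P x y) a b = RInt (fun x => P x y) a m + RInt (fun x => P
    x y) m b).
  { intros y. symmetry. apply (RInt_Chasles (fun x => P x y) a m b); apply ex_RInt_all; intros;
    apply HP. }
  assert (H2 : forall x, RInt (fun y => Q x y) c d = RInt (fun y => Q x y) c k + RInt (fun y => Q
    x y) k d).
  { intros y. symmetry. apply (RInt_Chasles (fun x => Q y x) c k d); apply ex_RInt_all; intros;
    apply HQ. }
  rewrite !H1, !H2. ring.
Qed.

Lemma RInt_affine_err (f : R -> R) s t u v e : s <= t -> (forall x, continuous f x) ->
  (forall x, s <= x <= t -> Rabs (f x - (u + v * x)) <= e) ->
  Rabs (RInt f s t - (u * (t - s) + v * (t ^ 2 - s ^ 2) / 2)) <= e * (t - s).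
Proof.
  intros Hst Hf He.
  assert (Hi : is_RInt (fun x => u + v * x) s t (u * (t - s) + v * (t ^ 2 - s ^ 2) / 2)).
  { replace (u * (t - s) + v * (t ^ 2 - s ^ 2) / 2)
      with (minus ((fun x => u * x + v * x ^ 2 / 2) t) ((fun x => u * x + v * x ^ 2 / 2) s))
      by (unfold minus, plus, opp; simpl; field).
    apply (is_RInt_derive (fun x => u * x + v * x ^ 2 / 2) (fun x => u + v * x)).
    - intros x _. auto_derive; trivial. field.
    - intros x _. apply (ex_derive_continuous (fun x => u + v * x)). auto_derive. trivial. }
  assert (Hj : RInt (fun x => f x - (u + v * x)) s t
     = RInt f s t - (u * (t - s) + v * (t ^ 2 - s ^ 2) / 2)).
  { apply is_RInt_unique. apply (is_RInt_minus f (fun x => u + v * x) s t).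
    - apply (RInt_correct f). now apply ex_RInt_all.
    - exact Hi. }
  rewrite <- Hj, Rmult_comm. apply abs_RInt_le_const; trivial.
  apply ex_RInt_all. intros x. apply (continuous_minus f); [apply Hf|].
  apply (ex_derive_continuous (fun x => u + v * x)). auto_derive. trivial.
Qed.

(** Goursat's argument: the common coefficient [p2] says that the form is closed, with no continuity
    of the partial derivatives. The bound [eps] times the squared half perimeter is exactly additive
    under quartering, so it need only be checked on small rectangles. *)
Lemma rect_int_closed a b c d : a <= b -> c <= d ->
  (forall x y, a <= x <= b -> c <= y <= d -> exists p1 p2 q2,
    differentiable_pt_lim P x y p1 p2 /\ differentiable_pt_lim Q x y p2 q2) ->
  rect_int P Q a b c d = 0.
Proof.
  intros Hab Hcd Hd.
  assert (Hall : forall eps, 0 < eps ->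
    Rabs (rect_int P Q a b c d) <= eps * ((b - a) + (d - c)) ^ 2).
  { intros eps Heps.
    apply (bisection_principle (fun a b c d => Rabs (rect_int P Q a b c d) <= eps * ((b - a) + (d
      - c)) ^ 2)); trivial.
    - clear - HP HQ. intros a b c d Hab Hcd H1 H2 H3 H4.
      rewrite (rect_int_split a b c d ((a + b) / 2) ((c + d) / 2)).
      replace (eps * (b - a + (d - c)) ^ 2) with
        (eps * ((a + b) / 2 - a + ((c + d) / 2 - c)) ^ 2 + eps * (b - (a + b) / 2 + ((c + d) / 2 -
          c)) ^ 2
        + eps * ((a + b) / 2 - a + (d - (c + d) / 2)) ^ 2 + eps * (b - (a + b) / 2 + (d - (c + d)
          / 2)) ^ 2)
        by field.
      apply Rabs_le_between in H1, H2, H3, H4. apply Rabs_le. lra.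
    - intros x y Hx Hy. destruct (Hd x y Hx Hy) as (p1 & p2 & q2 & H1 & H2).
      assert (He : 0 < eps / 2) by lra.
      destruct (H1 (mkposreal _ He)) as [d1 H1']. destruct (H2 (mkposreal _ He)) as [d2 H2'].
      exists (Rmin d1 d2). split; [apply Rmin_pos; apply cond_pos|].
      intros a' b' c' d' Ha Hc Hl1 Hl2.
      pose proof (Rmin_l d1 d2). pose proof (Rmin_r d1 d2).
      (* [s] is the half perimeter. On the boundary, [P] and [Q] are within [eps / 2 * s] of their
         affine parts; the affine parts integrate to 0, and the errors over a length [2 * s] add up
         to [eps * s ^ 2]. *)
      set (s := b' - a' + (d' - c')).
      assert (HPe : forall u v, a' <= u <= b' -> c' <= v <= d' ->
        Rabs (P u v - P x y - (p1 * (u - x) + p2 * (v - y))) <= eps / 2 * s /\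
        Rabs (Q u v - Q x y - (p2 * (u - x) + q2 * (v - y))) <= eps / 2 * s).
      { intros u v Hu Hv.
        assert (Rabs (u - x) <= b' - a') by (apply Rabs_le; lra).
        assert (Rabs (v - y) <= d' - c') by (apply Rabs_le; lra).
        assert (Rmax (Rabs (u - x)) (Rabs (v - y)) <= s) by (apply Rmax_lub; unfold s; lra).
        split; (eapply Rle_trans; [apply H1' || apply H2'; lra|]); simpl;
        apply Rmult_le_compat_l; lra. }
      unfold rect_int.
      pose proof (RInt_affine_err (fun x => P x c') a' b' (P x y - p1 * x + p2 * (c' - y)) p1 (eps
        / 2 * s)
        ltac:(lra) (fun x => HP x c')) as I1.
      pose proof (RInt_affine_err (fun x => P x d') a' b' (P x y - p1 * x + p2 * (d' - y)) p1 (eps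
        / 2 * s)
        ltac:(lra) (fun x => HP x d')) as I2.
      pose proof (RInt_affine_err (fun y => Q a' y) c' d' (Q x y - q2 * y + p2 * (a' - x)) q2 (eps
        / 2 * s)
        ltac:(lra) (fun y => HQ a' y)) as I3.
      pose proof (RInt_affine_err (fun y => Q b' y) c' d' (Q x y - q2 * y + p2 * (b' - x)) q2 (eps
        / 2 * s)
        ltac:(lra) (fun y => HQ b' y)) as I4.
      match type of I1 with ?A -> _ => assert A as HA end.
      { intros u Hu. destruct (HPe u c' Hu ltac:(lra)) as [G _]. revert G.
        match goal with |- Rabs ?x <= _ -> Rabs ?y <= _ => replace y with x by ring end. trivial. }
      specialize (I1 HA); clear HA.
      match type of I2 with ?A -> _ => assert A as HA end.
      { intros u Hu. destruct (HPe u d' Hu ltac:(lra)) as [G _]. revert G.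
        match goal with |- Rabs ?x <= _ -> Rabs ?y <= _ => replace y with x by ring end. trivial. }
      specialize (I2 HA); clear HA.
      match type of I3 with ?A -> _ => assert A as HA end.
      { intros u Hu. destruct (HPe a' u ltac:(lra) Hu) as [_ G]. revert G.
        match goal with |- Rabs ?x <= _ -> Rabs ?y <= _ => replace y with x by ring end. trivial. }
      specialize (I3 HA); clear HA.
      match type of I4 with ?A -> _ => assert A as HA end.
      { intros u Hu. destruct (HPe b' u ltac:(lra) Hu) as [_ G]. revert G.
        match goal with |- Rabs ?x <= _ -> Rabs ?y <= _ => replace y with x by ring end. trivial. }
      specialize (I4 HA); clear HA.
      pose proof (Rabs_4 _ _ _ _ _ _ _ _ I1 I4 I2 I3) as HH.
      apply Rle_trans with (eps / 2 * s * (b' - a') + eps / 2 * s * (d' - c')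
         + eps / 2 * s * (b' - a') + eps / 2 * s * (d' - c')).
      + revert HH. match goal with |- Rabs ?x <= _ ->
        Rabs ?y <= _ => replace y with x by field end. trivial.
      + unfold s. apply Req_le. field. }
  destruct (Req_dec (rect_int P Q a b c d) 0) as [|Hn]; [trivial|exfalso].
  apply Rabs_pos_lt in Hn.
  set (S := (b - a + (d - c)) ^ 2) in *. assert (0 <= S) by (apply pow2_ge_0).
  specialize (Hall (Rabs (rect_int P Q a b c d) / (2 * (S + 1)))
     ltac:(apply Rdiv_lt_0_compat; lra)).
  assert (Rabs (rect_int P Q a b c d) / (2 * (S + 1)) * S * (2 * (S + 1)) = Rabs (rect_int P Q a b
    c d) * S)
    by (field; lra).
  nra.
Qed.
End Goursat.

(** * Mean values over circles *)

Definition Ccont (f : C -> C) (z : C) : Prop :=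
  forall eps, 0 < eps -> exists del, 0 < del /\
    forall w, Cmod (w - z) < del -> Cmod (f w - f z) < eps.

(** A quotient by [z - a] at a zero is known to be continuous at [a], but not yet differentiable
    there. Allowing a finite exceptional list avoids removable singularities, since the mean value
    property holds for this larger class. *)
Definition holo_off (l : list C) (f : C -> C) : Prop :=
  (forall z, Ccont f z) /\ forall z, ~ In z l -> exists d, Cdiff f z d.

Lemma Cmod_le_sum z : Cmod z <= Rabs (fst z) + Rabs (snd z).
Proof.
  pose proof (Rabs_pos (fst z)). pose proof (Rabs_pos (snd z)).
  unfold Cmod. rewrite <- (sqrt_Rsqr (Rabs (fst z) + Rabs (snd z))) by lra.
  apply sqrt_le_1_alt. rewrite <- (pow2_abs (fst z)), <- (pow2_abs (snd z)). unfold Rsqr. nra.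
Qed.

Lemma Rabs_le_Cmod z : Rabs (fst z) <= Cmod z /\ Rabs (snd z) <= Cmod z.
Proof.
  pose proof (Rmax_Cmod z). pose proof (Rmax_l (Rabs (fst z)) (Rabs (snd z))).
  pose proof (Rmax_r (Rabs (fst z)) (Rabs (snd z))). lra.
Qed.

Definition circle (z0 : C) (r t : R) : C := (fst z0 + r * cos t, snd z0 + r * sin t).

Lemma circle_Cmod z0 r t : Cmod (circle z0 r t - z0) = Rabs r.
Proof.
  unfold circle, Cmod. simpl. rewrite <- sqrt_Rsqr_abs. f_equal.
  pose proof (sin2_cos2 t) as H. unfold Rsqr in *.
  replace (r * r) with (r * r * (sin t * sin t + cos t * cos t)) by (rewrite H; ring). ring.
Qed.

Lemma continuity_2d_circle f z0 : (forall z, Ccont f z) -> forall r t,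
  continuity_2d_pt (fun r t => fst (f (circle z0 r t))) r t /\
  continuity_2d_pt (fun r t => snd (f (circle z0 r t))) r t.
Proof.
  intros Hf r t.
  assert (H1 : continuity_2d_pt (fun r t => fst z0 + r * cos t) r t).
  { apply continuity_2d_pt_plus; [apply continuity_2d_pt_const|].
    apply continuity_2d_pt_mult; [apply continuity_2d_pt_id1|].
    apply continuity_1d_2d_pt_comp; [apply continuity_cos|apply continuity_2d_pt_id2]. }
  assert (H2 : continuity_2d_pt (fun r t => snd z0 + r * sin t) r t).
  { apply continuity_2d_pt_plus; [apply continuity_2d_pt_const|].
    apply continuity_2d_pt_mult; [apply continuity_2d_pt_id1|].
    apply continuity_1d_2d_pt_comp; [apply continuity_sin|apply continuity_2d_pt_id2]. }
  assert (H : forall eps : posreal, locally_2d (fun u v =>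
     Cmod (f (circle z0 u v) - f (circle z0 r t)) < eps) r t).
  { intros [eps Heps]. destruct (Hf (circle z0 r t) eps Heps) as [del [Hdel Hc]].
    assert (Hd : 0 < del / 2) by lra.
    destruct (H1 (mkposreal _ Hd)) as [d1 G1]. destruct (H2 (mkposreal _ Hd)) as [d2 G2].
    simpl in G1, G2.
    exists (mkposreal _ (Rmin_pos _ _ (cond_pos d1) (cond_pos d2))). simpl. intros u v Hu Hv.
    pose proof (Rmin_l d1 d2). pose proof (Rmin_r d1 d2).
    specialize (G1 u v ltac:(lra) ltac:(lra)). specialize (G2 u v ltac:(lra) ltac:(lra)).
    apply Hc. eapply Rle_lt_trans; [apply Cmod_le_sum|]. unfold circle; simpl.
    unfold Rminus in *. lra. }
  split; intros eps; destruct (H eps) as [d Hd]; exists d; intros u v Hu Hv;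
    specialize (Hd u v Hu Hv); destruct (Rabs_le_Cmod (f (circle z0 u v) - f (circle z0 r t))%C)
      as [K1 K2];
    simpl in K1, K2; unfold Rminus; lra.
Qed.

(** Continuity at each exceptional point joins the constants on its two sides; the points are
    removed one by one. *)
Lemma constant_off_finite (phi : R -> R) (l : list R) :
  (forall x, 0 <= x -> forall eps, 0 < eps -> exists del, 0 < del /\
     forall y, Rabs (y - x) < del -> Rabs (phi y - phi x) < eps) ->
  (forall a b, 0 <= a < b -> (forall e, In e l -> ~ a <= e <= b) -> phi a = phi b) ->
  forall a b, 0 <= a < b -> phi a = phi b.
Proof.
  intros Hc. induction l as [|e l IH]; intros Hl.
  - intros a b Hab. apply Hl; [trivial|intros e []].
  - apply IH. intros a b Hab Hlab.
    destruct (classic (a <= e <= b)) as [He|He].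
    2:{ apply Hl; trivial. intros e' [<-|H]; auto. }
    assert (Hclose : forall x y, (forall eps, 0 < eps -> Rabs (phi x - phi y) < eps) ->
      phi x = phi y).
    { intros x y H. apply cond_eq. exact H. }
    assert (H1 : phi a = phi e).
    { destruct (Req_dec a e) as [->|Hne]; trivial.
      apply Hclose. intros eps Heps. destruct (Hc e ltac:(lra) eps Heps) as [d [Hd Hp]].
      set (x := Rmax ((a + e) / 2) (e - d / 2)).
      assert (a < x < e /\ e - d / 2 <= x).
      { unfold x. pose proof (Rmax_l ((a + e) / 2) (e - d / 2)).
        pose proof (Rmax_r ((a + e) / 2) (e - d / 2)).
        assert (Rmax ((a + e) / 2) (e - d / 2) < e) by (apply Rmax_lub_lt; lra). lra. }
      rewrite (Hl a x); [|lra|].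
      - apply Hp. apply Rabs_lt_between. lra.
      - intros e' [<-|H'] G; [lra|]. apply (Hlab e' H'). lra. }
    assert (H2 : phi b = phi e).
    { destruct (Req_dec b e) as [->|Hne]; trivial.
      apply Hclose. intros eps Heps. destruct (Hc e ltac:(lra) eps Heps) as [d [Hd Hp]].
      set (x := Rmin ((b + e) / 2) (e + d / 2)).
      assert (e < x < b /\ x <= e + d / 2).
      { unfold x. pose proof (Rmin_l ((b + e) / 2) (e + d / 2)).
        pose proof (Rmin_r ((b + e) / 2) (e + d / 2)).
        assert (e < Rmin ((b + e) / 2) (e + d / 2)) by (apply Rmin_glb_lt; lra). lra. }
      rewrite <- (Hl x b); [|lra|].
      - apply Hp. apply Rabs_lt_between. lra.
      - intros e' [<-|H'] G; [lra|]. apply (Hlab e' H'). lra. }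
    congruence.
Qed.

Lemma differentiable_pt_lim_snd (g : R -> R) x y l : is_derive g y l ->
  differentiable_pt_lim (fun _ v => g v) x y 0 l.
Proof.
  intros [_ H] eps. destruct (H y (fun P HP => HP) eps) as [d Hd].
  exists d. intros u v _ Hv. specialize (Hd v Hv).
  change (Rabs (g v - g y - (v - y) * l) <= eps * Rabs (v - y)) in Hd.
  replace (g v - g y - (0 * (u - x) + l * (v - y))) with (g v - g y - (v - y) * l) by ring.
  eapply Rle_trans; [exact Hd|]. apply Rmult_le_compat_l; [left; apply cond_pos|apply Rmax_r].
Qed.

Lemma differentiable_pt_lim_prod c x y : differentiable_pt_lim (fun u v => c + u * v) x y y x.
Proof.
  intros eps. exists eps. intros u v Hu Hv.
  replace (c + u * v - (c + x * y) - (y * (u - x) + x * (v - y))) with ((u - x) * (v - y)) by ring.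
  rewrite Rabs_mult. apply Rmult_le_compat; try apply Rabs_pos; [lra|apply Rmax_r].
Qed.

Lemma differentiable_pt_lim_fst (g : R -> R) x y l : is_derive g x l ->
  differentiable_pt_lim (fun u _ => g u) x y l 0.
Proof. intros H. apply differentiable_pt_lim_proj1_0. now apply is_derive_Reals. Qed.

Lemma Cdiff_differentiable f z d : Cdiff f z d ->
  differentiable_pt_lim (fun x y => fst (f (x, y))) (fst z) (snd z) (fst d) (- snd d) /\
  differentiable_pt_lim (fun x y => snd (f (x, y))) (fst z) (snd z) (snd d) (fst d).
Proof.
  intros H.
  assert (Hk : forall eps : posreal, locally_2d (fun u v =>
     Cmod (f (u, v) - f z - d * ((u, v) - z)) <= eps * Rmax (Rabs (u - fst z)) (Rabs (v - snd z)))
       (fst z) (snd z)).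
  { intros [eps Heps]. destruct (H (eps / 2)) as [del [Hdel Hd]]; [lra|].
    assert (Hd2 : 0 < del / 2) by lra. exists (mkposreal _ Hd2). simpl. intros u v Hu Hv.
    pose proof (Cmod_le_sum ((u, v) - z)) as Hs. simpl in Hs.
    eapply Rle_trans; [apply Hd; unfold Rminus in *; lra|].
    pose proof (Rmax_l (Rabs (u - fst z)) (Rabs (v - snd z))).
    pose proof (Rmax_r (Rabs (u - fst z)) (Rabs (v - snd z))). unfold Rminus in *. nra. }
  destruct z as [x y]; simpl in *.
  split; intros eps; destruct (Hk eps) as [del Hd]; exists del; intros u v Hu Hv;
    (eapply Rle_trans; [|apply (Hd u v Hu Hv)]);
    destruct (Rabs_le_Cmod (f (u, v) - f (x, y) - d * ((u, v) - (x, y)))%C) as [K1 K2];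
    simpl in K1, K2; [refine (Rle_trans _ _ _ _ K1)|refine (Rle_trans _ _ _ _ K2)];
    apply Req_le; f_equal; ring.
Qed.

(** Only the real part, and not divided by [2 * PI]; a rotation of [f] later recovers the
    modulus. *)
Definition circle_mean (f : C -> C) (z0 : C) (r : R) : R :=
  RInt (fun t => fst (f (circle z0 r t))) 0 (2 * PI).

Section Mean.
Variables (f : C -> C) (z0 : C).
Hypothesis Hf : forall z, Ccont f z.

Lemma continuous_circle r t :
  continuous (fun t => fst (f (circle z0 r t))) t /\
  continuous (fun r => fst (f (circle z0 r t))) r /\
  continuous (fun r => snd (f (circle z0 r t))) r.
Proof.
  destruct (continuity_2d_circle f z0 Hf r t) as [H1 H2].
  repeat split; apply continuity_pt_filterlim; intros eps Heps;
  [destruct (H1 (mkposreal eps Heps)) as [d Hd]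
  |destruct (H1 (mkposreal eps Heps)) as [d Hd]
  |destruct (H2 (mkposreal eps Heps)) as [d Hd]];
  exists d; (split; [apply cond_pos|]); intros u [_ Hu]; apply Hd; trivial;
    rewrite Rminus_diag, Rabs_R0; apply cond_pos.
Qed.

Lemma circle_mean_cont r eps : 0 < eps -> exists del, 0 < del /\
  forall s, Rabs (s - r) < del -> Rabs (circle_mean f z0 s - circle_mean f z0 r) < eps.
Proof.
  intros Heps.
  assert (Hpi := PI_RGT_0).
  assert (He : 0 < eps / (4 * PI)) by (apply Rdiv_lt_0_compat; lra).
  destruct (uniform_continuity_2d_1d' (fun r t => fst (f (circle z0 r t))) 0 (2 * PI) r
    (fun x _ => proj1 (continuity_2d_circle f z0 Hf r x)) (mkposreal _ He)) as [del Hd].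
  exists del. split; [apply cond_pos|]. intros s Hs. unfold circle_mean.
  assert (Hex : forall r, ex_RInt (fun t => fst (f (circle z0 r t))) 0 (2 * PI)).
  { intros r'. apply ex_RInt_all. intros t. apply continuous_circle. }
  rewrite <- (RInt_minus (V := R_CompleteNormedModule)) by apply Hex.
  apply Rle_lt_trans with ((2 * PI - 0) * (eps / (4 * PI))).
  - apply abs_RInt_le_const; [lra|apply (ex_RInt_minus (V := R_NormedModule)); apply Hex|].
    intros t Ht. left. apply Rabs_lt_between in Hs.
    apply (Hd t r t s); trivial; try (pose proof (cond_pos del); lra).
    rewrite Rminus_diag, Rabs_R0. apply cond_pos.
  - replace ((2 * PI - 0) * (eps / (4 * PI))) with (eps / 2) by (field; lra). lra.
Qed.

(** With F(w) = f(z0 + exp w) and w = x + it, the form Im F dx + Re F dt is the imaginary part of F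
    dw, closed by the Cauchy-Riemann equations. Its integrals over the vertical sides are the two
    circle means. *)
Lemma circle_mean_annulus r s : 0 < r < s ->
  (forall z, r <= Cmod (z - z0) <= s -> exists d, Cdiff f z d) ->
  circle_mean f z0 r = circle_mean f z0 s.
Proof.
  intros Hrs Hd.
  set (P := fun x t => snd (f (circle z0 (exp x) t))).
  set (Q := fun x t => fst (f (circle z0 (exp x) t))).
  assert (HJ : rect_int P Q (ln r) (ln s) 0 (2 * PI) = 0).
  { apply rect_int_closed.
    - intros x y. apply (continuous_comp exp (fun r => snd (f (circle z0 r y)))).
      + apply continuous_exp.
      + apply continuous_circle.
    - intros x y. apply continuous_circle.
    - left. apply ln_increasing; lra.
    - pose proof PI_RGT_0; lra.
    - intros x t Hx _.
      assert (Hex : r <= exp x <= s).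
      { rewrite <- (exp_ln r), <- (exp_ln s) by lra.
        split; apply exp_mono; tauto. }
      destruct (Hd (circle z0 (exp x) t)) as [d Hdz].
      { rewrite circle_Cmod, Rabs_pos_eq; lra. }
      apply Cdiff_differentiable in Hdz. destruct Hdz as [D1 D2].
      assert (E1 : differentiable_pt_lim (fun x t => fst z0 + exp x * cos t) x t
         (cos t * exp x + exp x * 0) (cos t * 0 + exp x * (- sin t))).
      { apply (differentiable_pt_lim_comp (fun a b => fst z0 + a * b) (fun x _ => exp x) (fun _ t
        => cos t)).
        - apply differentiable_pt_lim_prod.
        - apply differentiable_pt_lim_fst. apply is_derive_exp.
        - apply differentiable_pt_lim_snd. apply is_derive_cos. }
      assert (E2 : differentiable_pt_lim (fun x t => snd z0 + exp x * sin t) x t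
         (sin t * exp x + exp x * 0) (sin t * 0 + exp x * cos t)).
      { apply (differentiable_pt_lim_comp (fun a b => snd z0 + a * b) (fun x _ => exp x) (fun _ t
        => sin t)).
        - apply differentiable_pt_lim_prod.
        - apply differentiable_pt_lim_fst. apply is_derive_exp.
        - apply differentiable_pt_lim_snd. apply is_derive_sin. }
      pose proof (differentiable_pt_lim_comp _ _ _ x t _ _ _ _ _ _ D1 E1 E2) as F1.
      pose proof (differentiable_pt_lim_comp _ _ _ x t _ _ _ _ _ _ D2 E1 E2) as F2.
      do 3 eexists. split; [exact F2|].
      match goal with |- differentiable_pt_lim _ _ _ ?A _ =>
        match type of F1 with differentiable_pt_lim _ _ _ ?B _ => replace A with B by ring end end.
      exact F1. }
  unfold rect_int in HJ.
  (* The two horizontal sides cancel because F has period [2 * PI] in t. *)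
  assert (HPP : RInt (fun x => P x 0) (ln r) (ln s) = RInt (fun x => P x (2 * PI)) (ln r) (ln s)).
  { apply RInt_ext. intros x _. unfold P, circle. now rewrite cos_2PI, sin_2PI, cos_0, sin_0. }
  unfold circle_mean. unfold Q in HJ. rewrite !exp_ln in HJ by lra. lra.
Qed.
End Mean.

Lemma mean_value l f z0 r : 0 < r -> holo_off l f ->
  circle_mean f z0 r = 2 * PI * fst (f z0).
Proof.
  intros Hr [Hc Hd].
  transitivity (circle_mean f z0 0).
  - symmetry.
    (* The excluded radii are those of circles through exceptional points, and 0, where the
       logarithmic coordinate breaks down; continuity of the mean at radius 0 then brings in the
       value at the centre. *)
    apply (constant_off_finite (circle_mean f z0) (0 :: map (fun e => Cmod (e - z0)) l)); [| |lra].
    + intros x _ eps Heps. now apply circle_mean_cont.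
    + intros a b Hab Hl. apply circle_mean_annulus; trivial.
      * destruct (Req_dec a 0) as [->|]; [|lra]. exfalso. apply (Hl 0); [now left|lra].
      * intros z Hz. apply Hd. intros Hin. apply (Hl (Cmod (z - z0))); trivial.
        right. apply (in_map (fun e => Cmod (e - z0)) l z Hin).
  - unfold circle_mean. rewrite (RInt_ext _ (fun _ => fst (f z0))).
    + rewrite RInt_const. unfold scal; simpl; unfold mult; simpl. ring.
    + intros t _. unfold circle. rewrite !Rmult_0_l, !Rplus_0_r. now destruct z0.
Qed.

Lemma Ccont_scal c f z : Ccont f z -> Ccont (fun w => c * f w)%C z.
Proof.
  intros H eps Heps. pose proof (Cmod_ge_0 c).
  destruct (H (eps / (1 + Cmod c))) as [d [Hd Hw]]; [apply Rdiv_lt_0_compat; lra|].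
  exists d. split; trivial. intros w Hdw. specialize (Hw w Hdw).
  replace (c * f w - c * f z)%C with (c * (f w - f z))%C by ring. rewrite Cmod_mult.
  apply Rmult_lt_compat_r with (r := 1 + Cmod c) in Hw; [|lra].
  unfold Rdiv in Hw. rewrite Rmult_assoc, Rinv_l, Rmult_1_r in Hw by lra.
  pose proof (Cmod_ge_0 (f w - f z)). nra.
Qed.

Lemma mean_value_bound l f z0 r S : 0 < r -> holo_off l f ->
  (forall w, Cmod (w - z0) = r -> Cmod (f w) <= S) -> Cmod (f z0) <= S.
Proof.
  intros Hr [Hc Hd] HS.
  destruct (Req_dec (Cmod (f z0)) 0) as [H0|H0].
  { rewrite H0. eapply Rle_trans; [apply Cmod_ge_0|apply (HS (circle z0 r 0))].
    rewrite circle_Cmod. apply Rabs_pos_eq; lra. }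
  assert (Hpos : 0 < Cmod (f z0)) by (pose proof (Cmod_ge_0 (f z0)); lra).
  (* Rotate so that [f z0] becomes real and positive. *)
  set (c := (Cconj (f z0) / Cmod (f z0))%C).
  assert (Hnz : RtoC (Cmod (f z0)) <> 0) by (intros E; apply RtoC_inj in E; lra).
  assert (Hcm : Cmod c = 1).
  { unfold c. rewrite Cmod_div, Cmod_conj, Cmod_R, Rabs_pos_eq by (trivial; lra). field; lra. }
  assert (Hcf : (c * f z0 = Cmod (f z0))%C).
  { unfold c. transitivity (Cconj (f z0) * f z0 / Cmod (f z0))%C; [field; trivial|].
    rewrite (Cmult_comm (Cconj (f z0))), <- Cmod2_conj. simpl. rewrite Rmult_1_r, RtoC_mult.
    field. trivial. }
  assert (Hh : holo_off l (fun w => c * f w)%C).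
  { split; [intros z; now apply Ccont_scal|]. intros z Hz. destruct (Hd z Hz) as [d Hfd].
    eexists. apply (Cdiff_mult (fun _ => c)); [apply Cdiff_const|exact Hfd]. }
  pose proof (mean_value l _ z0 r Hr Hh) as Hm. cbv beta in Hm. rewrite Hcf in Hm. simpl in Hm.
  assert (Hpi := PI_RGT_0).
  assert (Hle : Rabs (circle_mean (fun w => c * f w)%C z0 r) <= (2 * PI - 0) * S).
  { apply abs_RInt_le_const; [lra| |].
    - apply ex_RInt_all. intros t. apply (continuous_circle (fun w => c * f w)%C z0). apply Hh.
    - intros t _. eapply Rle_trans; [apply (proj1 (Rabs_le_Cmod _))|].
      rewrite Cmod_mult, Hcm, Rmult_1_l. apply HS. rewrite circle_Cmod. apply Rabs_pos_eq; lra. }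
  rewrite Hm, Rabs_pos_eq in Hle by nra. nra.
Qed.

(** * Division by zeros and locally uniform limits *)

Lemma Ccont_Cdiff f z d : Cdiff f z d -> Ccont f z.
Proof. intros H eps. now apply (Cdiff_cont f z d). Qed.

Lemma Ccont_plus f g z : Ccont f z -> Ccont g z -> Ccont (fun w => f w + g w)%C z.
Proof.
  intros Hf Hg eps Heps.
  destruct (Hf (eps / 2)) as [d1 [Hd1 H1]]; [lra|].
  destruct (Hg (eps / 2)) as [d2 [Hd2 H2]]; [lra|].
  exists (Rmin d1 d2). split; [now apply Rmin_pos|]. intros w Hw.
  pose proof (Rmin_l d1 d2). pose proof (Rmin_r d1 d2).
  specialize (H1 w ltac:(lra)). specialize (H2 w ltac:(lra)).
  replace (f w + g w - (f z + g z))%C with ((f w - f z) + (g w - g z))%C by ring.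
  eapply Rle_lt_trans; [apply Cmod_triangle|]. lra.
Qed.

Lemma Ccont_mult f g z : Ccont f z -> Ccont g z -> Ccont (fun w => f w * g w)%C z.
Proof.
  intros Hf Hg eps Heps.
  pose proof (Cmod_ge_0 (f z)). pose proof (Cmod_ge_0 (g z)).
  set (K := 1 + Cmod (f z) + Cmod (g z)).
  assert (HK : 0 < eps / K) by (apply Rdiv_lt_0_compat; unfold K; lra).
  destruct (Hf (eps / K)) as [d1 [Hd1 H1]]; [lra|].
  destruct (Hg (Rmin 1 (eps / K))) as [d2 [Hd2 H2]]; [apply Rmin_pos; lra|].
  exists (Rmin d1 d2). split; [now apply Rmin_pos|]. intros w Hw.
  pose proof (Rmin_l d1 d2). pose proof (Rmin_r d1 d2).
  specialize (H1 w ltac:(lra)). specialize (H2 w ltac:(lra)).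
  pose proof (Rmin_l 1 (eps / K)). pose proof (Rmin_r 1 (eps / K)).
  replace (f w * g w - f z * g z)%C
    with ((f w - f z) * (g w - g z) + ((f w - f z) * g z + f z * (g w - g z)))%C by ring.
  eapply Rle_lt_trans; [apply Cmod_triangle|].
  eapply Rle_lt_trans; [apply Rplus_le_compat_l, Cmod_triangle|]. rewrite !Cmod_mult.
  replace eps with (eps / K + eps / K * Cmod (g z) + Cmod (f z) * (eps / K)) by (unfold K; field;
    lra).
  pose proof (Cmod_ge_0 (f w - f z)). pose proof (Cmod_ge_0 (g w - g z)). nra.
Qed.

Lemma near_ext (f g : C -> C) z r : 0 < r -> (forall w, Cmod (w - z) < r -> f w = g w) ->
  (Ccont f z -> Ccont g z) /\ forall d, Cdiff f z d -> Cdiff g z d.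
Proof.
  intros Hr He.
  assert (Hz : f z = g z) by (apply He; replace (z - z)%C with (RtoC 0) by ring;
    now rewrite Cmod_0).
  split.
  - intros H eps Heps. destruct (H eps Heps) as [d [Hd H1]].
    exists (Rmin d r). split; [now apply Rmin_pos|]. intros w Hw.
    pose proof (Rmin_l d r). pose proof (Rmin_r d r). rewrite <- Hz, <- He by lra. apply H1. lra.
  - intros e H eps Heps. destruct (H eps Heps) as [d [Hd H1]].
    exists (Rmin d r). split; [now apply Rmin_pos|]. intros w Hw.
    pose proof (Rmin_l d r). pose proof (Rmin_r d r). rewrite <- Hz, <- He by lra. apply H1. lra.
Qed.

Lemma Cminus_neq0 (z a : C) : z <> a -> (z - a)%C <> 0.
Proof. intros H E. apply H. replace z with (a + (z - a))%C by ring. rewrite E. ring. Qed.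

Lemma Cmod_minus_pos (z a : C) : z <> a -> 0 < Cmod (z - a).
Proof. intros H. apply Cmod_gt_0. now apply Cminus_neq0. Qed.

Lemma Cmod_minus_sym (z a : C) : Cmod (z - a) = Cmod (a - z).
Proof. rewrite <- Cmod_opp. f_equal. ring. Qed.

Lemma Cmod_triangle3 (x y z : C) : Cmod (x - z) <= Cmod (x - y) + Cmod (y - z).
Proof. replace (x - z)%C with ((x - y) + (y - z))%C by ring. apply Cmod_triangle. Qed.

Lemma Cmod_minus_le (x y : C) : Cmod (x - y) <= Cmod x + Cmod y.
Proof. unfold Cminus. rewrite <- (Cmod_opp y). apply Cmod_triangle. Qed.

Lemma Cdiff_inv a z : z <> a -> exists d, Cdiff (fun w => / (w - a))%C z d.
Proof.
  intros Hza. set (rho := Cmod (z - a)). assert (Hr : 0 < rho) by now apply Cmod_minus_pos.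
  exists (- / ((z - a) * (z - a)))%C. intros eps Heps.
  assert (Hr3 : 0 < rho * rho * rho) by (repeat apply Rmult_lt_0_compat; trivial).
  exists (Rmin (rho / 2) (eps * (rho * rho * rho) / 2)).
  split; [apply Rmin_pos; [lra|]; apply Rdiv_lt_0_compat; [now apply Rmult_lt_0_compat|lra]|].
  intros w Hw.
  pose proof (Rmin_l (rho / 2) (eps * (rho * rho * rho) / 2)).
  pose proof (Rmin_r (rho / 2) (eps * (rho * rho * rho) / 2)).
  assert (Hwa : rho / 2 <= Cmod (w - a)).
  { pose proof (Cmod_triangle3 z w a). rewrite (Cmod_minus_sym z w) in H1. fold rho in H1. lra. }
  assert (Hwne : w <> a).
  { intros ->. replace (a - a)%C with (RtoC 0) in Hwa by ring. rewrite Cmod_0 in Hwa. lra. }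
  pose proof (Cminus_neq0 _ _ Hza). pose proof (Cminus_neq0 _ _ Hwne).
  replace (/ (w - a) - / (z - a) - - / ((z - a) * (z - a)) * (w - z))%C
    with ((w - z) * (w - z) / ((w - a) * ((z - a) * (z - a))))%C by (field; tauto).
  rewrite Cmod_div, !Cmod_mult by (repeat apply Cmult_neq_0; trivial). fold rho.
  assert (0 < rho / 2 * (rho * rho)) by nra.
  pose proof (Cmod_ge_0 (w - z)).
  apply Rmult_le_reg_r with (Cmod (w - a) * (rho * rho)); [nra|].
  unfold Rdiv. rewrite Rmult_assoc, Rinv_l, Rmult_1_r by nra.
  apply Rle_trans with (eps * Cmod (w - z) * (rho / 2 * (rho * rho))).
  - replace (eps * Cmod (w - z) * (rho / 2 * (rho * rho))) with
     (Cmod (w - z) * (eps * (rho * rho * rho) / 2)) by field.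
    apply Rmult_le_compat_l; lra.
  - apply Rmult_le_compat_l; [|apply Rmult_le_compat_r]; nra.
Qed.

Lemma holo_off_entire f : entire f -> holo_off nil f.
Proof.
  intros H. rewrite entire_iff in H. split; intros z; [|intros _]; destruct (H z) as [d Hd].
  - now apply (Ccont_Cdiff f z d).
  - now exists d.
Qed.

Lemma holo_off_minus l f g : holo_off l f -> holo_off l g -> holo_off l (fun z => f z - g z)%C.
Proof.
  intros [F1 F2] [G1 G2]. 
  replace (fun z => f z - g z)%C with (fun z => f z + (-(1)) * g z)%C
    by (apply functional_extensionality; intros; ring).
  split.
  - intros z. apply Ccont_plus; trivial. now apply Ccont_scal.
  - intros z Hz. destruct (F2 z Hz), (G2 z Hz). eexists. apply Cdiff_plus; [eassumption|].
    apply (Cdiff_mult (fun _ => _)); [apply Cdiff_const|eassumption].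
Qed.

Lemma holo_off_incl l l' f : incl l l' -> holo_off l f -> holo_off l' f.
Proof. intros Hl [H1 H2]. split; trivial. intros z Hz. apply H2. auto. Qed.

(** The quotient gets the derivative as its value at [a], which makes it continuous; as nothing more
    is known there, [a] joins the exceptional list. *)
Lemma divide_zero l f a : holo_off l f -> ~ In a l -> f a = 0 ->
  exists h, holo_off (a :: l) h /\ forall z, (f z = (z - a) * h z)%C.
Proof.
  intros [Hc Hd] Ha Hfa. destruct (Hd a Ha) as [d Hfd].
  set (h := fun z => if excluded_middle_informative (z = a) then d else (f z / (z - a))%C).
  assert (Hh : forall z, z <> a -> h z = (f z / (z - a))%C).
  { intros z Hz. unfold h. now destruct excluded_middle_informative. }
  assert (Hha : h a = d) by (unfold h; now destruct excluded_middle_informative).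
  assert (Hloc : forall z, z <> a -> forall w, Cmod (w - z) < Cmod (z - a) ->
    (f w * / (w - a))%C = h w).
  { intros z Hz w Hw. rewrite Hh; trivial. intros ->. rewrite Cmod_minus_sym in Hw. lra. }
  exists h. split; [split|].
  - intros z. destruct (classic (z = a)) as [->|Hz].
    + intros eps Heps. destruct (Hfd (eps / 2)) as [del [Hdel H1]]; [lra|].
      exists del. split; trivial. intros w Hw. rewrite Hha.
      destruct (classic (w = a)) as [->|Hwa].
      * rewrite Hha. replace (d - d)%C with (RtoC 0) by ring. now rewrite Cmod_0.
      * specialize (H1 w Hw). rewrite Hfa in H1. rewrite Hh by trivial.
        pose proof (Cminus_neq0 _ _ Hwa). pose proof (Cmod_minus_pos _ _ Hwa).
        replace (f w - 0 - d * (w - a))%C with ((f w / (w - a) - d) * (w - a))%C in H1 by (field;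
          trivial).
        rewrite Cmod_mult in H1. apply Rmult_le_reg_r in H1; lra.
    + apply (proj1 (near_ext _ _ z _ (Cmod_minus_pos _ _ Hz) (Hloc z Hz))).
      apply Ccont_mult; trivial. destruct (Cdiff_inv a z Hz) as [e He].
      now apply (Ccont_Cdiff _ z e).
  - intros z Hz. assert (Hza : z <> a) by (intros ->; apply Hz; now left).
    destruct (Hd z) as [e He]; [intros H; apply Hz; now right|].
    destruct (Cdiff_inv a z Hza) as [e' He']. eexists.
    apply (proj2 (near_ext _ _ z _ (Cmod_minus_pos _ _ Hza) (Hloc z Hza))).
    apply Cdiff_mult; eassumption.
  - intros z. destruct (classic (z = a)) as [->|Hz].
    + rewrite Hfa. ring.
    + rewrite Hh by trivial. field. now apply Cminus_neq0.
Qed.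

(** At distance at least 1/2 from [a], divide. If [z] is closer, the whole unit circle about [z] is
    at distance at least 1/2 from [a], and the mean value property carries the bound to [z]. *)
Lemma quotient_bound l f h a z S : holo_off l h -> (forall z, (f z = (z - a) * h z)%C) ->
  (forall w, Cmod (w - z) <= 1 -> Cmod (f w) <= S) -> Cmod (h z) <= 2 * S.
Proof.
  intros Hh Hf HS.
  assert (Haway : forall w, / 2 <= Cmod (w - a) -> Cmod (w - z) <= 1 -> Cmod (h w) <= 2 * S).
  { intros w Hw Hwz. specialize (HS w Hwz). rewrite Hf, Cmod_mult in HS.
    pose proof (Cmod_ge_0 (h w)). nra. }
  destruct (Rle_lt_dec (/ 2) (Cmod (z - a))) as [H|H].
  - apply Haway; trivial. replace (z - z)%C with (RtoC 0) by ring. rewrite Cmod_0; lra.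
  - apply (mean_value_bound l h z 1); trivial; [lra|]. intros w Hw. apply Haway; [|lra].
    pose proof (Cmod_triangle3 w a z). rewrite (Cmod_minus_sym a z) in H0. lra.
Qed.

Lemma C_complete_seq (u : nat -> C) :
  (forall eps, 0 < eps -> exists N, forall n m, (N <= n)%nat -> (N <= m)%nat ->
     Cmod (u n - u m) <= eps) ->
  exists l, forall eps, 0 < eps -> exists N, forall n, (N <= n)%nat -> Cmod (u n - l) <= eps.
Proof.
  intros H.
  assert (H1 : forall pr : C -> R, (forall z, Rabs (pr z) <= Cmod z) ->
    (forall z w, pr (z - w)%C = pr z - pr w) ->
    exists x, forall eps, 0 < eps -> exists N, forall n, (N <= n)%nat ->
      Rabs (pr (u n) - x) <= eps).
  { intros pr Hpr Hm. destruct (Rcomplete.R_complete (fun n => pr (u n))) as [x Hx].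
    - intros eps Heps. destruct (H (eps / 2)) as [N HN]; [lra|]. exists N. intros n m Hn Hm'.
      unfold Rdist. rewrite <- Hm. eapply Rle_lt_trans; [apply Hpr|].
      specialize (HN n m Hn Hm'). lra.
    - exists x. intros eps Heps. destruct (Hx eps Heps) as [N HN]. exists N. intros n Hn.
      left. now apply HN. }
  destruct (H1 fst) as [x Hx]; [apply Rabs_le_Cmod|reflexivity|].
  destruct (H1 snd) as [y Hy]; [apply Rabs_le_Cmod|reflexivity|].
  exists (x, y). intros eps Heps.
  destruct (Hx (eps / 2)) as [N1 HN1]; [lra|]. destruct (Hy (eps / 2)) as [N2 HN2]; [lra|].
  exists (max N1 N2). intros n Hn. specialize (HN1 n ltac:(lia)). specialize (HN2 n ltac:(lia)).
  eapply Rle_trans; [apply Cmod_le_sum|]. simpl. unfold Rminus in *. lra.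
Qed.

(** By [quotient_bound] the difference quotients [h k] at [a] are uniformly Cauchy on the unit disc
    about [a], and the limit of their values at [a] is the derivative. Radius 2 covers the unit
    discs about points of that disc. *)
Lemma entire_locally_uniform_limit (fk : nat -> C -> C) f : (forall k, entire (fk k)) ->
  (forall a eps, 0 < eps -> exists N, forall k, (N <= k)%nat -> forall w, Cmod (w - a) <= 2 ->
     Cmod (fk k w - f w) <= eps) ->
  entire f.
Proof.
  intros He Hu. apply entire_iff. intros a.
  assert (Hz : forall k, exists h, holo_off (a :: nil) h /\
     forall z, (fk k z - fk k a = (z - a) * h z)%C).
  { intros k. apply divide_zero; [|intros []|ring].
    apply holo_off_entire. apply entire_minus; [apply He|apply entire_const]. }
  destruct (choice _ Hz) as [h Hh]. clear Hz.
  assert (Hcau : forall eps, 0 < eps -> exists N, forall n m, (N <= n)%nat -> (N <= m)%nat ->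
     forall z, Cmod (z - a) <= 1 -> Cmod (h n z - h m z) <= eps).
  { intros eps Heps. destruct (Hu a (eps / 8)) as [N HN]; [lra|]. exists N. intros n m Hn Hm z Hza.
    destruct (Hh n) as [H1 H1']. destruct (Hh m) as [H2 H2'].
    replace eps with (2 * (eps / 2)) by field.
    apply (quotient_bound (a :: nil) (fun z => (fk n z - fk n a) - (fk m z - fk m a))%C
       (fun z => h n z - h m z)%C a).
    - now apply holo_off_minus.
    - intros w. rewrite H1', H2'. ring.
    - intros w Hw.
      pose proof (Cmod_triangle3 w z a).
      assert (Ha : Cmod (a - a) <= 2).
      { replace (a - a)%C with (RtoC 0) by ring. rewrite Cmod_0. lra. }
      pose proof (HN n Hn w ltac:(lra)). pose proof (HN m Hm w ltac:(lra)).
      pose proof (HN n Hn a Ha). pose proof (HN m Hm a Ha).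
      replace (fk n w - fk n a - (fk m w - fk m a))%C with
        ((fk n w - f w) - (fk m w - f w) - ((fk n a - f a) - (fk m a - f a)))%C by ring.
      eapply Rle_trans; [apply Cmod_minus_le|].
      eapply Rle_trans; [apply Rplus_le_compat; apply Cmod_minus_le|]. lra. }
  assert (Haa : Cmod (a - a) <= 1).
  { replace (a - a)%C with (RtoC 0) by ring. rewrite Cmod_0. lra. }
  destruct (C_complete_seq (fun k => h k a)) as [d Hd].
  { intros eps Heps. destruct (Hcau eps Heps) as [N HN]. exists N. intros n m Hn Hm.
    now apply HN. }
  exists d. intros eps Heps.
  destruct (Hcau (eps / 4)) as [N1 HN1]; [lra|].
  destruct (Hd (eps / 4)) as [N2 HN2]; [lra|].
  set (k := max N1 N2).
  destruct (Hh k) as [[Hkc _] Hk].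
  destruct (Hkc a (eps / 4)) as [del [Hdel Hkd]]; [lra|].
  exists (Rmin del 1). split; [apply Rmin_pos; lra|]. intros w Hw.
  pose proof (Rmin_l del 1). pose proof (Rmin_r del 1).
  specialize (HN2 k ltac:(lia)). specialize (Hkd w ltac:(lra)).
  destruct (classic (w = a)) as [->|Hwa].
  { replace (f a - f a - d * (a - a))%C with (RtoC 0) by ring. rewrite Cmod_0.
    pose proof (Cmod_ge_0 (a - a)). nra. }
  pose proof (Cmod_minus_pos _ _ Hwa) as Hpos.
  (* The index [m] may depend on [w], because the comparison of [h m] with [h k] is uniform in [m];
     so the error can be made small relative to the distance from [w] to [a]. *)
  destruct (Hu a (eps / 8 * Cmod (w - a))) as [N3 HN3]; [nra|].
  set (m := max N1 N3).
  pose proof (HN3 m ltac:(lia) w ltac:(lra)) as G1.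
  pose proof (HN3 m ltac:(lia) a ltac:(lra)) as G2.
  pose proof (HN1 m k ltac:(lia) ltac:(lia) w ltac:(lra)) as G3.
  destruct (Hh m) as [_ Hm].
  replace (f w - f a - d * (w - a))%C with
    ((fk m a - f a) - (fk m w - f w) + (w - a) * ((h m w - h k w) + ((h k w - h k a) + (h k a -
      d))))%C.
  2:{ transitivity ((fk m a - f a) - (fk m w - f w) + ((w - a) * h m w - (w - a) * d))%C; [ring|].
      rewrite <- Hm. ring. }
  eapply Rle_trans; [apply Cmod_triangle|].
  assert (Cmod ((fk m a - f a) - (fk m w - f w)) <= eps / 4 * Cmod (w - a)).
  { eapply Rle_trans; [apply Cmod_minus_le|]. lra. }
  assert (Cmod ((h m w - h k w) + ((h k w - h k a) + (h k a - d))) <= eps / 4 * 3).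
  { eapply Rle_trans; [apply Cmod_triangle|].
    eapply Rle_trans; [apply Rplus_le_compat_l, Cmod_triangle|]. lra. }
  rewrite Cmod_mult. nra.
Qed.

(** * Weights and uniform constants *)

Lemma half_pow_pos k : 0 < (/ 2) ^ k.
Proof. apply pow_lt. lra. Qed.

Lemma half_pow_small M eps : 0 <= M -> 0 < eps -> exists N, forall k, (N <= k)%nat ->
  M * (/ 2) ^ k <= eps.
Proof.
  intros HM Heps.
  destruct (pow_lt_1_zero (/ 2) ltac:(rewrite Rabs_pos_eq; lra) (eps / (M + 1))) as [N HN];
    [apply Rdiv_lt_0_compat; lra|].
  exists N. intros k Hk. specialize (HN k Hk). pose proof (half_pow_pos k).
  rewrite Rabs_pos_eq in HN by lra.
  apply (Rmult_lt_compat_r (M + 1)) in HN; [|lra].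
  unfold Rdiv in HN. rewrite Rmult_assoc, Rinv_l, Rmult_1_r in HN by lra. nra.
Qed.

Lemma le_by_half_pow x y M : 0 <= M -> (forall k, x <= y + M * (/ 2) ^ k) -> x <= y.
Proof.
  intros HM H. apply Rnot_lt_le; intros Hlt.
  destruct (half_pow_small M ((x - y) / 2)) as [N HN]; [trivial|lra|].
  specialize (HN N (le_n _)). specialize (H N). lra.
Qed.

Lemma geometric_limit (u : nat -> C) M : 0 <= M ->
  (forall k, Cmod (u (S k) - u k) <= M * (/ 2) ^ k) ->
  exists l, forall k, Cmod (l - u k) <= 2 * M * (/ 2) ^ k.
Proof.
  intros HM H.
  assert (H1 : forall k j, Cmod (u (k + j)%nat - u k) <= 2 * M * (/ 2) ^ k).
  { intros k j. apply Rle_trans with (2 * M * (/ 2) ^ k * (1 - (/ 2) ^ j)).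
    - induction j as [|j IH].
      + rewrite Nat.add_0_r. replace (u k - u k)%C with (RtoC 0) by ring. rewrite Cmod_0. simpl.
      lra.
      + rewrite Nat.add_succ_r. eapply Rle_trans; [apply (Cmod_triangle3 _ (u (k + j)%nat))|].
        eapply Rle_trans; [apply Rplus_le_compat; [apply H|apply IH]|].
        rewrite pow_add. simpl. apply Req_le. field.
    - pose proof (half_pow_pos k). pose proof (half_pow_pos j).
      assert (0 <= M * (/ 2) ^ k) by nra. nra. }
  assert (H2 : forall k n, (k <= n)%nat -> Cmod (u n - u k) <= 2 * M * (/ 2) ^ k).
  { intros k n Hkn. replace n with (k + (n - k))%nat by lia. apply H1. }
  destruct (C_complete_seq u) as [l Hl].
  { intros eps Heps. destruct (half_pow_small (4 * M) eps) as [N HN]; [lra|trivial|].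
    exists N. intros n m Hn Hm. specialize (HN N (le_n _)).
    eapply Rle_trans; [apply (Cmod_triangle3 _ (u N))|].
    rewrite (Cmod_minus_sym (u N)). pose proof (H2 N n Hn). pose proof (H2 N m Hm). lra. }
  exists l. intros k. apply Rnot_lt_le. intros Hlt.
  destruct (Hl ((Cmod (l - u k) - 2 * M * (/ 2) ^ k) / 2)) as [N HN]; [lra|].
  specialize (HN (max N k) ltac:(lia)). specialize (H2 k (max N k) ltac:(lia)).
  pose proof (Cmod_triangle3 l (u (max N k)) (u k)) as H3.
  rewrite (Cmod_minus_sym l (u (max N k))) in H3. lra.
Qed.

Fixpoint partial_sum (f : nat -> C -> C) (N : nat) (z : C) : C :=
  match N with
  | O => 0
  | S N' => (partial_sum f N' z + f N' z)%C
  end.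

Lemma entire_partial_sum f N : (forall k, entire (f k)) -> entire (partial_sum f N).
Proof.
  intros H. induction N as [|N IH]; simpl.
  - apply entire_const.
  - now apply (entire_plus (partial_sum f N)).
Qed.

Lemma weight_const p : weight p -> exists D E, 1 <= D /\ 0 < E /\
  forall z w, Cmod (z - w) <= 1 -> p z <= D * p w + E.
Proof.
  intros Hp. destruct (weight_doubling p Hp) as (D & E & HD & HE & H).
  exists (D + 1), E. repeat split; trivial; [lra|]. intros z w Hzw.
  specialize (H z w Hzw). pose proof (weight_nonneg p Hp w). nra.
Qed.

Lemma weight_locally_bounded p : weight p -> forall a, exists S, forall z, Cmod (z - a) <= 2 ->
  p z <= S.
Proof.
  intros Hp a. destruct (weight_const p Hp) as (D & E & HD & HE & H).
  exists (D * (D * p a + E) + E). intros z Hz.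
  (* Doubling reaches distance 1 only, so it is applied twice, through the midpoint. *)
  set (m := ((z + a) * (/ 2)%R)%C).
  assert (Hm : forall x : C, Cmod (x * (/ 2)%R) = Cmod x / 2).
  { intros x. rewrite Cmod_mult, Cmod_R, Rabs_pos_eq; lra. }
  assert (H2 : RtoC 2 <> 0) by (intros X; apply RtoC_inj in X; lra).
  assert (H22 : RtoC (/ 2) = (/ 2)%C) by (apply RtoC_inv; lra).
  assert (H3 : Cmod (z - m) <= 1).
  { replace (z - m)%C with ((z - a) * (/ 2)%R)%C; [rewrite Hm; lra|].
    unfold m. rewrite H22. field. }
  assert (H4 : Cmod (m - a) <= 1).
  { replace (m - a)%C with ((z - a) * (/ 2)%R)%C; [rewrite Hm; lra|].
    unfold m. rewrite H22. field. }
  apply H in H3, H4. nra.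
Qed.

Lemma weighted_series p (f : nat -> C -> C) M B : weight p -> 0 <= M -> 0 <= B ->
  (forall k, entire (f k)) ->
  (forall k z, Cmod (f k z) <= M * (/ 2) ^ k * exp (B * p z)) ->
  exists F, entire F /\ forall N z,
    Cmod (F z - partial_sum f N z) <= 2 * M * (/ 2) ^ N * exp (B * p z).
Proof.
  intros Hp HM HB He Hf.
  assert (Hl : forall z, exists l, forall k,
    Cmod (l - partial_sum f k z) <= 2 * (M * exp (B * p z)) * (/ 2) ^ k).
  { intros z. apply geometric_limit.
    - pose proof (exp_pos (B * p z)). nra.
    - intros k. simpl. replace (partial_sum f k z + f k z - partial_sum f k z)%C with (f k z) by
      ring.
      eapply Rle_trans; [apply Hf|]. apply Req_le. ring. }
  destruct (choice _ Hl) as [F HF]. exists F. split.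
  2:{ intros N z. eapply Rle_trans; [apply HF|]. apply Req_le. ring. }
  apply (entire_locally_uniform_limit (partial_sum f)).
  - intros k. now apply entire_partial_sum.
  - intros a eps Heps. destruct (weight_locally_bounded p Hp a) as [S HS].
    destruct (half_pow_small (2 * (M * exp (B * S))) eps) as [N HN]; trivial.
    { pose proof (exp_pos (B * S)). nra. }
    exists N. intros k Hk w Hw. rewrite Cmod_minus_sym.
    eapply Rle_trans; [apply HF|]. eapply Rle_trans; [|apply (HN k Hk)].
    pose proof (half_pow_pos k). apply Rmult_le_compat_r; [lra|].
    apply Rmult_le_compat_l; [lra|]. apply Rmult_le_compat_l; [lra|].
    apply exp_mono. apply Rmult_le_compat_l; [lra|]. now apply HS.
Qed.

Lemma exp_weight_le p A B A' B' z : weight p -> 0 <= A <= A' -> B <= B' ->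
  A * exp (B * p z) <= A' * exp (B' * p z).
Proof.
  intros Hp HA HB. pose proof (weight_nonneg p Hp z).
  apply Rmult_le_compat; [lra|left; apply exp_pos|lra|]. apply exp_mono. nra.
Qed.

Section Uniform.
Variables (p : C -> R) (L : C -> Prop) (phi : C -> R).
Hypothesis (Hp : weight p).
Hypothesis Hphi : forall z, L z -> 0 <= phi z.

(** Closed balls of the sup norm on [L] relative to [phi]; values off [L] are ignored. *)
Let ball (c : C -> C) (r : R) (w : C -> C) : Prop :=
  forall z, L z -> Cmod (w z - c z) <= r * phi z.

(** One integer bounds both growth constants, so that the extendable functions form a countable
    union. *)
Let ext (N : nat) (w : C -> C) : Prop :=
  exists f, entire f /\ (forall z, Cmod (f z) <= INR N * exp (INR N * p z)) /\
    forall z, L z -> f z = w z.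

(** Baire's argument: otherwise there are nested balls, the one after step [N] avoiding [ext N].
    Their common point is bounded by [phi], hence extends with some constants, and lies in some
    [ext N] after all. *)
Lemma some_ext_dense :
  (forall w, (forall z, L z -> Cmod (w z) <= phi z) ->
     exists f, in_Ap p f /\ forall z, L z -> f z = w z) ->
  exists N c r, 0 < r /\
    forall w d, 0 < d -> ball c r w -> exists w', ext N w' /\ ball w d w'.
Proof.
  intros Hall. apply NNPP; intros Hno.
  assert (Hnext : forall (N : nat) (q : (C -> C) * R), exists q' : (C -> C) * R,
     0 < snd q -> 0 < snd q' <= snd q / 2 /\ ball (fst q) (snd q / 2) (fst q') /\
       forall w, ext N w -> ~ ball (fst q') (snd q') w).
  { intros N [c r]. simpl. destruct (Rlt_dec 0 r) as [Hr|Hr].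
    2:{ exists (c, r). intros; contradiction. }
    apply NNPP; intros Hn. apply Hno. exists N, c, (r / 2). split; [lra|].
    (* If [ext N] has no element within [d] of [w], the ball of radius [Rmin d (r / 2)] about [w]
       avoids [ext N] and stays in the old ball, against [Hn]. *)
    intros w d Hd Hw. apply NNPP; intros Hn'. apply Hn. exists (w, Rmin d (r / 2)). intros _. simpl.
    pose proof (Rmin_l d (r / 2)). pose proof (Rmin_r d (r / 2)).
    split; [split; [apply Rmin_pos; lra|trivial]|]. split; [exact Hw|].
    intros w' He Hb. apply Hn'. exists w'. split; trivial. intros z Hz.
    eapply Rle_trans; [apply (Hb z Hz)|]. apply Rmult_le_compat_r; auto. }
  destruct (choice _ (fun N => choice _ (Hnext N))) as [nx Hnx].
  (* Starting from the unit ball about 0 keeps the limit of the centres bounded by [phi]; halving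
     the radii makes the centres converge. *)
  set (q := fix q n := match n with O => (fun _ => RtoC 0, 1) | S n => nx n (q n) end).
  assert (Hq : forall n, 0 < snd (q n) <= (/ 2) ^ n).
  { induction n as [|n IH]; [simpl; lra|]. destruct (Hnx n (q n)) as [H _]; [lra|].
    change (q (S n)) with (nx n (q n)). simpl. lra. }
  assert (Hqs : forall n, snd (q (S n)) <= snd (q n) / 2 /\ ball (fst (q n)) (snd (q n) / 2) (fst
    (q (S n))) /\
     forall w, ext n w -> ~ ball (fst (q (S n))) (snd (q (S n))) w).
  { intros n. destruct (Hnx n (q n)) as [H1 H2]; [apply Hq|]. split; [apply H1|exact H2]. }
  assert (Hin : forall n k z, L z ->
    Cmod (fst (q (n + k)%nat) z - fst (q n) z) + snd (q (n + k)%nat) * phi z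
      <= snd (q n) * phi z).
  { intros n k z Hz. induction k as [|k IH].
    - rewrite Nat.add_0_r. replace (fst (q n) z - fst (q n) z)%C with (RtoC 0) by ring.
    rewrite Cmod_0. lra.
    - rewrite Nat.add_succ_r. destruct (Hqs (n + k)%nat) as (H1 & H2 & _). specialize (H2 z Hz).
      pose proof (Cmod_triangle3 (fst (q (S (n + k))) z) (fst (q (n + k)%nat) z) (fst (q n) z)).
      pose proof (Hphi z Hz). nra. }
  assert (Hlim : forall z, exists l, L z ->
    forall k, Cmod (l - fst (q k) z) <= 2 * phi z * (/ 2) ^ k).
  { intros z. destruct (classic (L z)) as [Hz|Hz]; [|exists 0; contradiction].
    destruct (geometric_limit (fun k => fst (q k) z) (phi z) (Hphi z Hz)) as [l Hl].
    - intros k. destruct (Hqs k) as (_ & H2 & _). specialize (H2 z Hz).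
      eapply Rle_trans; [exact H2|]. pose proof (Hq k). pose proof (Hphi z Hz). nra.
    - exists l. intros _. exact Hl. }
  destruct (choice _ Hlim) as [c Hc].
  assert (Hcb : forall n, ball (fst (q n)) (snd (q n)) c).
  { intros n z Hz. apply le_by_half_pow with (2 * phi z); [pose proof (Hphi z Hz); lra|].
    intros k. specialize (Hc z Hz (n + k)%nat). specialize (Hin n k z Hz).
    pose proof (Cmod_triangle3 (c z) (fst (q (n + k)%nat) z) (fst (q n) z)).
    pose proof (Hphi z Hz). pose proof (Hq (n + k)%nat).
    assert ((/ 2) ^ (n + k) <= (/ 2) ^ k).
    { rewrite pow_add. pose proof (half_pow_pos k). pose proof (half_pow_pos n).
      assert ((/ 2) ^ n <= 1) by (rewrite <- (pow1 n); apply pow_incr; lra). nra. }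
    nra. }
  destruct (Hall c) as [f [[He (A & B & HA & HB & Hf)] Hfc]].
  { intros z Hz. specialize (Hcb O z Hz). simpl in Hcb.
    replace (c z - 0)%C with (c z) in Hcb by ring. lra. }
  destruct (nfloor_ex (Rmax A B)) as [n Hn].
  { apply Rle_trans with A; [lra|apply Rmax_l]. }
  destruct (Hqs (S n)) as (_ & _ & H). apply (H c); [|apply Hcb].
  exists f. split; trivial. split; trivial. intros z.
  eapply Rle_trans; [apply Hf|]. rewrite S_INR.
  pose proof (Rmax_l A B). pose proof (Rmax_r A B). apply exp_weight_le; trivial; lra.
Qed.

(* An open mapping theorem: Baire category gives solvability up to an arbitrarily small error
   with uniform constants, and a geometric series of corrections removes the error. *)
Lemma uniform_extension :
  (forall w, (forall z, L z -> Cmod (w z) <= phi z) ->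
     exists f, in_Ap p f /\ forall z, L z -> f z = w z) ->
  exists M B, 0 < M /\ 0 < B /\ forall w, (forall z, L z -> Cmod (w z) <= phi z) ->
     exists f, entire f /\ (forall z, Cmod (f z) <= M * exp (B * p z)) /\
       forall z, L z -> f z = w z.
Proof.
  intros Hall. destruct (some_ext_dense Hall) as (N & c & r & Hr & Hd).
  set (B := INR N). set (M := 2 * B / r).
  assert (HB : 0 <= B) by apply pos_INR.
  assert (HM : 0 <= M) by (apply Rmult_le_pos; [lra|left; now apply Rinv_0_lt_compat]).
  assert (Hrc : RtoC r <> 0) by (intros X; apply RtoC_inj in X; lra).
  (* [w] is the difference of the two ball elements [c + r * w] and [c], divided by [r].
     Approximating each within [r / 4] leaves an error of [phi / 2], and [M = 2 * B / r] bounds the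
     quotient. *)
  assert (Hhalf : forall w, exists g, (forall z, L z -> Cmod (w z) <= phi z) ->
    entire g /\ (forall z, Cmod (g z) <= M * exp (B * p z)) /\
    forall z, L z -> Cmod (w z - g z) <= phi z / 2).
  { intros w. destruct (classic (forall z, L z -> Cmod (w z) <= phi z)) as [Hw|Hw].
    2:{ exists w. contradiction. }
    destruct (Hd (fun z => c z + r * w z)%C (r / 4)) as (w1 & (f1 & E1 & G1 & F1) & B1); [lra| |].
    { intros z Hz. replace (c z + r * w z - c z)%C with (r * w z)%C by ring.
      rewrite Cmod_mult, Cmod_R, Rabs_pos_eq by lra. specialize (Hw z Hz). nra. }
    destruct (Hd c (r / 4)) as (w2 & (f2 & E2 & G2 & F2) & B2); [lra| |].
    { intros z Hz. replace (c z - c z)%C with (RtoC 0) by ring. rewrite Cmod_0.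
      pose proof (Hphi z Hz). nra. }
    exists (fun z => (/ r)%R * (f1 z - f2 z))%C. intros _. split; [|split].
    - apply (entire_mult (fun _ => _)); [apply entire_const|now apply entire_minus].
    - intros z. rewrite Cmod_mult, Cmod_R, Rabs_pos_eq by (left; now apply Rinv_0_lt_compat).
      specialize (G1 z). specialize (G2 z). fold B in G1, G2.
      apply Rle_trans with (/ r * (2 * B * exp (B * p z))).
      + apply Rmult_le_compat_l; [left; now apply Rinv_0_lt_compat|].
        eapply Rle_trans; [apply Cmod_minus_le|]. lra.
      + apply Req_le. unfold M. field. lra.
    - intros z Hz. rewrite F1, F2 by trivial.
      replace (w z - (/ r)%R * (w1 z - w2 z))%C with
        ((/ r)%R * ((w2 z - c z) - (w1 z - (c z + r * w z))))%C.
      2:{ rewrite RtoC_inv by lra. field. trivial. }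
      rewrite Cmod_mult, Cmod_R, Rabs_pos_eq by (left; now apply Rinv_0_lt_compat).
      apply Rle_trans with (/ r * (r / 2 * phi z)).
      + apply Rmult_le_compat_l; [left; now apply Rinv_0_lt_compat|].
        eapply Rle_trans; [apply Cmod_minus_le|]. specialize (B1 z Hz). specialize (B2 z Hz). lra.
      + apply Req_le. field. lra. }
  destruct (choice _ Hhalf) as [g Hg].
  exists (2 * M + 1), (B + 1). split; [lra|]. split; [lra|]. intros w Hw.
  (* The error is doubled to be bounded by [phi] again; the remainder after [k] corrections is
     [ws k] times [(/ 2) ^ k]. *)
  set (ws := fix ws k := match k with O => w | S k => fun z => (2 * (ws k z - g (ws k) z))%C end).
  assert (Hws : forall k z, L z -> Cmod (ws k z) <= phi z).
  { induction k as [|k IH]; [exact Hw|]. intros z Hz. simpl.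
    destruct (Hg (ws k) IH) as (_ & _ & H). specialize (H z Hz).
    rewrite Cmod_mult, Cmod_R, Rabs_pos_eq by lra. lra. }
  set (fk := fun k z => (RtoC ((/ 2) ^ k) * g (ws k) z)%C).
  assert (Hsum : forall k z, (w z - partial_sum fk k z = RtoC ((/ 2) ^ k) * ws k z)%C).
  { induction k as [|k IH]; intros z.
    - simpl. ring.
    - simpl partial_sum. replace (w z - (partial_sum fk k z + fk k z))%C with (w z - partial_sum
      fk k z - fk k z)%C by ring.
      rewrite IH. unfold fk. simpl ws. simpl pow. rewrite RtoC_mult, RtoC_inv by lra. field. }
  destruct (weighted_series p fk M B Hp HM HB) as (F & HF & HFs).
  { intros k. apply (entire_mult (fun _ => _)); [apply entire_const|].
    apply (Hg (ws k) (Hws k)). }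
  { intros k z. unfold fk. pose proof (half_pow_pos k).
    rewrite Cmod_mult, Cmod_R, Rabs_pos_eq by lra.
    destruct (Hg (ws k) (Hws k)) as (_ & H1 & _). specialize (H1 z). nra. }
  exists F. split; trivial. split.
  - intros z. specialize (HFs O z). simpl in HFs.
    replace (F z - 0)%C with (F z) in HFs by ring.
    eapply Rle_trans; [exact HFs|]. rewrite Rmult_1_r. apply exp_weight_le; trivial; lra.
  - intros z Hz. pose proof (Hphi z Hz). pose proof (exp_pos (B * p z)).
    assert (H1 : Cmod (F z - w z) <= 0).
    { apply le_by_half_pow with (2 * M * exp (B * p z) + phi z); [nra|]. intros k.
      eapply Rle_trans; [apply (Cmod_triangle3 _ (partial_sum fk k z))|].
      specialize (HFs k z). rewrite (Cmod_minus_sym (partial_sum fk k z)), Hsum.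
      pose proof (half_pow_pos k). rewrite Cmod_mult, Cmod_R, Rabs_pos_eq by lra.
      specialize (Hws k z Hz). nra. }
    pose proof (Cmod_ge_0 (F z - w z)).
    assert (H3 : (F z - w z)%C = 0) by (apply Cmod_eq_0; lra).
    replace (F z) with ((F z - w z) + w z)%C by ring. rewrite H3. ring.
Qed.
End Uniform.

(** * Divided differences over lists *)

Definition diff_quot (W : C -> C) (x z : C) : C := ((W z - W x) / (z - x))%C.

(** Divided differences computed by taking out one point at a time and passing to the difference
    quotient. This form parallels division of an entire function by [z - x] and reduces symmetry to
    swapping two points. The empty list has the dummy value 0. *)
Fixpoint ldd (l : list C) (W : C -> C) : C :=
  match l with
  | nil => 0
  | x :: l' => match l' with nil => W x | _ => ldd l' (diff_quot W x) end
  end.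

Lemma ldd_cons x l W : l <> nil -> ldd (x :: l) W = ldd l (diff_quot W x).
Proof. destruct l; [contradiction|reflexivity]. Qed.

Lemma ldd_ext l : forall W W', (forall x, In x l -> W x = W' x) -> ldd l W = ldd l W'.
Proof.
  induction l as [|x l IH]; intros W W' H; [reflexivity|].
  destruct l as [|y l]; [simpl; apply H; now left|].
  rewrite !ldd_cons by discriminate. apply IH. intros z Hz.
  unfold diff_quot. rewrite (H x), (H z); [reflexivity|now right|now left].
Qed.

Lemma NoDup_cons2 (x y : C) l : NoDup (x :: y :: l) -> x <> y /\ ~ In x l /\ ~ In y l /\ NoDup l.
Proof.
  intros H. inversion H as [|? ? Hx H1]; subst. inversion H1; subst.
  simpl in Hx. intuition congruence.
Qed.

Lemma neq_of_notin (x z : C) l : ~ In x l -> In z l -> z <> x.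
Proof. congruence. Qed.

Lemma ldd_swap x y l W : NoDup (x :: y :: l) -> ldd (x :: y :: l) W = ldd (y :: x :: l) W.
Proof.
  intros H. apply NoDup_cons2 in H. destruct H as (Hxy & Hx & Hy & _).
  pose proof (Cminus_neq0 _ _ Hxy). pose proof (Cminus_neq0 y x ltac:(congruence)).
  destruct l as [|z l].
  - simpl. unfold diff_quot. field. tauto.
  - rewrite !(ldd_cons _ (_ :: _ :: _)), !(ldd_cons _ (z :: l)) by discriminate. apply ldd_ext.
    intros w Hw. pose proof (Cminus_neq0 _ _ (neq_of_notin _ _ _ Hx Hw)).
    pose proof (Cminus_neq0 _ _ (neq_of_notin _ _ _ Hy Hw)).
    unfold diff_quot. field. tauto.
Qed.

Lemma ldd_perm l l' : Permutation l l' -> forall W, NoDup l -> ldd l W = ldd l' W.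
Proof.
  intros HP. induction HP; intros W Hl.
  - reflexivity.
  - destruct l as [|y l].
    + apply Permutation_nil in HP. now subst.
    + destruct l' as [|y' l']; [now apply Permutation_sym, Permutation_nil in HP|].
      rewrite !ldd_cons by discriminate. apply IHHP. now inversion Hl.
  - now apply ldd_swap.
  - rewrite IHHP1 by trivial. apply IHHP2. now apply (Permutation_NoDup HP1).
Qed.

Lemma ldd_minus l : forall W W', ldd l (fun z => W z - W' z)%C = (ldd l W - ldd l W')%C.
Proof.
  induction l as [|x l IH]; intros W W'; [simpl; ring|].
  destruct l as [|y l]; [reflexivity|]. rewrite !(ldd_cons x (y :: l)) by discriminate.
  rewrite <- IH.
  apply ldd_ext. intros z _. unfold diff_quot, Cdiv. ring.
Qed.

Lemma ldd_const x l c : l <> nil -> ldd (x :: l) (fun _ => c) = 0.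
Proof.
  revert x c. induction l as [|y l IH]; intros x c Hl; [contradiction|].
  rewrite ldd_cons by discriminate.
  rewrite (ldd_ext _ _ (fun _ => RtoC 0)) by (intros z _; unfold diff_quot, Cdiv; ring).
  destruct l as [|z l]; [reflexivity|]. now apply IH.
Qed.

(** The recursion defining divided differences, in symmetric form: it prices the exchange of [b] for
    [a]. A common point [c] is moved to the front by symmetry, which reduces the claim to the
    difference quotient at [c]. *)
Lemma ldd_exchange l : forall a b W, NoDup (a :: b :: l) ->
  (ldd (a :: l) W - ldd (b :: l) W = (a - b) * ldd (a :: b :: l) W)%C.
Proof.
  induction l as [|c l IH]; intros a b W H.
  - apply NoDup_cons2 in H. destruct H as (Hab & _). simpl. unfold diff_quot.
    pose proof (Cminus_neq0 b a ltac:(congruence)). field. trivial.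
  - rewrite (ldd_perm (a :: c :: l) (c :: a :: l)), (ldd_perm (b :: c :: l) (c :: b :: l)),
      (ldd_perm (a :: b :: c :: l) (c :: a :: b :: l)).
    + rewrite !(ldd_cons c) by discriminate. apply IH. apply NoDup_cons2 in H.
      destruct H as (H1 & H2 & H3 & H4). inversion H4; subst. simpl in *.
      repeat constructor; simpl; intuition congruence.
    + apply perm_trans with (a :: c :: b :: l); [apply perm_skip|]; apply perm_swap.
    + trivial.
    + apply perm_swap.
    + now inversion H.
    + apply perm_swap.
    + inversion H as [|? ? H1 H2]; subst. inversion H2; subst. constructor; trivial.
      simpl in *; intuition congruence.
Qed.

Definition dist_prod (x : C) (l : list C) : R := fold_right (fun y r => Cmod (x - y) * r) 1 l.

Lemma dist_prod_ge0 x l : 0 <= dist_prod x l.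
Proof. induction l; simpl; [lra|]. apply Rmult_le_pos; [apply Cmod_ge_0|trivial]. Qed.

Lemma dist_prod_pos x l : ~ In x l -> 0 < dist_prod x l.
Proof.
  induction l as [|y l IH]; simpl; intros H; [lra|].
  apply Rmult_lt_0_compat; [apply Cmod_minus_pos; intros ->; tauto|tauto].
Qed.

(** The only surviving term of Lagrange's formula: passing to the quotient at a zero [y] divides the
    value at [x] by [x - y]. *)
Lemma ldd_single l : forall x (W : C -> C), NoDup (x :: l) -> (forall y, In y l -> W y = RtoC 0) ->
  Cmod (W x) = Cmod (ldd (x :: l) W) * dist_prod x l.
Proof.
  induction l as [|y l IH]; intros x W H HW; [simpl; lra|].
  rewrite ldd_swap by trivial. rewrite ldd_cons by discriminate. simpl dist_prod.
  apply NoDup_cons2 in H. destruct H as (H1 & H2 & H3 & H4).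
  rewrite (Rmult_comm (Cmod (x - y))), <- Rmult_assoc, <- (IH x (diff_quot W y)).
  - rewrite <- Cmod_mult. f_equal. unfold diff_quot. rewrite (HW y) by now left. field.
    now apply Cminus_neq0.
  - now constructor.
  - intros z Hz. unfold diff_quot. rewrite (HW y), (HW z); [|now right|now left]. unfold Cdiv. ring.
Qed.

(* By Lagrange's formula each of the [length l] points contributes at most 1. *)
Lemma ldd_bound_dist_prod l (W : C -> C) : NoDup l ->
  (forall x l', Permutation l (x :: l') -> Cmod (W x) <= dist_prod x l') ->
  Cmod (ldd l W) <= INR (length l).
Proof.
  intros Hl HW.
  (* Induction on a list [s] carrying the support of [W] within [l]: each step splits off the part
     of [W] at one point, to which [ldd_single] applies. *)
  enough (H : forall s (W : C -> C), incl s l ->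
     (forall x l', Permutation l (x :: l') -> Cmod (W x) <= dist_prod x l') ->
     (forall x, In x l -> ~ In x s -> W x = RtoC 0) -> Cmod (ldd l W) <= INR (length s)).
  { apply H; [apply incl_refl|exact HW|tauto]. }
  clear W HW. induction s as [|x s IH]; intros W Hs HW H0.
  - rewrite (ldd_ext l W (fun _ => RtoC 0)) by (intros x Hx; apply H0; auto).
    destruct l as [|x [|y l]]; [simpl; rewrite Cmod_0; lra..|].
    rewrite ldd_const by discriminate. rewrite Cmod_0. simpl; lra.
  - assert (Hxl : In x l) by (apply Hs; now left).
    destruct (in_split x l Hxl) as (l1 & l2 & E).
    assert (HP : Permutation l (x :: l1 ++ l2)) by (rewrite E; symmetry; apply Permutation_middle).
    set (W1 := fun z => if excluded_middle_informative (z = x) then W z else RtoC 0).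
    set (W2 := fun z => if excluded_middle_informative (z = x) then RtoC 0 else W z).
    assert (EW : ldd l W = (ldd l W1 - ldd l (fun z => - W2 z))%C).
    { rewrite <- ldd_minus. apply ldd_ext. intros z _. unfold W1, W2.
      destruct excluded_middle_informative; ring. }
    rewrite EW. eapply Rle_trans; [apply Cmod_minus_le|].
    simpl length. rewrite S_INR, Rplus_comm. apply Rplus_le_compat.
    + apply IH.
      * intros z Hz; apply Hs; now right.
      * intros z l' Hz. unfold W2. destruct excluded_middle_informative.
        -- rewrite Cmod_opp, Cmod_0. apply dist_prod_ge0.
        -- rewrite Cmod_opp. now apply HW.
      * intros z Hz Hzs. unfold W2. destruct excluded_middle_informative as [|Hne]; [ring|].
        rewrite H0; [ring|trivial|]. intros [->|]; tauto.
    + rewrite (ldd_perm _ _ HP) by trivial.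
      pose proof (Permutation_NoDup HP Hl) as Hn.
      assert (Hx : ~ In x (l1 ++ l2)) by now inversion Hn.
      pose proof (dist_prod_pos _ _ Hx) as Hp.
      pose proof (ldd_single (l1 ++ l2) x W1 Hn) as Hs1.
      specialize (HW x _ HP). apply Rmult_le_reg_r with (dist_prod x (l1 ++ l2)); [trivial|].
      rewrite <- Hs1.
      * unfold W1. destruct excluded_middle_informative; [lra|contradiction].
      * intros y Hy. unfold W1. destruct excluded_middle_informative; [subst;
        contradiction|trivial].
Qed.

Definition weight_sum (p : C -> R) (l : list C) : R := fold_right (fun x s => p x + s) 0 l.

Lemma weight_sum_app p l l' : weight_sum p (l ++ l') = weight_sum p l + weight_sum p l'.
Proof. induction l as [|x l IH]; simpl; [lra|rewrite IH; lra]. Qed.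

Lemma weight_sum_perm p l l' : Permutation l l' -> weight_sum p l = weight_sum p l'.
Proof. intros H. induction H; simpl; lra. Qed.

Lemma weight_sum_ge0 p l : weight p -> 0 <= weight_sum p l.
Proof.
  intros Hp. induction l as [|x l IH]; simpl; [lra|]. pose proof (weight_nonneg p Hp x). lra.
Qed.

(** Indexed by the number of points, one more than the order. The exponent may be 0, unlike that of
    [in_X], hence the [B + 1] when passing back. *)
Definition list_X (p : C -> R) (L : C -> Prop) (n : nat) (W : C -> C) : Prop :=
  exists M B, 0 <= M /\ 0 <= B /\ forall l, length l = n -> NoDup l -> (forall x, In x l -> L x) ->
    Cmod (ldd l W) <= M * exp (B * weight_sum p l).

Definition extend {L : C -> Prop} (w : family_on L) (z : C) : C :=
  match excluded_middle_informative (L z) with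
  | left H => w (exist _ z H)
  | right _ => 0
  end.

Lemma extend_pval {L : C -> Prop} (w : family_on L) x : extend w (pval x) = w x.
Proof.
  unfold extend. destruct x as [z Hz]; simpl.
  destruct excluded_middle_informative as [H|H]; [|contradiction].
  now rewrite (proof_irrelevance _ H Hz).
Qed.

Definition tuple_list {L : C -> Prop} (x : nat -> Defs.point_of L) (n : nat) : list C :=
  map (fun i => pval (x i)) (seq 0 n).

Lemma tuple_list_snoc {L : C -> Prop} (x : nat -> Defs.point_of L) n :
  tuple_list x (S n) = tuple_list x n ++ pval (x n) :: nil.
Proof. unfold tuple_list. now rewrite seq_S, map_app. Qed.

Lemma tuple_list_cons {L : C -> Prop} (x : nat -> Defs.point_of L) n :
  tuple_list x (S n) = pval (x O) :: tuple_list (fun i => x (S i)) n.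
Proof. unfold tuple_list. simpl. now rewrite <- seq_shift, map_map. Qed.

Lemma tuple_list_NoDup {L : C -> Prop} (x : nat -> Defs.point_of L) n :
  distinct_tuple n x -> NoDup (tuple_list x n).
Proof.
  intros H. unfold tuple_list.
  apply NoDup_nth with (d := pval (x O)). rewrite length_map, length_seq.
  intros i j Hi Hj E. apply NNPP; intros Hij. apply (H i j Hi Hj Hij).
  rewrite !(map_nth (fun i => pval (x i)) (seq 0 n) O), !seq_nth in E by trivial. exact E.
Qed.

(** [divdiff] compares the tuples without the first and without the last point. By symmetry the last
    point moves to the front, and [ldd_exchange] for the last and first points is this recursion. *)
Lemma divdiff_ldd {L : C -> Prop} (w : family_on L) m : forall x, distinct_tuple (S m) x ->
  divdiff w m x = ldd (tuple_list x (S m)) (extend w).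
Proof.
  induction m as [|m IH]; intros x Hx.
  - simpl. now rewrite extend_pval.
  - simpl divdiff. rewrite !IH.
    2:{ intros i k Hi Hk. apply Hx; lia. }
    2:{ intros i k Hi Hk Hik. apply Hx; lia. }
    assert (Hn := tuple_list_NoDup x (S (S m)) Hx).
    rewrite tuple_list_cons, tuple_list_snoc in Hn.
    set (l := tuple_list (fun i => x (S i)) m) in *.
    rewrite (tuple_list_cons x (S m)), (tuple_list_cons x m), tuple_list_snoc. fold l.
    assert (HP : Permutation (pval (x O) :: l ++ pval (x (S m)) :: nil) (pval (x (S m)) :: pval (x
      O) :: l)).
    { symmetry. exact (Permutation_cons_append (_ :: l) _). }
    pose proof (Permutation_NoDup HP Hn) as Hn'.
    rewrite (ldd_perm _ _ HP) by trivial.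
    rewrite (ldd_perm (l ++ _ :: nil) (pval (x (S m)) :: l)).
    + rewrite ldd_exchange by trivial. apply NoDup_cons2 in Hn'. field.
      apply Cminus_neq0. tauto.
    + symmetry. apply Permutation_cons_append.
    + now inversion Hn.
Qed.

Lemma weight_sum_tuple_list {L : C -> Prop} (p : C -> R) (x : nat -> Defs.point_of L) m :
  sum_f_R0 (fun i => p (pval (x i))) m = weight_sum p (tuple_list x (S m)).
Proof.
  induction m as [|m IH]; [simpl; lra|].
  simpl sum_f_R0. rewrite IH, (tuple_list_snoc x (S m)), weight_sum_app. simpl. lra.
Qed.

Lemma list_tuple {L : C -> Prop} (l : list C) : l <> nil -> (forall x, In x l -> L x) -> NoDup l ->
  exists x : nat -> Defs.point_of L, distinct_tuple (length l) x /\ tuple_list x (length l) = l.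
Proof.
  intros Hl HL Hn. destruct l as [|a l0] eqn:El; [contradiction|]. rewrite <- El in *. clear Hl.
  assert (Ha : L a) by (apply HL; rewrite El; now left).
  assert (H : forall i, exists q : Defs.point_of L, pval q = nth i l a).
  { intros i. assert (Hi : L (nth i l a)) by (destruct (nth_in_or_default i l a) as [H| ->]; auto).
    now exists (exist _ _ Hi). }
  destruct (choice _ H) as [x Hx]. exists x. split.
  - intros i k Hi Hk Hik. rewrite !Hx. intros E. apply Hik.
    now apply (proj1 (NoDup_nth l a) Hn).
  - unfold tuple_list. apply nth_ext with (d := a) (d' := a).
    + now rewrite length_map, length_seq.
    + rewrite length_map, length_seq. intros i Hi.
      rewrite (nth_indep _ a (pval (x O))) by now rewrite length_map, length_seq.
      rewrite (map_nth (fun i => pval (x i)) (seq 0 (length l)) O), seq_nth by trivial. apply Hx.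
Qed.

Lemma in_X_list_X p (L : C -> Prop) m (w : family_on L) : weight p ->
  in_X p L m w <-> list_X p L (S m) (extend w).
Proof.
  intros Hp. split.
  - intros (B & HB & M & H). exists (Rmax M 0), B. split; [apply Rmax_r|]. split; [lra|].
    intros l Hlen Hn HL.
    destruct (list_tuple (L := L) l) as (x & Hx & E); trivial; [now destruct l|].
    rewrite Hlen in Hx, E. specialize (H x Hx).
    rewrite divdiff_ldd, weight_sum_tuple_list, E in H by trivial.
    apply Rmult_le_reg_r with (exp (- B * weight_sum p l)); [apply exp_pos|].
    rewrite Rmult_assoc, <- exp_plus.
    replace (B * weight_sum p l + - B * weight_sum p l) with 0 by ring.
    rewrite exp_0, Rmult_1_r. eapply Rle_trans; [exact H|apply Rmax_l].
  - intros (M & B & HM & HB & H). exists (B + 1). split; [lra|]. exists M. intros x Hx.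
    rewrite divdiff_ldd, weight_sum_tuple_list by trivial.
    set (l := tuple_list x (S m)).
    assert (Hl : Cmod (ldd l (extend w)) <= M * exp (B * weight_sum p l)).
    { apply H; [unfold l, tuple_list;
      now rewrite length_map, length_seq|now apply tuple_list_NoDup|].
      intros z Hz. unfold l, tuple_list in Hz. apply in_map_iff in Hz. destruct Hz as (i & <- & _).
      exact (proj2_sig (x i)). }
    apply Rmult_le_compat_r with (r := exp (- (B + 1) * weight_sum p l)) in Hl; [|left;
      apply exp_pos].
    eapply Rle_trans; [exact Hl|]. rewrite Rmult_assoc, <- exp_plus.
    rewrite <- (Rmult_1_r M) at 2. apply Rmult_le_compat_l; trivial.
    apply Rle_trans with (exp 0); [apply exp_mono|rewrite exp_0; lra].
    pose proof (weight_sum_ge0 p l Hp). lra.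
Qed.

(** * Growth estimates *)

Section Growth.
Variable p : C -> R.
Hypothesis Hp : weight p.

(** [A'] and [B'] depend on [B] alone and [M] enters linearly, so that the division can be iterated
    with uniform constants. Doubling moves the weight from the unit disc to its centre. *)
Lemma divide_zero_growth B : 0 <= B -> exists A' B', 0 < A' /\ 0 <= B' /\
  forall M l f a, 0 <= M -> holo_off l f -> ~ In a l -> f a = RtoC 0 ->
    (forall z, Cmod (f z) <= M * exp (B * p z)) ->
    exists h, holo_off (a :: l) h /\ (forall z, (f z = (z - a) * h z)%C) /\
      forall z, Cmod (h z) <= M * A' * exp (B' * p z).
Proof.
  intros HB. destruct (weight_const p Hp) as (D & E & HD & HE & H).
  exists (2 * exp (B * E)), (B * D). pose proof (exp_pos (B * E)).
  split; [lra|]. split; [nra|]. intros M l f a HM Hf Ha Hfa Hg.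
  destruct (divide_zero l f a Hf Ha Hfa) as (h & Hh & Hfh).
  exists h. split; trivial. split; trivial. intros z.
  replace (M * (2 * exp (B * E)) * exp (B * D * p z)) with (2 * (M * (exp (B * E) * exp (B * D * p
    z)))) by ring.
  apply (quotient_bound (a :: l) f h a); trivial. intros w Hw.
  eapply Rle_trans; [apply Hg|]. apply Rmult_le_compat_l; trivial.
  rewrite <- exp_plus. apply exp_mono. specialize (H w z Hw). nra.
Qed.

(** Each point [x] taken out is a zero of [f - f x]; dividing there costs constants, and the size of
    [f x] goes into [M], where it supplies the weight of [x]. *)
Lemma ldd_growth n : forall B, 0 <= B -> exists A' B', 0 <= A' /\ 0 <= B' /\
  forall M l0 f, 0 <= M -> holo_off l0 f -> (forall z, Cmod (f z) <= M * exp (B * p z)) ->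
    forall l, length l = S n -> NoDup l -> (forall x, In x l -> ~ In x l0) ->
    Cmod (ldd l f) <= M * A' * exp (B' * weight_sum p l).
Proof.
  induction n as [|n IH]; intros B HB.
  - exists 1, B. split; [lra|]. split; trivial. intros M l0 f HM _ Hf l Hl _ _.
    destruct l as [|x [|y l]]; try discriminate. simpl. rewrite Rmult_1_r, Rplus_0_r. apply Hf.
  - destruct (divide_zero_growth B HB) as (A1 & B1 & HA1 & HB1 & Hdiv).
    destruct (IH B1 HB1) as (A2 & B2 & HA2 & HB2 & Hnd).
    exists (2 * A1 * A2), (B + B2). split; [nra|]. split; [lra|].
    intros M l0 f HM Hh Hf l Hl Hn Hd.
    destruct l as [|x l]; [discriminate|]. simpl in Hl. injection Hl as Hl.
    inversion Hn as [|? ? Hx Hn']; subst.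
    (* Both exponentials are at least 1, so their sum is at most twice their product. *)
    set (M' := 2 * M * exp (B * p x)).
    assert (HM' : 0 <= M') by (unfold M'; pose proof (exp_pos (B * p x)); nra).
    destruct (Hdiv M' l0 (fun z => f z - f x)%C x HM') as (h & Hhh & Hfh & Hg).
    + apply holo_off_minus; trivial. apply holo_off_incl with nil; [intros ? []|].
      apply holo_off_entire, entire_const.
    + apply Hd. now left.
    + ring.
    + intros z. eapply Rle_trans; [apply Cmod_minus_le|].
      pose proof (Hf z) as G1. pose proof (Hf x) as G2. unfold M'.
      assert (1 <= exp (B * p z)) by (rewrite <- exp_0; apply exp_mono;
        pose proof (weight_nonneg p Hp z); nra).
      assert (1 <= exp (B * p x)) by (rewrite <- exp_0; apply exp_mono;
        pose proof (weight_nonneg p Hp x); nra).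
      set (ez := exp (B * p z)) in *. set (ex := exp (B * p x)) in *.
      assert (0 <= (ez - 1) * (ex - 1)) by nra.
      assert (0 <= M * ((ez - 1) * ex)) by (repeat apply Rmult_le_pos; lra).
      assert (0 <= M * ((ex - 1) * ez)) by (repeat apply Rmult_le_pos; lra). lra.
    + rewrite ldd_cons by now destruct l.
      rewrite (ldd_ext l _ h).
      2:{ intros z Hz. unfold diff_quot. rewrite Hfh. field. apply Cminus_neq0.
      now apply (neq_of_notin _ _ l). }
      eapply Rle_trans; [apply (Hnd (M' * A1) (x :: l0) h)|]; trivial; [nra| |].
      * intros z Hz [->|Hz0]; [contradiction|]. apply (Hd z); trivial. now right.
      * unfold M'. simpl weight_sum. rewrite Rmult_plus_distr_l, exp_plus.
        pose proof (exp_pos (B * p x)). pose proof (exp_pos (B2 * weight_sum p l)).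
        pose proof (weight_nonneg p Hp x). pose proof (weight_sum_ge0 p l Hp).
        assert (exp (B * p x) <= exp ((B + B2) * p x)) by (apply exp_mono; nra).
        assert (exp (B2 * weight_sum p l) <= exp ((B + B2) * weight_sum p l)) by (apply exp_mono;
          nra).
        assert (exp (B * p x) * exp (B2 * weight_sum p l) <= exp ((B + B2) * p x) * exp ((B + B2)
          * weight_sum p l))
          by (apply Rmult_le_compat; lra).
        assert (0 <= 2 * M * A1 * A2) by (repeat apply Rmult_le_pos; lra). nra.
Qed.

(** After division by one zero, the other points are still zeros of the quotient, so the distances
    come out one by one. *)
Lemma zeros_growth n : forall B, 0 <= B -> exists A' B', 0 <= A' /\ 0 <= B' /\
  forall M l0 f, 0 <= M -> holo_off l0 f -> (forall z, Cmod (f z) <= M * exp (B * p z)) ->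
    forall l, length l = n -> NoDup l -> (forall x, In x l -> ~ In x l0) ->
    (forall x, In x l -> f x = RtoC 0) ->
    forall z, Cmod (f z) <= M * A' * exp (B' * p z) * dist_prod z l.
Proof.
  induction n as [|n IH]; intros B HB.
  - exists 1, B. split; [lra|]. split; trivial. intros M l0 f HM _ Hf l Hl _ _ _ z.
    destruct l; [|discriminate]. simpl. rewrite !Rmult_1_r. apply Hf.
  - destruct (divide_zero_growth B HB) as (A1 & B1 & HA1 & HB1 & Hdiv).
    destruct (IH B1 HB1) as (A2 & B2 & HA2 & HB2 & Hnd).
    exists (A1 * A2), B2. split; [nra|]. split; [lra|].
    intros M l0 f HM Hh Hf l Hl Hn Hd Hz z.
    destruct l as [|x l]; [discriminate|]. simpl in Hl. injection Hl as Hl.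
    inversion Hn as [|? ? Hx Hn']; subst.
    destruct (Hdiv M l0 f x HM) as (h & Hhh & Hfh & Hg); trivial.
    + apply Hd. now left.
    + apply Hz. now left.
    + rewrite Hfh, Cmod_mult. simpl dist_prod.
      assert (Hb : Cmod (h z) <= M * A1 * A2 * exp (B2 * p z) * dist_prod z l).
      { apply (Hnd (M * A1) (x :: l0) h); trivial; [nra| |].
        - intros y Hy [->|Hy0]; [contradiction|]. apply (Hd y); trivial. now right.
        - intros y Hy. assert (Hyx : y <> x) by now apply (neq_of_notin _ _ l).
          pose proof (Hz y (or_intror Hy)) as E. rewrite Hfh in E.
          apply NNPP. intros Hn0. apply (Cmult_neq_0 _ _ (Cminus_neq0 _ _ Hyx) Hn0 E). }
      pose proof (Cmod_ge_0 (z - x)).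
      apply Rle_trans with (Cmod (z - x) * (M * A1 * A2 * exp (B2 * p z) * dist_prod z l)).
      * now apply Rmult_le_compat_l.
      * apply Req_le. ring.
Qed.

Lemma Ap_list_X L n f : in_Ap p f -> list_X p L (S n) f.
Proof.
  intros [He (A & B & HA & HB & Hf)].
  destruct (ldd_growth n B) as (A' & B' & HA' & HB' & H); [lra|].
  exists (A * A'), B'. split; [nra|]. split; trivial. intros l Hl Hn _.
  apply (H A nil f); trivial; [lra|now apply holo_off_entire|intros ? _ []].
Qed.

Lemma list_X_minus L n V W : list_X p L n V -> list_X p L n W ->
  list_X p L n (fun z => V z - W z)%C.
Proof.
  intros (M1 & B1 & HM1 & HB1 & H1) (M2 & B2 & HM2 & HB2 & H2).
  exists (M1 + M2), (B1 + B2). split; [lra|]. split; [lra|]. intros l Hl Hn HL.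
  rewrite ldd_minus. eapply Rle_trans; [apply Cmod_minus_le|].
  specialize (H1 l Hl Hn HL). specialize (H2 l Hl Hn HL).
  pose proof (weight_sum_ge0 p l Hp). 
  assert (exp (B1 * weight_sum p l) <= exp ((B1 + B2) * weight_sum p l)) by (apply exp_mono; nra).
  assert (exp (B2 * weight_sum p l) <= exp ((B1 + B2) * weight_sum p l)) by (apply exp_mono; nra).
  nra.
Qed.

(** The use of (w1): polynomial factors, such as distances between points, are absorbed into the
    weight. *)
Lemma Cmod_le_exp_weight : exists K, 0 < K /\ forall z, Cmod z <= exp (K * p z).
Proof.
  destruct (weight_log p Hp) as (K & HK & H). exists (/ K). split; [now apply Rinv_0_lt_compat|].
  intros z. specialize (H z). pose proof (Cmod_ge_0 z).
  apply Rle_trans with (1 + Cmod z ^ 2); [nra|].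
  rewrite <- (exp_ln (1 + Cmod z ^ 2)) by nra. apply exp_mono.
  apply Rmult_le_reg_l with K; [trivial|]. rewrite <- Rmult_assoc, Rinv_r by lra. lra.
Qed.
End Growth.

(** * Lower orders, discrete and interpolating sequences *)

Definition C_eq_dec (x y : C) : {x = y} + {x <> y} := excluded_middle_informative (x = y).

Lemma weight_sum_in p l x : weight p -> In x l -> p x <= weight_sum p l.
Proof.
  intros Hp. induction l as [|y l IH]; simpl; [tauto|].
  pose proof (weight_sum_ge0 p l Hp). pose proof (weight_nonneg p Hp y).
  intros [->|H1]; [lra|]. specialize (IH H1). lra.
Qed.

(* Exchange the points of a list one by one for those of a fixed reference list. *)
Lemma list_X_pred p L n W : weight p -> list_X p L (S n) W -> list_X p L n W.
Proof.
  intros Hp (M & B & HM & HB & H).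
  destruct (classic (exists y : list C, length y = n /\ NoDup y /\ forall x, In x y -> L x))
    as [(y & Hy & Hyn & HyL)|Hno].
  2:{ exists 0, 0. split; [lra|]. split; [lra|]. intros l H1 H2 H3. exfalso. apply Hno.
  now exists l. }
  destruct (Cmod_le_exp_weight p Hp) as (K & HK & HKp).
  set (P := weight_sum p y). assert (HP : 0 <= P) by now apply weight_sum_ge0.
  set (B' := B + K).
  (* [v] holds points of the reference list [y], [u] the [k] points still to be treated. Only [M']
     changes with [k]; the [K] in [B'] pays for the distance between exchanged points. *)
  assert (Hclaim : forall k, exists M', 0 <= M' /\ forall u v, length u = k ->
    length (u ++ v) = n ->
     NoDup (u ++ v) -> (forall x, In x (u ++ v) -> L x) -> incl v y ->
     Cmod (ldd (u ++ v) W) <= M' * exp (B' * weight_sum p (u ++ v))).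
  { induction k as [|k (M' & HM' & IH)].
    - exists (Cmod (ldd y W)). split; [apply Cmod_ge_0|]. intros u v Hu Hl Hn HL Hv.
      destruct u; [|discriminate]. simpl in *.
      rewrite (ldd_perm v y).
      + rewrite <- (Rmult_1_r (Cmod _)) at 1. apply Rmult_le_compat_l; [apply Cmod_ge_0|].
        rewrite <- exp_0 at 1. apply exp_mono. pose proof (weight_sum_ge0 p v Hp). unfold B'. nra.
      + apply NoDup_Permutation_bis; trivial; lia.
      + trivial.
    - exists (M' * exp (B' * P) + 2 * exp (K * P) * M * exp (B * P)).
      pose proof (exp_pos (B' * P)) as E1. pose proof (exp_pos (K * P)) as E2.
      pose proof (exp_pos (B * P)) as E3.
      assert (H0 : 0 <= M' * exp (B' * P)) by nra.
      assert (H0' : 0 <= 2 * exp (K * P) * M * exp (B * P)) by (repeat apply Rmult_le_pos; lra).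
      split; [lra|]. intros u v Hu Hl Hn HL Hv.
      destruct u as [|a u]; [discriminate|]. simpl in Hu. injection Hu as Hu.
      assert (HPs := weight_sum_ge0 p ((a :: u) ++ v) Hp).
      destruct (in_dec C_eq_dec a y) as [Ha|Ha].
      + assert (HPm : Permutation ((a :: u) ++ v) (u ++ a :: v)) by apply Permutation_middle.
        rewrite (ldd_perm _ _ HPm) by trivial. rewrite (weight_sum_perm p _ _ HPm) in *.
        eapply Rle_trans; [apply IH; trivial|].
        * rewrite <- (Permutation_length HPm); trivial.
        * now apply (Permutation_NoDup HPm).
        * intros x Hx. apply HL. now apply (Permutation_in x (Permutation_sym HPm)).
        * intros x [<-|Hx]; auto.
        * apply Rmult_le_compat_r; [left; apply exp_pos|].
          assert (1 <= exp (B' * P)) by (rewrite <- exp_0 at 1; apply exp_mono; unfold B'; nra).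
          nra.
      (* By equal lengths: were all of [y] in the list, the list would have no point outside [y],
         but [a] is one. Exchanging [a] for [b] leaves a list treated by induction and one with
         [n + 1] points, bounded by [H]. *)
      + assert (Hb : exists b, In b y /\ ~ In b ((a :: u) ++ v)).
        { apply NNPP. intros Hnb. apply Ha. 
          assert (Hi : incl y ((a :: u) ++ v)).
          { intros b Hby. apply NNPP. intros Hb. apply Hnb. now exists b. }
          apply (NoDup_length_incl Hyn) in Hi; [|lia]. apply Hi. now left. }
        destruct Hb as (b & Hby & Hb). set (x := u ++ v) in *.
        change ((a :: u) ++ v) with (a :: x) in *.
        assert (Hab : NoDup (a :: b :: x)).
        { apply (Permutation_NoDup (l := b :: a :: x)); [apply perm_swap|]. now constructor. }
        replace (ldd (a :: x) W) with (ldd (b :: x) W + (a - b) * ldd (a :: b :: x) W)%C.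
        2:{ rewrite <- ldd_exchange by trivial. ring. }
        assert (HbL : forall z, In z (b :: x) -> L z).
        { intros z [<-|Hz]; [now apply HyL|]. apply HL. now right. }
        assert (Hpb : p b <= P) by now apply weight_sum_in.
        assert (Hpa : 0 <= p a) by now apply weight_nonneg.
        assert (Hpx : 0 <= weight_sum p x) by now apply weight_sum_ge0.
        set (s := weight_sum p (a :: x)) in *.
        assert (Hs : s = p a + weight_sum p x) by reflexivity.
        eapply Rle_trans; [apply Cmod_triangle|]. rewrite Cmod_mult, Rmult_plus_distr_r.
        apply Rplus_le_compat.
        * assert (HPm : Permutation (b :: x) (u ++ b :: v)) by apply Permutation_middle.
          assert (Hbn : NoDup (b :: x)) by (apply NoDup_cons2 in Hab; constructor; tauto).
          rewrite (ldd_perm _ _ HPm) by trivial.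
          eapply Rle_trans; [apply IH; trivial|].
          -- rewrite <- (Permutation_length HPm). exact Hl.
          -- now apply (Permutation_NoDup HPm).
          -- intros z Hz. apply HbL. now apply (Permutation_in z (Permutation_sym HPm)).
          -- intros z [<-|Hz]; auto.
          -- rewrite <- (weight_sum_perm p _ _ HPm), Rmult_assoc, <- exp_plus.
             apply Rmult_le_compat_l; trivial. apply exp_mono. simpl. unfold B'. nra.
        * assert (Hnd : Cmod (ldd (a :: b :: x) W) <= M * (exp (B * P) * exp (B * s))).
          { eapply Rle_trans; [apply H; trivial|].
            - simpl in *. lia.
            - intros z [<-|Hz]; [apply HL; now left|auto].
            - apply Rmult_le_compat_l; trivial. rewrite <- exp_plus. apply exp_mono. simpl. nra. }
          assert (Hd : Cmod (a - b) <= 2 * (exp (K * P) * exp (K * s))).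
          { eapply Rle_trans; [apply Cmod_minus_le|]. rewrite <- exp_plus.
            assert (exp (K * p a) <= exp (K * P + K * s)) by (apply exp_mono; nra).
            assert (exp (K * p b) <= exp (K * P + K * s)) by (apply exp_mono; nra).
            pose proof (HKp a). pose proof (HKp b). lra. }
          replace (exp (B' * s)) with (exp (B * s) * exp (K * s))
            by (rewrite <- exp_plus; f_equal; unfold B'; ring).
          eapply Rle_trans; [apply Rmult_le_compat;
            [apply Cmod_ge_0|apply Cmod_ge_0|exact Hd|exact Hnd]|].
          apply Req_le. ring. }
  destruct (Hclaim n) as (M' & HM' & HC). exists M', B'. split; trivial. split; [unfold B'; lra|].
  intros l Hl Hn HL. specialize (HC l nil). rewrite app_nil_r in HC. apply HC; trivial. intros ? [].
Qed.

(** Common constants for all lengths up to [n], since the lists of nearby points met later have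
    lengths varying with the base point. *)
Lemma list_X_all p L n W : weight p -> list_X p L n W -> exists M B, 0 <= M /\ 0 <= B /\
  forall l, (length l <= n)%nat -> NoDup l -> (forall x, In x l -> L x) ->
    Cmod (ldd l W) <= M * exp (B * weight_sum p l).
Proof.
  intros Hp. induction n as [|n IH]; intros H.
  - destruct H as (M & B & HM & HB & H). exists M, B. repeat split; trivial.
    intros l Hl. apply H. lia.
  - destruct (IH (list_X_pred p L n W Hp H)) as (M1 & B1 & HM1 & HB1 & H1).
    destruct H as (M & B & HM & HB & H).
    exists (M + M1), (B + B1). split; [lra|]. split; [lra|]. intros l Hl Hn HL.
    pose proof (weight_sum_ge0 p l Hp). pose proof (exp_pos ((B + B1) * weight_sum p l)).
    assert (exp (B * weight_sum p l) <= exp ((B + B1) * weight_sum p l)) by (apply exp_mono; nra).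
    assert (exp (B1 * weight_sum p l) <= exp ((B + B1) * weight_sum p l)) by (apply exp_mono; nra).
    destruct (Nat.eq_dec (length l) (S n)) as [E|E].
    + specialize (H l E Hn HL). nra.
    + specialize (H1 l ltac:(lia) Hn HL). nra.
Qed.

(** A positive infimum is approached within a factor 2, which replaces any argument that it is
    attained. *)
Lemma almost_min (S : R -> Prop) e : (exists s, S s) -> 0 < e -> (forall s, S s -> e <= s) ->
  exists D, 0 < D /\ (forall s, S s -> D <= s) /\ exists s, S s /\ s <= 2 * D.
Proof.
  intros [s0 Hs0] He Hle.
  destruct (completeness (fun r => forall s, S s -> r <= s)) as [D [HD1 HD2]].
  - exists s0. intros r Hr. now apply Hr.
  - now exists e.
  - assert (HeD : e <= D) by now apply HD1.
    assert (HD : forall s, S s -> D <= s) by (intros s Hs; apply HD2; intros r Hr; now apply Hr).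
    exists D. split; [lra|]. split; trivial.
    apply NNPP. intros Hno. assert (2 * D <= D); [|lra].
    apply HD1. intros s Hs. left. apply Rnot_le_lt. intros Hs2. apply Hno. now exists s.
Qed.

Lemma discrete_isolated L z : discrete L -> exists e, 0 < e /\ forall w, L w -> w <> z ->
  e <= Cmod (z - w).
Proof.
  intros Hd. apply NNPP. intros Hno. apply (Hd z). intros eps Heps. apply NNPP. intros Hn.
  apply Hno. exists eps. split; trivial. intros w Hw Hwz. apply Rnot_lt_le. intros Hlt.
  apply Hn. exists w. rewrite Cmod_minus_sym. tauto.
Qed.

Lemma discrete_subset (L L' : C -> Prop) : (forall z, L' z -> L z) -> discrete L -> discrete L'.
Proof. intros Hs Hd z Ha. apply (Hd z). intros eps Heps. destruct (Ha eps Heps) as (w & Hw & ?).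
exists w; auto. Qed.

(** [bisection_principle] with finiteness as the property: it passes from quarters to the whole, and
    a small rectangle around [(x, y)] contains no point of [L] other than possibly [(x, y)]. *)
Lemma discrete_bounded_finite L r : discrete L -> exists l, forall z, L z -> Cmod z <= r -> In z l.
Proof.
  intros Hd. destruct (Rle_lt_dec 0 r) as [Hr|Hr].
  2:{ exists nil. intros z _ Hz. pose proof (Cmod_ge_0 z). lra. }
  enough (H : exists l, forall z, L z -> - r <= fst z <= r -> - r <= snd z <= r -> In z l).
  { destruct H as [l H]. exists l. intros z Hz Hzr. destruct (Rabs_le_Cmod z) as [H1 H2].
    apply H; trivial; apply Rabs_le_between; lra. }
  apply (bisection_principle (fun a b c d => exists l, forall z, L z ->
     a <= fst z <= b -> c <= snd z <= d -> In z l)); [|lra|lra|].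
  - intros a b c d _ _ [l1 H1] [l2 H2] [l3 H3] [l4 H4].
    exists ((l1 ++ l2) ++ (l3 ++ l4)). intros z Hz Ha Hc. rewrite !in_app_iff.
    destruct (Rle_lt_dec (fst z) ((a + b) / 2)), (Rle_lt_dec (snd z) ((c + d) / 2)).
    + left; left; apply H1; trivial; lra.
    + right; left; apply H3; trivial; lra.
    + left; right; apply H2; trivial; lra.
    + right; right; apply H4; trivial; lra.
  - intros x y _ _. destruct (discrete_isolated L (x, y) Hd) as (e & He & H).
    exists (e / 2). split; [lra|]. intros a b c d Hx Hy Hab Hcd.
    exists ((x, y) :: nil). intros z Hz Ha Hc. left. apply NNPP. intros Hne.
    specialize (H z Hz ltac:(congruence)). pose proof (Cmod_le_sum ((x, y) - z)) as Hs. simpl in Hs.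
    assert (Rabs (x + - fst z) < e / 2) by (apply Rabs_lt_between; lra).
    assert (Rabs (y + - snd z) < e / 2) by (apply Rabs_lt_between; lra). lra.
Qed.

Lemma finite_list (P : C -> Prop) l : (forall z, P z -> In z l) ->
  exists l', NoDup l' /\ forall z, In z l' <-> P z.
Proof.
  intros H. exists (nodup C_eq_dec (filter (fun z => if excluded_middle_informative (P z) then
    true else false) l)).
  split; [apply NoDup_nodup|]. intros z. rewrite nodup_In, filter_In.
  destruct excluded_middle_informative as [Hz|Hz].
  - split; auto.
  - split; [intros [_ E]; discriminate|contradiction].
Qed.

(** Restrictions of functions in the algebra satisfy the growth condition automatically, so only
    surjectivity remains. Families become total functions, ignored off [L]. *)
Lemma interpolating_iff p L : weight p -> interpolating p L <-> discrete L /\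
  forall w A B, 0 < A -> 0 < B -> (forall z, L z -> Cmod (w z) <= A * exp (B * p z)) ->
    exists f, in_Ap p f /\ forall z, L z -> f z = w z.
Proof.
  intros Hp. split; intros [Hd H]; split; trivial.
  - intros w A B HA HB Hw.
    destruct (proj2 (H (fun x => w (pval x)))) as (f & Hf & Hfw).
    + exists A, B. split; trivial. split; trivial. intros x. apply Hw. exact (proj2_sig x).
    + exists f. split; trivial. intros z Hz. exact (Hfw (exist _ z Hz)).
  - intros w. split.
    + intros (f & [_ (A & B & HA & HB & Hf)] & Hfw). exists A, B. split; trivial. split; trivial.
      intros x. rewrite <- Hfw. apply Hf.
    + intros (A & B & HA & HB & Hw).
      destruct (H (extend w) A B HA HB) as (f & Hf & Hfw).
      * intros z Hz. specialize (Hw (exist _ z Hz)).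
        rewrite <- extend_pval in Hw. exact Hw.
      * exists f. split; trivial. intros x. unfold restriction. rewrite Hfw; [apply extend_pval|].
        exact (proj2_sig x).
Qed.

Lemma interpolating_subset p (L L' : C -> Prop) : weight p -> (forall z, L' z -> L z) ->
  interpolating p L -> interpolating p L'.
Proof.
  intros Hp Hs H. rewrite interpolating_iff in * by trivial. destruct H as [Hd H].
  split; [now apply (discrete_subset L)|]. intros w A B HA HB Hw.
  destruct (H (fun z => if excluded_middle_informative (L' z) then w z else RtoC 0) A B HA HB) as
    (f & Hf & Hfw).
  - intros z Hz. destruct excluded_middle_informative as [Hz'|Hz']; [now apply Hw|].
    rewrite Cmod_0. pose proof (exp_pos (B * p z)). nra.
  - exists f. split; trivial. intros z Hz. rewrite Hfw by auto.
    destruct excluded_middle_informative; [trivial|contradiction].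
Qed.

Lemma interpolating_uniform p L c : weight p -> 0 <= c -> interpolating p L ->
  exists M B, 0 < M /\ 0 < B /\ forall w, (forall z, L z -> Cmod (w z) <= exp (c * p z)) ->
     exists f, entire f /\ (forall z, Cmod (f z) <= M * exp (B * p z)) /\
       forall z, L z -> f z = w z.
Proof.
  intros Hp Hc H. apply uniform_extension; trivial.
  - intros z _. left. apply exp_pos.
  - intros w Hw. rewrite interpolating_iff in H by trivial. destruct H as [_ H].
    apply (H w 1 (c + 1)); [lra|lra|]. intros z Hz. eapply Rle_trans; [now apply Hw|].
    rewrite Rmult_1_l. apply exp_mono. pose proof (weight_nonneg p Hp z). lra.
Qed.

(** * Functions vanishing on a union of interpolating sequences *)

(** [G w = d - (w - z) * h w], where [h] interpolates the values [d / (x - z)]; these have modulus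
    at most 1 because [d] does not exceed the distance from [z] to [L]. *)
Lemma vanishing_factor p L z M B : weight p -> discrete L -> ~ L z -> 0 <= M -> 0 <= B ->
  (forall w, (forall x, L x -> Cmod (w x) <= exp (0 * p x)) ->
     exists f, entire f /\ (forall x, Cmod (f x) <= M * exp (B * p x)) /\ forall x, L x ->
       f x = w x) ->
  exists d G, 0 < d <= / 2 /\ (/ 4 <= d \/ exists x, L x /\ Cmod (z - x) <= 2 * d) /\
    entire G /\ G z = RtoC d /\ (forall x, L x -> G x = RtoC 0) /\
    forall w, Cmod (G w) <= 1 + (Cmod w + Cmod z) * (M * exp (B * p w)).
Proof.
  intros Hp Hd Hz HM HB Hu.
  destruct (discrete_isolated L z Hd) as (e & He & Hiso).
  (* The competitor [/ 2] handles an empty or distant [L] and forces [2 * d <= 1], so that a point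
     within [2 * d] is in the range of doubling. *)
  destruct (almost_min (fun s => s = / 2 \/ exists x, L x /\ s = Cmod (z - x)) (Rmin (/ 2) e))
    as (d & Hd0 & Hdmin & s & Hs & Hsd).
  - exists (/ 2). now left.
  - apply Rmin_pos; lra.
  - intros s [->|(x & Hx & ->)]; [apply Rmin_l|].
    eapply Rle_trans; [apply Rmin_r|]. apply Hiso; trivial. intros ->. contradiction.
  - assert (Hdx : forall x, L x -> d <= Cmod (x - z)).
    { intros x Hx. rewrite Cmod_minus_sym. apply Hdmin. right. now exists x. }
    destruct (Hu (fun x => d / (x - z))%C) as (h & Hh & Hhg & Hhx).
    + intros x Hx. specialize (Hdx x Hx). rewrite Rmult_0_l, exp_0.
      rewrite Cmod_div, Cmod_R, Rabs_pos_eq by (try (apply Cmod_gt_0); lra).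
      apply Rmult_le_reg_r with (Cmod (x - z)); [lra|]. unfold Rdiv.
      rewrite Rmult_assoc, Rinv_l by lra. lra.
    + exists d, (fun w => d - (w - z) * h w)%C.
      assert (d <= / 2) by (apply Hdmin; now left).
      split; [lra|]. split.
      { destruct Hs as [->|(x & Hx & ->)]; [left; lra|right; now exists x]. }
      split; [|split; [|split]].
      * apply entire_minus; [apply entire_const|]. apply entire_mult; trivial.
        apply entire_minus; [apply entire_id|apply entire_const].
      * ring.
      * intros x Hx. rewrite Hhx by trivial. field. apply Cminus_neq0. intros ->. contradiction.
      * intros w. eapply Rle_trans; [apply Cmod_minus_le|].
      rewrite Cmod_mult, Cmod_R, Rabs_pos_eq by lra.
        apply Rplus_le_compat; [lra|].
        apply Rmult_le_compat; try apply Cmod_ge_0; [apply Cmod_minus_le|apply Hhg].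
Qed.

(** A product of one vanishing factor per sequence, with values [e] at [z]. Either the sequence has
    a point within [2 * e] of [z], which joins [l], or [e] is at least 1/4 and [l] is unchanged; in
    both cases [dist_prod z l] grows by a factor at most [4 * e]. Disjointness keeps [l] free of
    repetitions. *)
Lemma vanishing_functions p Ls m : weight p -> 
  (forall i, (i < m)%nat -> interpolating p (Ls i)) ->
  (forall i j z, (i < m)%nat -> (j < m)%nat -> Ls i z -> Ls j z -> i = j) ->
  exists A B, 0 < A /\ 0 < B /\ forall z, (forall i, (i < m)%nat -> ~ Ls i z) ->
    exists d l G, 0 < d /\ NoDup l /\ (length l <= m)%nat /\
      (forall x, In x l -> (exists i, (i < m)%nat /\ Ls i x) /\ Cmod (x - z) <= 1) /\
      dist_prod z l <= 4 ^ m * d /\ entire G /\ G z = RtoC d /\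
      (forall i x, (i < m)%nat -> Ls i x -> G x = RtoC 0) /\
      forall w, Cmod (G w) <= A * exp (B * (p w + p z)).
Proof.
  intros Hp. induction m as [|m IH]; intros Hi Hdis.
  - exists 1, 1. split; [lra|]. split; [lra|]. intros z _.
    exists 1, nil, (fun _ => RtoC 1). simpl. repeat split; try tauto; try lra; try lia.
    + constructor.
    + apply entire_const.
    + intros w. rewrite Cmod_1. pose proof (weight_nonneg p Hp w).
    pose proof (weight_nonneg p Hp z).
      rewrite Rmult_1_l. rewrite <- exp_0 at 1. apply exp_mono. lra.
  - destruct IH as (A & B & HA & HB & H).
    { intros i Hm. apply Hi. lia. }
    { intros i j z Hm Hj. apply Hdis; lia. }
    assert (Him : interpolating p (Ls m)) by (apply Hi; lia).
    destruct (interpolating_uniform p (Ls m) 0 Hp (Rle_refl 0) Him) as (M & B1 & HM & HB1 & Hu).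
    destruct (Cmod_le_exp_weight p Hp) as (K & HK & HKp).
    exists (A * (1 + 2 * M)), (B + (K + B1)). split; [nra|]. split; [lra|]. intros z Hz.
    destruct (H z) as (d & l & G & Hd & Hl & Hlen & Hlx & Hprod & HG & HGz & HG0 & HGg).
    { intros i Him'. apply Hz. lia. }
    destruct (vanishing_factor p (Ls m) z M B1 Hp (proj1 Him) (Hz m (Nat.lt_succ_diag_r m))
       ltac:(lra) ltac:(lra) Hu) as (e & G1 & He & Hnear & HG1 & HG1z & HG10 & HG1g).
    assert (Hex : exists l', NoDup l' /\ (length l' <= S m)%nat /\
       (forall x, In x l' -> (exists i, (i < S m)%nat /\ Ls i x) /\ Cmod (x - z) <= 1) /\
       dist_prod z l' <= 4 ^ S m * (d * e)).
    { pose proof (dist_prod_ge0 z l). assert (0 < 4 ^ m) by (apply pow_lt; lra).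
      assert (0 < 4 ^ m * d) by nra.
      assert (Hlx' : forall x, In x l -> (exists i, (i < S m)%nat /\ Ls i x) /\ Cmod (x - z) <= 1).
      { intros x Hx. destruct (Hlx x Hx) as [(i & Hi1 & Hi2) Hx1]. split; trivial.
        exists i. split; [lia|trivial]. }
      destruct Hnear as [He4|(x & Hx & Hxe)].
      - exists l. repeat split; trivial; try apply Hlx'; trivial; [lia|]. simpl. nra.
      - exists (x :: l). split; [|split; [|split]].
        + constructor; trivial. intros Hxl. destruct (Hlx x Hxl) as [(i & Hi1 & Hi2) _].
          assert (i = m) by (apply (Hdis i m x); trivial; lia). lia.
        + simpl. lia.
        + intros y [<-|Hy]; [|auto]. split; [exists m; split; [lia|trivial]|].
          rewrite Cmod_minus_sym. lra.
        + simpl. pose proof (Cmod_ge_0 (z - x)).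
          apply Rle_trans with (2 * e * (4 ^ m * d)); [apply Rmult_le_compat; trivial|]. nra. }
    destruct Hex as (l' & Hl' & Hlen' & Hlx' & Hprod').
    exists (d * e), l', (fun w => G w * G1 w)%C.
    split; [nra|]. do 4 (split; [trivial|]). split; [now apply entire_mult|]. split; [|split].
    + rewrite HGz, HG1z. now rewrite RtoC_mult.
    + intros i x Hi1 Hx. destruct (Nat.eq_dec i m) as [->|Hne].
      * rewrite HG10 by trivial. ring.
      * rewrite (HG0 i x) by (trivial; lia). ring.
    + intros w. rewrite Cmod_mult. pose proof (weight_nonneg p Hp w).
    pose proof (weight_nonneg p Hp z).
      specialize (HGg w). specialize (HG1g w).
      assert (E1 : Cmod w + Cmod z <= 2 * exp (K * (p w + p z))).
      { pose proof (HKp w). pose proof (HKp z).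
        assert (exp (K * p w) <= exp (K * (p w + p z))) by (apply exp_mono; nra).
        assert (exp (K * p z) <= exp (K * (p w + p z))) by (apply exp_mono; nra). lra. }
      assert (E2 : exp (B1 * p w) <= exp (B1 * (p w + p z))) by (apply exp_mono; nra).
      assert (E3 : Cmod (G1 w) <= (1 + 2 * M) * exp ((K + B1) * (p w + p z))).
      { assert (1 <= exp ((K + B1) * (p w + p z))).
        { rewrite <- exp_0 at 1. apply exp_mono. apply Rmult_le_pos; lra. }
        assert (Eq : exp ((K + B1) * (p w + p z)) = exp (K * (p w + p z)) * exp (B1 * (p w + p z))).
        { rewrite <- exp_plus. f_equal. ring. }
        pose proof (Cmod_ge_0 w). pose proof (Cmod_ge_0 z). pose proof (exp_pos (B1 * p w)).
        assert ((Cmod w + Cmod z) * (M * exp (B1 * p w)) <=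
          2 * exp (K * (p w + p z)) * (M * exp (B1 * (p w + p z)))).
        { apply Rmult_le_compat; [lra|nra|trivial|apply Rmult_le_compat_l; lra]. }
        rewrite Eq in *. lra. }
      replace (A * (1 + 2 * M) * exp ((B + (K + B1)) * (p w + p z))) with
        (A * exp (B * (p w + p z)) * ((1 + 2 * M) * exp ((K + B1) * (p w + p z)))).
      2:{ rewrite (Rmult_plus_distr_r B), exp_plus. ring. }
      apply Rmult_le_compat; trivial; apply Cmod_ge_0.
Qed.

(** * Finite sums and square-summable interpolation *)

Definition rsum (l : list C) (F : C -> R) : R := fold_right (fun x s => F x + s) 0 l.
Definition csum (l : list C) (F : C -> C) : C := fold_right (fun x s => F x + s)%C (RtoC 0) l.

Lemma rsum_cons x l F : rsum (x :: l) F = F x + rsum l F.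
Proof. reflexivity. Qed.

Lemma Cmod_csum_le l F b : (forall x, In x l -> Cmod (F x) <= b x) -> Cmod (csum l F) <= rsum l b.
Proof.
  induction l as [|x l IH]; intros H; simpl; [rewrite Cmod_0; lra|].
  eapply Rle_trans; [apply Cmod_triangle|]. apply Rplus_le_compat; [apply H; now left|].
  apply IH. intros y Hy. apply H. now right.
Qed.

Lemma csum_zero l F : (forall x, In x l -> F x = RtoC 0) -> csum l F = RtoC 0.
Proof.
  induction l as [|x l IH]; intros H; simpl; [trivial|].
  rewrite (H x), IH; [ring| |now left]. intros y Hy. apply H. now right.
Qed.

Lemma csum_single l F y : NoDup l -> In y l -> (forall x, In x l -> x <> y -> F x = RtoC 0) ->
  csum l F = F y.
Proof.
  induction l as [|x l IH]; intros Hn Hy H; [destruct Hy|].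
  inversion Hn as [|? ? Hx Hn']; subst. simpl. destruct Hy as [->|Hy].
  - rewrite csum_zero; [ring|]. intros z Hz. apply H; [now right|congruence].
  - rewrite IH, (H x); trivial; [ring|now left|congruence|]. intros z Hz. apply H. now right.
Qed.

Lemma entire_csum l (F : C -> C -> C) : (forall x, In x l -> entire (F x)) ->
  entire (fun z => csum l (fun x => F x z)).
Proof.
  induction l as [|x l IH]; intros H; simpl; [apply entire_const|].
  apply entire_plus; [apply H; now left|]. apply IH. intros y Hy. apply H. now right.
Qed.

Lemma rsum_scal l c F : rsum l (fun x => c * F x) = c * rsum l F.
Proof. induction l as [|x l IH]; simpl; [ring|rewrite IH; ring]. Qed.

Lemma rsum_le l F G : (forall x, In x l -> F x <= G x) -> rsum l F <= rsum l G.
Proof.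
  induction l as [|x l IH]; intros H; simpl; [lra|]. apply Rplus_le_compat; [apply H; now left|].
  apply IH. intros y Hy. apply H. now right.
Qed.

Lemma rsum_ge0 l F : (forall x, In x l -> 0 <= F x) -> 0 <= rsum l F.
Proof.
  induction l as [|x l IH]; intros H; simpl; [lra|].
  apply Rplus_le_le_0_compat; [apply H; now left|].
  apply IH. intros y Hy. apply H. now right.
Qed.

Lemma rsum_plus l F G : rsum l (fun x => F x + G x) = rsum l F + rsum l G.
Proof. induction l as [|x l IH]; simpl; [ring|rewrite IH; ring]. Qed.

Lemma parallelogram (a b : C) :
  Cmod ((a + b) * (/ 2)%R) ^ 2 + Cmod ((a - b) * (/ 2)%R) ^ 2 = (Cmod a ^ 2 + Cmod b ^ 2) / 2.
Proof. rewrite !Cmod2_alt. destruct a, b. simpl. field. Qed.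

(* Averaging over the two choices of sign at each point of the list makes the functions [g x]
   square-summable (the trick of Varopoulos), with a bound independent of the list. *)
Lemma square_summable_interpolation L phi (b : C -> R) : (forall x, 0 <= phi x) ->
  (forall w, (forall x, L x -> Cmod (w x) <= phi x) ->
     exists f, entire f /\ (forall z, Cmod (f z) <= b z) /\ forall x, L x -> f x = w x) ->
  forall l, NoDup l -> forall w, (forall x, L x -> Cmod (w x) <= phi x) ->
  exists u (g : C -> C -> C), entire u /\ (forall x, In x l -> entire (g x)) /\
    (forall y, L y -> ~ In y l -> u y = w y) /\ (forall y, L y -> In y l -> u y = RtoC 0) /\
    (forall x y, In x l -> L y -> y <> x -> g x y = RtoC 0) /\
    (forall x, In x l -> L x -> g x x = RtoC (phi x)) /\
    forall z, Cmod (u z) ^ 2 + rsum l (fun x => Cmod (g x z) ^ 2) <= b z ^ 2.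
Proof.
  intros Hphi Hext. induction l as [|a l IH]; intros Hn w Hw.
  - destruct (Hext w Hw) as (f & Hf & Hfb & Hfw). exists f, (fun _ => f).
    split; [trivial|]. split; [intros x []|]. split; [auto|]. split; [intros y _ []|].
    split; [intros x y []|]. split; [intros x []|]. intros z. simpl rsum. specialize (Hfb z).
    pose proof (Cmod_ge_0 (f z)). nra.
  - inversion Hn as [|? ? Ha Hn']; subst.
    (* Interpolate with [phi a] and with [- phi a] at [a]. The half sum vanishes at [a] and is the
       new [u], the half difference is [g a]; by the parallelogram law the square sums are averaged,
       so the bound [b] is kept. *)
    set (wp := fun (s : R) x => if C_eq_dec x a then RtoC (s * phi a) else w x).
    assert (Hwp : forall s, Rabs s = 1 -> forall x, L x -> Cmod (wp s x) <= phi x).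
    { intros s Hs x Hx. unfold wp. destruct (C_eq_dec x a) as [->|]; [|auto].
      rewrite Cmod_R, Rabs_mult, Hs, Rabs_pos_eq by auto. lra. }
    destruct (IH Hn' (wp 1)) as (u1 & g1 & Hu1 & Hg1 & A1 & B1 & C1 & D1 & E1); [apply Hwp;
      apply Rabs_R1|].
    destruct (IH Hn' (wp (-1))) as (u2 & g2 & Hu2 & Hg2 & A2 & B2 & C2 & D2 & E2).
    { apply Hwp. rewrite Rabs_left; lra. }
    assert (Hav : forall f1 f2 : C -> C, entire f1 -> entire f2 ->
      entire (fun z => (f1 z + f2 z) * (/ 2)%R)%C).
    { intros f1 f2 H1 H2. apply entire_mult; [now apply entire_plus|apply entire_const]. }
    assert (Hdf : entire (fun z => (u1 z - u2 z) * (/ 2)%R)%C).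
    { apply entire_mult; [now apply entire_minus|apply entire_const]. }
    assert (H2 : RtoC 2 <> 0) by (intros X; apply RtoC_inj in X; lra).
    assert (Hwa : forall s, wp s a = RtoC (s * phi a)).
    { intros s. unfold wp. destruct (C_eq_dec a a); [trivial|contradiction]. }
    assert (Hwy : forall s y, y <> a -> wp s y = w y).
    { intros s y Hy. unfold wp. destruct (C_eq_dec y a); [contradiction|trivial]. }
    exists (fun z => (u1 z + u2 z) * (/ 2)%R)%C,
      (fun x z => if C_eq_dec x a then (u1 z - u2 z) * (/ 2)%R else (g1 x z + g2 x z) * (/ 2)%R)%C.
    split; [auto|]. split; [|split; [|split; [|split; [|split]]]].
    + intros x Hx. destruct (C_eq_dec x a) as [->|Hxa]; [trivial|].
      destruct Hx as [->|Hx]; [contradiction|]. auto.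
    + intros y Hy Hyl. assert (Hya : y <> a) by (intros ->; apply Hyl; now left).
      assert (Hyl' : ~ In y l) by (intros X; apply Hyl; now right).
      rewrite A1, A2, !Hwy by trivial. rewrite RtoC_inv by lra. field.
    + intros y Hy [->|Hyl].
      * rewrite A1, A2, !Hwa by trivial. rewrite <- RtoC_plus, <- RtoC_mult. f_equal. ring.
      * rewrite B1, B2 by trivial. ring.
    + intros x y Hx Hy Hyx. destruct (C_eq_dec x a) as [->|Hxa].
      * destruct (in_dec C_eq_dec y l) as [Hyl|Hyl].
        -- rewrite B1, B2 by trivial. ring.
        -- rewrite A1, A2, !Hwy by trivial. ring.
      * destruct Hx as [->|Hx]; [contradiction|]. rewrite C1, C2 by trivial. ring.
    + intros x Hx HLx. destruct (C_eq_dec x a) as [->|Hxa].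
      * rewrite A1, A2, !Hwa by trivial. rewrite <- RtoC_minus, <- RtoC_mult. f_equal. field.
      * destruct Hx as [->|Hx]; [contradiction|]. rewrite D1, D2 by trivial.
        rewrite <- RtoC_plus, <- RtoC_mult. f_equal. field.
    + intros z. rewrite rsum_cons. destruct (C_eq_dec a a) as [_|]; [|contradiction].
      rewrite <- Rplus_assoc, parallelogram.
      assert (Hle : rsum l (fun x => Cmod (if C_eq_dec x a then (u1 z - u2 z) * (/ 2)%R
          else (g1 x z + g2 x z) * (/ 2)%R) ^ 2)
        <= / 2 * rsum l (fun x => Cmod (g1 x z) ^ 2 + Cmod (g2 x z) ^ 2)).
      { rewrite <- rsum_scal. apply rsum_le. intros x Hx.
        destruct (C_eq_dec x a) as [->|]; [contradiction|].
        pose proof (parallelogram (g1 x z) (g2 x z)) as HP.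
        pose proof (pow2_ge_0 (Cmod ((g1 x z - g2 x z) * (/ 2)%R))). lra. }
      rewrite rsum_plus in Hle. specialize (E1 z). specialize (E2 z). lra.
Qed.

(** * Unions of interpolating sequences have the expected trace *)

Lemma weight_sublevel_finite p L t : weight p -> discrete L ->
  exists l, forall z, L z -> p z <= t -> In z l.
Proof.
  intros Hp Hd. destruct (Cmod_le_exp_weight p Hp) as (K & HK & HKp).
  destruct (discrete_bounded_finite L (exp (K * t)) Hd) as [l Hl]. exists l. intros z Hz Hzt.
  apply Hl; trivial. eapply Rle_trans; [apply HKp|]. apply exp_mono. nra.
Qed.

Lemma exp_neg_le_half_pow k : exp (- INR k) <= (/ 2) ^ k.
Proof.
  induction k as [|k IH]; [simpl; rewrite Ropp_0, exp_0; lra|].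
  rewrite S_INR. replace (- (INR k + 1)) with (- (1) + - INR k) by ring. rewrite exp_plus.
  simpl pow. apply Rmult_le_compat; try (left; apply exp_pos); trivial.
  rewrite exp_Ropp. apply Rinv_le_contravar; [lra|]. pose proof (exp_ineq1 1). lra.
Qed.

Lemma partial_sum_support f c m z : (forall k, f k z = if Nat.eq_dec k m then c else RtoC 0) ->
  forall N, partial_sum f N z = if le_lt_dec N m then RtoC 0 else c.
Proof.
  intros H. induction N as [|N IH]; simpl partial_sum.
  - destruct (le_lt_dec 0 m); [trivial|lia].
  - rewrite IH, H. destruct (le_lt_dec N m), (Nat.eq_dec N m), (le_lt_dec (S N) m); try lia; ring.
Qed.

Lemma eq_of_half_pow (x y : C) M m : 0 <= M -> (forall N, (m < N)%nat ->
  Cmod (x - y) <= M * (/ 2) ^ N) -> x = y.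
Proof.
  intros HM H. assert (H0 : Cmod (x - y) <= 0).
  { apply le_by_half_pow with (M := M); [trivial|].
    intros k. eapply Rle_trans; [apply (H (S m + k)%nat); lia|]. rewrite Rplus_0_l.
    apply Rmult_le_compat_l; trivial. rewrite pow_add. pose proof (half_pow_pos k).
    assert ((/ 2) ^ S m <= 1) by (rewrite <- (pow1 (S m)); apply pow_incr; lra). nra. }
  pose proof (Cmod_ge_0 (x - y)).
  assert (Hxy : (x - y)%C = RtoC 0) by (apply Cmod_eq_0; lra).
  replace x with ((x - y) + y)%C by ring. rewrite Hxy. ring.
Qed.

(* The values on the layer [k <= p < k + 1] are interpolated by a finite sum; the growth of the
   weight makes the sums over the layers decay geometrically. *)
Lemma interpolate_with_kernels p L v (D : C -> R) (G : C -> C -> C) A B M c : weight p ->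
  interpolating p L -> 0 < A -> 0 < B -> 0 <= M -> 0 <= c ->
  (forall x, L x -> 0 < D x /\ entire (G x) /\ G x x = RtoC (D x) /\
     forall w, Cmod (G x w) <= A * exp (B * (p w + p x))) ->
  (forall x, L x -> Cmod (v x) <= M * exp (c * p x) * D x) ->
  exists F, in_Ap p F /\ (forall x, L x -> F x = v x) /\
    forall y, (forall x, L x -> G x y = RtoC 0) -> F y = RtoC 0.
Proof.
  intros Hp HL HA HB HM Hc HG Hv.
  (* A term at [x] has size [exp ((c + B - 2 * q) * p x)] in its parameter; this [q] makes the
     exponent at most [- p x], hence at most [- INR k] on the layer [k]. *)
  set (q := c + B + 1).
  destruct (interpolating_uniform p L q Hp ltac:(unfold q; lra) HL) as (M1 & B1 & HM1 & HB1 & Hu).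
  assert (HT : forall k : nat, exists l, NoDup l /\ forall x,
    In x l <-> L x /\ INR k <= p x < INR k + 1).
  { intros k. destruct (weight_sublevel_finite p L (INR k + 1) Hp (proj1 HL)) as [l Hl].
    apply (finite_list _ l). intros z (Hz & Hz1). apply Hl; trivial. lra. }
  destruct (choice _ HT) as [T HTT]. clear HT.
  assert (Hg : forall k, exists g : C -> C -> C, (forall x, In x (T k) -> entire (g x)) /\
     (forall x y, In x (T k) -> L y -> y <> x -> g x y = RtoC 0) /\
     (forall x, In x (T k) -> L x -> g x x = RtoC (exp (q * p x))) /\
     forall z, rsum (T k) (fun x => Cmod (g x z) ^ 2) <= (M1 * exp (B1 * p z)) ^ 2).
  { intros k. destruct (square_summable_interpolation L (fun x => exp (q * p x))
      (fun z => M1 * exp (B1 * p z))) with (l := T k) (w := fun _ : C => RtoC 0)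
      as (u & g & _ & H1 & _ & _ & H2 & H3 & H4); trivial.
    - intros x. left. apply exp_pos.
    - apply HTT.
    - intros x _. rewrite Cmod_0. left. apply exp_pos.
    - exists g. repeat split; trivial. intros z. specialize (H4 z).
      pose proof (pow2_ge_0 (Cmod (u z))). lra. }
  destruct (choice _ Hg) as [g Hgk]. clear Hg.
  (* At [x] the kernel gives [D x] and the square gives [exp (2 * q * p x)], leaving [v x]. The
     factor [g k x] kills the other points of [L], and [G x] keeps the common zeros of the
     kernels. *)
  set (f := fun k z => csum (T k) (fun x => (v x / D x * RtoC (exp (- (2 * q * p x)))) * (G x z *
    (g k x z * g k x z)))%C).
  assert (Hlayer : forall k y, L y ->
    f k y = if Nat.eq_dec k (nfloor (p y) (weight_nonneg p Hp y)) then v y else RtoC 0).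
  { intros k y Hy. destruct (Hgk k) as (_ & H2 & H3 & _).
    set (m := nfloor (p y) (weight_nonneg p Hp y)).
    assert (Hm : INR m <= p y < INR m + 1) by (unfold m, nfloor; destruct nfloor_ex; trivial).
    unfold f. destruct (Nat.eq_dec k m) as [->|Hkm].
    - assert (HyT : In y (T m)) by now apply HTT.
      rewrite (csum_single _ _ y); trivial; [|apply HTT|].
      + rewrite H3 by trivial. destruct (HG y Hy) as (HD & _ & -> & _).
        assert (HDc : RtoC (D y) <> 0) by (intros X; apply RtoC_inj in X; lra).
        replace (v y / D y * RtoC (exp (- (2 * q * p y))) * (D y * (RtoC (exp (q * p y)) * RtoC
          (exp (q * p y)))))%C
          with (v y * (RtoC (exp (- (2 * q * p y))) * (RtoC (exp (q * p y)) * RtoC (exp (q * p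
            y)))))%C
          by (field; trivial).
        rewrite <- !RtoC_mult, <- !exp_plus.
        replace (- (2 * q * p y) + (q * p y + q * p y)) with 0 by ring. rewrite exp_0. ring.
      + intros x Hx Hxy. rewrite H2; trivial; [ring|congruence].
    - apply csum_zero. intros x Hx. rewrite H2; trivial; [ring|].
      intros ->. apply HTT in Hx. destruct Hx as [_ Hx].
      assert (INR k < INR (S m) /\ INR m < INR (S k)) as [K1 K2] by (rewrite !S_INR; lra).
      apply INR_lt in K1, K2. lia. }
  set (N0 := M * A * M1 ^ 2). set (B' := B + 2 * B1).
  assert (HN0 : 0 <= N0) by (unfold N0; pose proof (pow2_ge_0 M1); repeat apply Rmult_le_pos; lra).
  assert (Hf : forall k z, Cmod (f k z) <= N0 * (/ 2) ^ k * exp (B' * p z)).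
  { intros k z. destruct (Hgk k) as (_ & _ & _ & H4). specialize (H4 z).
    unfold f. eapply Rle_trans.
    - apply Cmod_csum_le with (b := fun x => M * A * exp (- INR k) * exp (B * p z) * Cmod (g k x
      z) ^ 2).
      intros x Hx. apply HTT in Hx. destruct Hx as [Hx Hxk].
      destruct (HG x Hx) as (HD & _ & _ & HGg). specialize (HGg z). specialize (Hv x Hx).
      assert (HDc : RtoC (D x) <> 0) by (intros X; apply RtoC_inj in X; lra).
      assert (H0 : 0 <= Cmod (g k x z) ^ 2) by apply pow2_ge_0.
      rewrite !Cmod_mult, Cmod_div, !Cmod_R, (Rabs_pos_eq (D x)), (Rabs_pos_eq (exp _)) by
        (trivial; try (left; apply exp_pos); lra).
      apply Rle_trans with (M * exp (c * p x) * exp (- (2 * q * p x)) *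
        (A * exp (B * (p z + p x)) * Cmod (g k x z) ^ 2)).
      + pose proof (exp_pos (- (2 * q * p x))). pose proof (exp_pos (c * p x)).
        assert (Cmod (v x) / D x <= M * exp (c * p x)).
        { apply Rmult_le_reg_r with (D x); [trivial|]. unfold Rdiv.
        rewrite Rmult_assoc, Rinv_l by lra. lra. }
        assert (0 <= Cmod (v x) / D x).
        { apply Rmult_le_pos; [apply Cmod_ge_0|left; now apply Rinv_0_lt_compat]. }
        pose proof (Cmod_ge_0 (G x z)).
        apply Rmult_le_compat; [nra|simpl; nra|apply Rmult_le_compat_r; lra|].
        replace (Cmod (g k x z) * Cmod (g k x z)) with (Cmod (g k x z) ^ 2) by ring.
        now apply Rmult_le_compat_r.
      + replace (M * exp (c * p x) * exp (- (2 * q * p x)) * (A * exp (B * (p z + p x)) * Cmod (g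
        k x z) ^ 2))
          with (M * A * (exp (c * p x) * exp (- (2 * q * p x)) * exp (B * (p z + p x))) * Cmod (g
            k x z) ^ 2) by ring.
        apply Rmult_le_compat_r; trivial. rewrite (Rmult_assoc (M * A) (exp (- INR k))).
        apply Rmult_le_compat_l; [nra|]. rewrite <- !exp_plus. apply exp_mono.
        assert (0 <= INR k) by apply pos_INR. unfold q. nra.
    - rewrite rsum_scal. 
      apply Rle_trans with (M * A * (/ 2) ^ k * exp (B * p z) * (M1 * exp (B1 * p z)) ^ 2).
      + pose proof (half_pow_pos k). pose proof (exp_pos (B * p z)).
      pose proof (exp_neg_le_half_pow k).
        pose proof (exp_pos (- INR k)).
        assert (0 <= M * A) by nra.
        apply Rmult_le_compat; trivial.
        * apply Rmult_le_pos; [|lra]. apply Rmult_le_pos; lra.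
        * apply rsum_ge0. intros. apply pow2_ge_0.
        * apply Rmult_le_compat_r; [lra|]. now apply Rmult_le_compat_l.
      + apply Req_le. unfold N0, B'. rewrite Rmult_plus_distr_r, exp_plus.
        replace (2 * B1 * p z) with (B1 * p z + B1 * p z) by ring. rewrite exp_plus. ring. }
  destruct (weighted_series p f N0 B' Hp HN0 ltac:(unfold B'; lra)) as (F & HFe & HFs).
  { intros k. apply (entire_csum (T k) (fun x z => (v x / D x * RtoC (exp (- (2 * q * p x)))) * (G
    x z * (g k x z * g k x z)))%C).
    intros x Hx. destruct (Hgk k) as (H1 & _). specialize (H1 x Hx).
    apply HTT in Hx. destruct (HG x (proj1 Hx)) as (_ & H2 & _).
    apply (entire_mult (fun _ => _)); [apply entire_const|]. apply entire_mult; trivial.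
    now apply entire_mult. }
  { exact Hf. }
  exists F. split; [split; trivial|split].
  - exists (2 * N0 + 1), B'. split; [lra|]. split; [unfold B'; lra|]. intros z.
    specialize (HFs O z). simpl in HFs. replace (F z - 0)%C with (F z) in HFs by ring.
    eapply Rle_trans; [exact HFs|]. rewrite Rmult_1_r. apply exp_weight_le; trivial; lra.
  (* Past the layer of [y] the partial sums at [y] equal [v y] exactly, so the tail estimate alone
     forces equality. *)
  - intros y Hy. apply eq_of_half_pow with (M := 2 * N0 * exp (B' * p y)) (m := nfloor (p y)
    (weight_nonneg p Hp y)).
    + pose proof (exp_pos (B' * p y)). nra.
    + intros N HN. specialize (HFs N y).
      rewrite (partial_sum_support f (v y) _ y (fun k => Hlayer k y Hy) N) in HFs.
      destruct le_lt_dec; [lia|]. lra.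
  - intros y Hy. apply eq_of_half_pow with (M := 2 * N0 * exp (B' * p y)) (m := O).
    + pose proof (exp_pos (B' * p y)). nra.
    + intros N HN. specialize (HFs N y).
      rewrite (partial_sum_support f (RtoC 0) O y) in HFs.
      * destruct le_lt_dec; lra.
      * intros k. destruct (Nat.eq_dec k 0); apply csum_zero; intros x Hx; apply HTT in Hx;
          rewrite Hy by tauto; ring.
Qed.

Lemma weight_sum_near p z l : weight p -> forall D E, (forall w, Cmod (w - z) <= 1 ->
  p w <= D * p z + E) ->
  (forall x, In x l -> Cmod (x - z) <= 1) -> weight_sum p l <= INR (length l) * (D * p z + E).
Proof.
  intros Hp D E H. induction l as [|x l IH]; intros Hl; simpl weight_sum; simpl length; [simpl;
    lra|].
  rewrite S_INR. specialize (IH (fun y Hy => Hl y (or_intror Hy))).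
  specialize (H x (Hl x (or_introl eq_refl))). lra.
Qed.

Lemma in_Ap_plus p f g : weight p -> in_Ap p f -> in_Ap p g -> in_Ap p (fun z => f z + g z)%C.
Proof.
  intros Hp [He (A & B & HA & HB & Hf)] [He' (A' & B' & HA' & HB' & Hg)].
  split; [now apply entire_plus|]. exists (A + A'), (B + B'). split; [lra|]. split; [lra|].
  intros z. eapply Rle_trans; [apply Cmod_triangle|].
  rewrite Rmult_plus_distr_r. apply Rplus_le_compat.
  - eapply Rle_trans; [apply Hf|]. apply exp_weight_le; trivial; lra.
  - eapply Rle_trans; [apply Hg|]. apply exp_weight_le; trivial; lra.
Qed.

(** Newton interpolation with a sequence in place of each node: the error [e] vanishes on the first
    [m] sequences, and the correction on the next one is built from kernels that vanish there
    too. *)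
Lemma disjoint_union_trace p L Ls n W : weight p ->
  (forall i, (i < n)%nat -> interpolating p (Ls i)) ->
  (forall i j z, (i < n)%nat -> (j < n)%nat -> Ls i z -> Ls j z -> i = j) ->
  (forall i z, (i < n)%nat -> Ls i z -> L z) ->
  list_X p L n W ->
  forall m, (m <= n)%nat -> exists f, in_Ap p f /\ forall i z, (i < m)%nat -> Ls i z -> f z = W z.
Proof.
  intros Hp Hi Hdis HLs HX. induction m as [|m IH]; intros Hmn.
  - exists (fun _ => RtoC 1). split; [split; [apply entire_const|]|intros; lia].
    exists 1, 1. split; [lra|]. split; [lra|]. intros z. rewrite Cmod_1, Rmult_1_l.
    rewrite <- exp_0 at 1. apply exp_mono. pose proof (weight_nonneg p Hp z). lra.
  - destruct IH as (f & Hf & HfW); [lia|].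
    destruct (vanishing_functions p Ls m Hp) as (A & B & HA & HB & HV).
    { intros i Him. apply Hi. lia. }
    { intros i j z Him Hjm. apply Hdis; lia. }
    set (e := fun z => (W z - f z)%C).
    assert (He : list_X p L n e).
    { apply list_X_minus; trivial. destruct n as [|n']; [lia|]. now apply Ap_list_X. }
    destruct (list_X_all p L n e Hp He) as (M & B1 & HM & HB1 & HXe).
    destruct (weight_const p Hp) as (D0 & E0 & HD0 & HE0 & Hw).
    assert (Hker : forall x, exists dG : R * (C -> C), Ls m x -> 0 < fst dG /\ entire (snd dG) /\
       snd dG x = RtoC (fst dG) /\ (forall w, Cmod (snd dG w) <= A * exp (B * (p w + p x))) /\
       (forall i y, (i < m)%nat -> Ls i y -> snd dG y = RtoC 0) /\
       Cmod (e x) <= M * exp (B1 * (INR m * E0)) * 4 ^ m * exp (B1 * (1 + INR m * D0) * p x) * fst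
         dG).
    { intros x. destruct (classic (Ls m x)) as [Hx|Hx].
      2:{ exists (0, fun _ => RtoC 0). contradiction. }
      destruct (HV x) as (d & l & G & Hd & Hl & Hlen & Hlx & Hprod & HG & HGx & HG0 & HGg).
      { intros i Him Hix. assert (i = m) by (apply (Hdis i m x); trivial; lia). lia. }
      exists (d, G). intros _. simpl. do 5 (split; [trivial|]).
      assert (Hxl : ~ In x l).
      { intros Hin. destruct (Hlx x Hin) as [(i & Him & Hix) _].
        assert (i = m) by (apply (Hdis i m x); trivial; lia). lia. }
      assert (Hne : NoDup (x :: l)) by now constructor.
      (* [l] consists of zeros of [e] near [x]. The divided difference over [x :: l] is controlled
         since this list has at most [m + 1] points, and [dist_prod x l] is at most [4 ^ m * d]. *)
      rewrite (ldd_single l x e Hne).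
      2:{ intros y Hy. destruct (Hlx y Hy) as [(i & Him & Hiy) _]. unfold e.
      rewrite (HfW i y) by trivial. ring. }
      assert (Hnd : Cmod (ldd (x :: l) e) <= M * exp (B1 * (INR m * E0)) * exp (B1 * (1 + INR m *
        D0) * p x)).
      { eapply Rle_trans; [apply HXe; trivial; [simpl; lia|]|].
        - intros y [<-|Hy]; [apply (HLs m); trivial; lia|].
          destruct (Hlx y Hy) as [(i & Him & Hiy) _]. apply (HLs i); trivial. lia.
        - rewrite Rmult_assoc, <- exp_plus. apply Rmult_le_compat_l; trivial. apply exp_mono.
        simpl weight_sum.
          assert (weight_sum p l <= INR m * (D0 * p x + E0)).
          { eapply Rle_trans; [apply (weight_sum_near p x l Hp D0 E0)|].
            - intros w Hwx. now apply Hw.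
            - intros y Hy. now apply Hlx.
            - apply Rmult_le_compat_r; [pose proof (weight_nonneg p Hp x); nra|].
            now apply le_INR. }
          apply Rle_trans with (B1 * (p x + INR m * (D0 * p x + E0))); [apply Rmult_le_compat_l;
            lra|].
          apply Req_le. ring. }
      apply Rle_trans with (M * exp (B1 * (INR m * E0)) * exp (B1 * (1 + INR m * D0) * p x) * (4 ^
        m * d)).
      - apply Rmult_le_compat; trivial; [apply Cmod_ge_0|apply dist_prod_ge0].
      - apply Req_le. ring. }
    destruct (choice _ Hker) as [dG HdG].
    destruct (interpolate_with_kernels p (Ls m) e (fun x => fst (dG x)) (fun x => snd (dG x)) A B
      (M * exp (B1 * (INR m * E0)) * 4 ^ m) (B1 * (1 + INR m * D0))) as (F & HF & HFe & HF0);
        trivial.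
    + apply Hi. lia.
    + pose proof (exp_pos (B1 * (INR m * E0))). assert (0 < 4 ^ m) by (apply pow_lt; lra).
      repeat apply Rmult_le_pos; lra.
    + pose proof (pos_INR m). apply Rmult_le_pos; nra.
    + intros x Hx. destruct (HdG x Hx) as (H1 & H2 & H3 & H4 & _). auto.
    + intros x Hx. apply HdG, Hx.
    + exists (fun z => f z + F z)%C. split; [now apply in_Ap_plus|].
      intros i z Him Hz. destruct (Nat.eq_dec i m) as [->|Hne].
      * rewrite HFe by trivial. unfold e. ring.
      * rewrite (HfW i z), HF0; [ring| |lia|trivial]. intros x Hx.
        destruct (HdG x Hx) as (_ & _ & _ & _ & H5 & _). apply (H5 i); [lia|trivial].
Qed.

Lemma union_of_interpolating_trace p L n W : weight p -> union_of_interpolating p n L ->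
  list_X p L n W -> exists f, in_Ap p f /\ forall z, L z -> f z = W z.
Proof.
  intros Hp (Ls & Hi & HL) HX.
  (* Each point is kept only in the first sequence containing it, which makes the sequences
     disjoint; subsets of interpolating sequences are interpolating. *)
  set (Ls' := fun i z => Ls i z /\ forall j, (j < i)%nat -> ~ Ls j z).
  destruct (disjoint_union_trace p L Ls' n W Hp) with (m := n) as (f & Hf & HfW); trivial.
  - intros i Hin. apply (interpolating_subset p (Ls i)); auto. now intros z [H _].
  - intros i j z _ _ [H1 H1'] [H2 H2']. destruct (Nat.lt_trichotomy i j) as [H|[H|H]]; trivial.
    + destruct (H2' i H H1).
    + destruct (H1' j H H2).
  - intros i z Hin [Hz _]. apply HL. now exists i.
  - exists f. split; trivial. intros z Hz. apply HL in Hz. destruct Hz as (i & Hin & Hz).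
    destruct (dec_inh_nat_subset_has_unique_least_element (fun i => (i < n)%nat /\ Ls i z))
      as (k & ((Hkn & Hk) & Hmin) & _); [intros; apply classic|now exists i|].
    apply (HfW k); trivial. split; trivial. intros j Hj Hjz.
    specialize (Hmin j (conj (Nat.lt_trans _ _ _ Hj Hkn) Hjz)). lia.
Qed.

(** * Splitting a sequence with the expected trace *)

Lemma list_or_cover (S : C -> Prop) k :
  (exists l, length l = k /\ NoDup l /\ forall x, In x l -> S x) \/
  (exists l, (length l < k)%nat /\ forall x, S x -> In x l).
Proof.
  induction k as [|k [(l & Hl & Hn & HS)|(l & Hl & HS)]].
  - left. exists nil. repeat split; [constructor|intros ? []].
  - destruct (classic (forall x, S x -> In x l)) as [H|H].
    + right. exists l. split; [lia|trivial].
    + apply not_all_ex_not in H. destruct H as [x Hx]. apply imply_to_and in Hx.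
      left. exists (x :: l). split; [simpl; lia|]. split; [now constructor|].
      intros y [<-|Hy]; [apply Hx|auto].
  - right. exists l. split; [lia|trivial].
Qed.

Lemma dist_prod_lower z e l : 0 < e <= 1 -> (forall x, In x l -> e <= Cmod (z - x)) ->
  e ^ length l <= dist_prod z l.
Proof.
  intros He. induction l as [|x l IH]; intros H; simpl; [lra|].
  apply Rmult_le_compat; [lra|apply pow_le; lra|apply H; now left|]. apply IH. intros y Hy.
  apply H. now right.
Qed.

(** The extension of the function with value [phi z] at [z] and 0 elsewhere on [L] vanishes at [x]
    and on a nearly minimising list. Dividing out these [k + 1] zeros bounds [phi z] by a constant
    times [exp (B' * p z)], the distance from [x] to [z], and [2 * phi z]. Cancelling [phi z] bounds
    the distance from below. *)
Lemma sparse_of_trace p L k : weight p -> discrete L ->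
  (forall W, list_X p L (S k) W -> exists f, in_Ap p f /\ forall z, L z -> f z = W z) ->
  exists eps B, 0 < eps <= 1 /\ 0 <= B /\ forall z, L z -> exists nu, (length nu <= k)%nat /\
    forall x, L x -> x <> z -> ~ In x nu -> eps * exp (- (B * p z)) <= Cmod (x - z).
Proof.
  intros Hp HdL Hext.
  (* [fst q] is a lower bound for the products of distances from [z] to [k] other points, reached up
     to a factor 2 on [snd q]. If there are fewer than [k] other points, the bound is a dummy 1 and
     [snd q] contains them all. *)
  assert (HD : forall z, exists q : R * list C, 0 < fst q /\
    (forall l, length l = k -> NoDup l -> (forall x, In x l -> L x /\ x <> z) ->
      fst q <= dist_prod z l) /\
    (length (snd q) <= k)%nat /\
    ((length (snd q) = k /\ NoDup (snd q) /\ (forall x, In x (snd q) -> L x /\ x <> z) /\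
        dist_prod z (snd q) <= 2 * fst q) \/
     (forall x, L x /\ x <> z -> In x (snd q)))).
  { intros z. destruct (list_or_cover (fun x => L x /\ x <> z) k) as [(l & Hl & Hn & HS)|(l & Hl &
    HS)].
    - destruct (discrete_isolated L z HdL) as (e & He & Hiso).
      set (e' := Rmin 1 e). assert (He' : 0 < e' <= 1) by (split; [apply Rmin_pos;
        lra|apply Rmin_l]).
      destruct (almost_min (fun s => exists l, length l = k /\ NoDup l /\
          (forall x, In x l -> L x /\ x <> z) /\ s = dist_prod z l) (e' ^ k))
        as (D & HD & Hmin & s & (nu & H1 & H2 & H3 & ->) & Hs).
      + exists (dist_prod z l), l. auto.
      + apply pow_lt. lra.
      + intros s (l' & H1 & H2 & H3 & ->). rewrite <- H1. apply dist_prod_lower; trivial.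
        intros x Hx. eapply Rle_trans; [apply Rmin_r|]. apply Hiso; now apply H3.
      + exists (D, nu). simpl. split; trivial. split; [|split; [lia|left; auto]].
        intros l' H1' H2' H3'. apply Hmin. exists l'. auto.
    - exists (1, l). simpl. split; [lra|]. split; [|split; [lia|now right]].
      intros l' H1 H2 H3. exfalso.
      assert (Hi : incl l' l) by (intros x Hx; apply HS, H3, Hx).
      apply (NoDup_incl_length H2) in Hi. lia. }
  destruct (choice _ HD) as [q Hq]. clear HD.
  set (phi := fun z => fst (q z)).
  destruct (uniform_extension p L phi Hp) as (M & B & HM & HB & Hu).
  { intros z _. left. apply Hq. }
  { intros W HW. apply Hext. exists (INR (S k)), 0. split; [apply pos_INR|]. split; [lra|].
    intros l Hl Hn HL. rewrite Rmult_0_l, exp_0, Rmult_1_r, <- Hl.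
    apply ldd_bound_dist_prod; trivial.
    intros x l' HP. pose proof (Permutation_NoDup HP Hn) as Hn'.
    inversion Hn' as [|? ? Hx Hn'']; subst.
    pose proof (Permutation_length HP) as Hlen. simpl in Hlen.
    assert (HxL : L x) by (apply HL, (Permutation_in x (Permutation_sym HP)); now left).
    eapply Rle_trans; [now apply HW|]. apply Hq; trivial; [lia|].
    intros y Hy. split; [apply HL, (Permutation_in y (Permutation_sym HP)); now right|congruence]. }
  destruct (zeros_growth p Hp (S k) B) as (A' & B' & HA' & HB' & Hz); [lra|].
  assert (HMA : 0 <= M * A') by nra.
  (* The 2 is the loss in near-minimality; the added 1 keeps [eps] at most 1. *)
  exists (/ (1 + 2 * (M * A'))), B'. split; [|split; [trivial|]].
  { split; [apply Rinv_0_lt_compat; lra|]. rewrite <- Rinv_1. apply Rinv_le_contravar; lra. }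
  intros z HzL. exists (snd (q z)). destruct (Hq z) as (HD & Hmin & Hlen & Hcase). split; trivial.
  intros x Hx Hxz Hxn. destruct Hcase as [(H1 & H2 & H3 & H4)|Hcov].
  2:{ exfalso. apply Hxn. now apply Hcov. }
  destruct (Hu (fun y => if C_eq_dec y z then RtoC (phi z) else RtoC 0)) as (f & Hf & Hfg & Hfw).
  { intros y Hy. destruct (C_eq_dec y z) as [->|_].
    - rewrite Cmod_R, Rabs_pos_eq; [lra|]. left. exact HD.
    - rewrite Cmod_0. left. apply Hq. }
  assert (Hfz : Cmod (f z) <= M * A' * exp (B' * p z) * dist_prod z (x :: snd (q z))).
  { apply (Hz M nil f); trivial; [lra|now apply holo_off_entire|simpl;
    lia|now constructor|intros ? _ []|].
    intros y Hy. assert (HyL : L y /\ y <> z) by (destruct Hy as [<-|Hy]; auto).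
    rewrite Hfw by tauto. destruct (C_eq_dec y z); tauto. }
  rewrite Hfw in Hfz by trivial. destruct (C_eq_dec z z) as [_|]; [|contradiction].
  rewrite Cmod_R, Rabs_pos_eq in Hfz by (left; exact HD). simpl in Hfz.
  change (fst (q z)) with (phi z) in *. rewrite (Cmod_minus_sym z x) in Hfz.
  pose proof (exp_pos (B' * p z)) as HE. pose proof (Cmod_ge_0 (x - z)) as HC.
  set (X := M * A' * exp (B' * p z) * Cmod (x - z)).
  assert (HX : 0 <= X) by (unfold X; apply Rmult_le_pos; nra).
  assert (H5 : phi z <= X * (2 * phi z)).
  { eapply Rle_trans; [exact Hfz|]. unfold X.
    replace (M * A' * exp (B' * p z) * (Cmod (x - z) * dist_prod z (snd (q z))))
      with (M * A' * exp (B' * p z) * Cmod (x - z) * dist_prod z (snd (q z))) by ring.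
    apply Rmult_le_compat_l; trivial. }
  assert (H6 : 1 <= 2 * X).
  { apply Rmult_le_reg_r with (phi z); [trivial|]. lra. }
  apply Rmult_le_reg_l with ((1 + 2 * (M * A')) * exp (B' * p z)); [nra|].
  rewrite exp_Ropp. replace ((1 + 2 * (M * A')) * exp (B' * p z) *
    (/ (1 + 2 * (M * A')) * / exp (B' * p z))) with 1 by (field; split; lra).
  unfold X in H6. nra.
Qed.

(** * Clusters of points linked at a small scale *)

Section Clusters.
Variables (p : C -> R) (L : C -> Prop) (n : nat) (eps B D0 E0 : R).
Hypothesis (Hp : weight p) (Heps : 0 < eps <= 1) (HB : 0 <= B) (HD0 : 1 <= D0) (HE0 : 0 < E0).
Hypothesis Hw : forall z w, Cmod (z - w) <= 1 -> p z <= D0 * p w + E0.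
Hypothesis Hsparse : forall z, L z -> exists nu, (length nu < n)%nat /\
  forall x, L x -> x <> z -> ~ In x nu -> eps * exp (- (B * p z)) <= Cmod (x - z).

(** Chosen so that [n] links, each at most [eps / (INR n + 1) * exp (- (B * p z))], stay below the
    separation given by [Hsparse]. The factor [exp (- (B * E0))] and the [D0] in [scale] pay for
    replacing [p x] by [p z]. *)
Let del := eps * exp (- (B * E0)) / (INR n + 1).
Let scale (x : C) := del * exp (- (B * D0 * p x)).
(** Allowing the scale of either end makes the relation symmetric, so that its closure [comp] is an
    equivalence. *)
Let edge (x y : C) : Prop := L x /\ L y /\ (Cmod (x - y) < scale x \/ Cmod (x - y) < scale y).
Let comp := clos_refl_trans C edge.

Lemma del_pos : 0 < del <= eps / (INR n + 1).
Proof.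
  pose proof (pos_INR n). pose proof (exp_pos (- (B * E0))).
  assert (exp (- (B * E0)) <= 1) by (rewrite <- exp_0; apply exp_mono; nra).
  unfold del. split; [apply Rdiv_lt_0_compat; nra|].
  apply Rmult_le_compat_r; [left; apply Rinv_0_lt_compat; lra|nra].
Qed.

Lemma scale_le z x : Cmod (z - x) <= 1 -> scale x <= eps / (INR n + 1) * exp (- (B * p z)).
Proof.
  intros Hzx. unfold scale, del. pose proof (pos_INR n).
  replace (eps * exp (- (B * E0)) / (INR n + 1) * exp (- (B * D0 * p x)))
    with (eps / (INR n + 1) * (exp (- (B * E0)) * exp (- (B * D0 * p x)))) by (field; lra).
  rewrite <- exp_plus. apply Rmult_le_compat_l; [left; apply Rdiv_lt_0_compat; lra|].
  apply exp_mono. specialize (Hw z x Hzx). nra.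
Qed.

Lemma scale_le_del x : scale x <= del.
Proof.
  pose proof del_pos. unfold scale. rewrite <- (Rmult_1_r del) at 2.
  apply Rmult_le_compat_l; [lra|].
  rewrite <- exp_0. apply exp_mono. pose proof (weight_nonneg p Hp x).
  assert (0 <= B * D0) by nra. nra.
Qed.

Lemma edge_sym x y : edge x y -> edge y x.
Proof. intros (H1 & H2 & H3). repeat split; trivial. rewrite Cmod_minus_sym. tauto. Qed.

Lemma comp_sym x y : comp x y -> comp y x.
Proof.
  intros H. induction H as [x y H|x|x y z _ IH1 _ IH2].
  - apply rt_step. now apply edge_sym.
  - apply rt_refl.
  - now apply rt_trans with y.
Qed.

Fixpoint reach (z : C) (j : nat) (x : C) : Prop :=
  match j with
  | O => x = z
  | S j => reach z j x \/ exists y, reach z j y /\ edge y x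
  end.

Lemma reach_near z j x : L z -> (j <= n)%nat -> reach z j x ->
  L x /\ Cmod (x - z) <= INR j * (eps / (INR n + 1)) * exp (- (B * p z)).
Proof.
  intros Hz. revert x. induction j as [|j IH]; intros x Hj Hx.
  - simpl in Hx. subst x. split; trivial. replace (z - z)%C with (RtoC 0) by ring.
    rewrite Cmod_0. simpl. lra.
  - pose proof (pos_INR n) as Hn0. pose proof (pos_INR j) as Hj0.
    assert (Hr : 0 < eps / (INR n + 1)) by (apply Rdiv_lt_0_compat; lra).
    pose proof (exp_pos (- (B * p z))) as HE.
    assert (HE1 : exp (- (B * p z)) <= 1).
    { rewrite <- exp_0. apply exp_mono. pose proof (weight_nonneg p Hp z). nra. }
    rewrite S_INR. destruct Hx as [Hx|(y & Hy & HyL & HxL & He)].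
    + destruct (IH x ltac:(lia) Hx) as [H1 H2]. split; trivial. nra.
    + destruct (IH y ltac:(lia) Hy) as [_ H2]. split; trivial.
      pose proof (Cmod_triangle3 x y z) as Ht. rewrite (Cmod_minus_sym x y) in Ht.
      (* A crude bound first places the end whose scale is used within 1 of [z]; only then can
         doubling compare its scale with [p z]. *)
      assert (Hj1 : (INR j + 1) * (eps / (INR n + 1)) <= 1).
      { assert (INR j + 1 <= INR n) by (rewrite <- S_INR; apply le_INR; lia).
        apply Rmult_le_reg_r with (INR n + 1); [lra|].
        replace ((INR j + 1) * (eps / (INR n + 1)) * (INR n + 1)) with ((INR j + 1) * eps) by
          (field; lra). nra. }
      assert (Hyz : Cmod (y - z) <= INR j * (eps / (INR n + 1))).
      { eapply Rle_trans; [exact H2|]. rewrite <- (Rmult_1_r (INR j * _)) at 2.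
        apply Rmult_le_compat_l; nra. }
      pose proof del_pos as Hdel. pose proof (scale_le_del x). pose proof (scale_le_del y).
      assert (Hs : forall u, Cmod (u - z) <= 1 -> scale u <= eps / (INR n + 1) * exp (- (B * p z))).
      { intros u Hu. apply scale_le. now rewrite Cmod_minus_sym. }
      assert (Hyx : Cmod (y - x) <= eps / (INR n + 1) * exp (- (B * p z))).
      { destruct He as [He|He]; left; eapply Rlt_le_trans; try exact He; apply Hs.
        - lra.
        - lra. }
      lra.
Qed.

(** Points reached in at most [n] links are too close to [z] to be outside the exceptional list of
    [Hsparse], which has fewer than [n] points; [z] itself makes at most [n]. *)
Lemma near_finite z : L z -> exists nu, (length nu <= n)%nat /\
  forall x j, (j <= n)%nat -> reach z j x -> In x nu.
Proof.
  intros Hz. destruct (Hsparse z Hz) as (nu & Hnu & H). exists (z :: nu). split; [simpl; lia|].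
  intros x j Hj Hx. destruct (reach_near z j x Hz Hj Hx) as [HxL Hxz].
  apply NNPP. intros Hn. assert (Hne : x <> z) by (intros ->; apply Hn; now left).
  specialize (H x HxL Hne (fun X => Hn (or_intror X))).
  pose proof (exp_pos (- (B * p z))) as HE. pose proof (pos_INR n).
  assert (INR j * (eps / (INR n + 1)) < eps).
  { apply Rmult_lt_reg_r with (INR n + 1); [lra|].
    replace (INR j * (eps / (INR n + 1)) * (INR n + 1)) with (INR j * eps) by (field; lra).
    apply le_INR in Hj. nra. }
  nra.
Qed.

(** Each step that is not closed adds a point; [n] of them would give [n + 1] reached points,
    against [near_finite]. So chains of fewer than [n] links exhaust the cluster. *)
Lemma reach_closed z : L z -> exists i, (i < n)%nat /\ forall x, reach z (S i) x -> reach z i x.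
Proof.
  intros Hz.
  assert (H : forall j, (exists i, (i < j)%nat /\ forall x, reach z (S i) x -> reach z i x) \/
     exists l, NoDup l /\ length l = S j /\ forall x, In x l -> reach z j x).
  { induction j as [|j [(i & Hi & IH)|(l & Hn & Hl & Hr)]].
    - right. exists (z :: nil). split; [constructor; [intros []|constructor]|]. split; trivial.
      intros x [<-|[]]. reflexivity.
    - left. exists i. split; [lia|trivial].
    - destruct (classic (forall x, reach z (S j) x -> reach z j x)) as [Hc|Hc].
      + left. exists j. split; [lia|trivial].
      + apply not_all_ex_not in Hc. destruct Hc as [x Hx]. apply imply_to_and in Hx.
        right. exists (x :: l). split; [|split].
        * constructor; trivial. intros Hin. now apply Hx, Hr.
        * simpl. lia.
        * intros y [<-|Hy]; [apply Hx|]. left. auto. }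
  destruct (H n) as [?|(l & Hn & Hl & Hr)]; trivial. exfalso.
  destruct (near_finite z Hz) as (nu & Hnu & Hin).
  assert (Hi : incl l nu) by (intros x Hx; apply (Hin x n (le_n _)); auto).
  apply (NoDup_incl_length Hn) in Hi. lia.
Qed.

Lemma comp_reach z x : L z -> comp z x -> exists j, (j < n)%nat /\ reach z j x.
Proof.
  intros Hz Hx. destruct (reach_closed z Hz) as (i & Hi & Hc). exists i. split; trivial.
  apply clos_rt_rtn1 in Hx. induction Hx as [|x y Hxy _ IH].
  - clear Hc Hi. induction i; simpl; auto.
  - apply Hc. right. now exists x.
Qed.

Lemma comp_near z x : L z -> comp z x -> L x /\ Cmod (x - z) <= 1.
Proof.
  intros Hz Hx. destruct (comp_reach z x Hz Hx) as (j & Hj & Hr).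
  destruct (reach_near z j x Hz ltac:(lia) Hr) as [H1 H2]. split; trivial.
  eapply Rle_trans; [exact H2|].
  assert (HE1 : exp (- (B * p z)) <= 1).
  { rewrite <- exp_0. apply exp_mono. pose proof (weight_nonneg p Hp z). nra. }
  pose proof (exp_pos (- (B * p z))). pose proof (pos_INR n). pose proof (pos_INR j).
  assert (INR j * (eps / (INR n + 1)) <= 1).
  { apply Rmult_le_reg_r with (INR n + 1); [lra|].
    replace (INR j * (eps / (INR n + 1)) * (INR n + 1)) with (INR j * eps) by (field; lra).
    apply lt_INR in Hj. nra. }
  assert (0 <= INR j * (eps / (INR n + 1))).
  { apply Rmult_le_pos; trivial. left. apply Rdiv_lt_0_compat; lra. }
  nra.
Qed.

Lemma comp_apart x y : L x -> L y -> ~ comp x y -> scale x <= Cmod (x - y).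
Proof.
  intros Hx Hy Hn. apply Rnot_lt_le. intros Hlt. apply Hn. apply rt_step. repeat split; auto.
Qed.

(* [epsilon] depends only on the class of [z], so equivalent points get the same enumeration. *)
Definition class_list (z : C) : list C :=
  epsilon (inhabits nil) (fun l => NoDup l /\ forall x, In x l <-> comp z x).

Lemma class_list_spec z : L z -> NoDup (class_list z) /\ (forall x,
  In x (class_list z) <-> comp z x) /\
  (length (class_list z) <= n)%nat.
Proof.
  intros Hz. destruct (near_finite z Hz) as (nu & Hnu & Hin).
  assert (Hcov : forall x, comp z x -> In x nu).
  { intros x Hx. destruct (comp_reach z x Hz Hx) as (j & Hj & Hr). apply (Hin x j); [lia|trivial]. }
  destruct (epsilon_spec (inhabits nil) (fun l => NoDup l /\ forall x, In x l <-> comp z x)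
    (finite_list (comp z) nu Hcov)) as [H1 H2]. fold (class_list z) in H1, H2.
  repeat split; trivial; try apply H2.
  assert (Hi : incl (class_list z) nu) by (intros x Hx; apply Hcov, H2, Hx).
  apply (NoDup_incl_length H1) in Hi. lia.
Qed.

Lemma class_list_eq z x : comp z x -> class_list x = class_list z.
Proof.
  intros Hzx. unfold class_list. f_equal. apply functional_extensionality. intros l.
  apply propositional_extensionality.
  assert (H : forall y, comp z y <-> comp x y).
  { intros y. split; intros H; [apply rt_trans with z;
    [now apply comp_sym|trivial]|now apply rt_trans with x]. }
  split; intros [H1 H2]; split; trivial; intros y; rewrite H2; [symmetry|]; apply H.
Qed.

(** A point is labelled by its position in the enumeration shared by its cluster. Positions below
    [n] suffice, and a shorter cluster is simply absent from the later layers. *)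
Definition layer (i : nat) (z : C) : Prop := L z /\ nth_error (class_list z) i = Some z.

Lemma layer_cover z : L z <-> exists i, (i < n)%nat /\ layer i z.
Proof.
  split; [|now intros (i & _ & H & _)]. intros Hz.
  destruct (class_list_spec z Hz) as (H1 & H2 & H3).
  assert (Hin : In z (class_list z)) by (apply H2, rt_refl).
  apply In_nth_error in Hin. destruct Hin as [i Hi]. exists i. split; [|now split].
  assert (i < length (class_list z))%nat; [|lia]. apply nth_error_Some. congruence.
Qed.

(** Induction on the order. Within one cluster the divided difference of a constant is 0. Otherwise
    some [a] and [b] lie in different clusters, at least [scale a] apart, and solving the exchange
    identity for the higher difference costs [exp (B * D0 * p a) / del]. *)
Lemma constant_on_classes_list_X W A1 B1 : 0 <= A1 -> 0 <= B1 ->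
  (forall z, L z -> Cmod (W z) <= A1 * exp (B1 * p z)) ->
  (forall x y, L x -> comp x y -> W y = W x) -> forall j, list_X p L (S j) W.
Proof.
  intros HA1 HB1 HWg HWc. induction j as [|j (M & Bj & HM & HBj & IH)].
  - exists A1, B1. repeat split; trivial. intros l Hl Hn HL.
    destruct l as [|x [|y l]]; try discriminate. simpl. rewrite Rplus_0_r. apply HWg, HL. now left.
  - exists (2 * M / del), (Bj + B * D0). pose proof del_pos as Hdel.
    assert (0 <= B * D0) by nra.
    assert (H0 : 0 <= 2 * M / del) by (apply Rmult_le_pos; [lra|left; apply Rinv_0_lt_compat; lra]).
    split; trivial. split; [lra|]. intros l Hl Hn HL.
    destruct l as [|a l]; [discriminate|].
    assert (Ha : L a) by (apply HL; now left).
    destruct (classic (forall b, In b l -> comp a b)) as [Hall|Hno].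
    + rewrite (ldd_ext _ _ (fun _ => W a)).
      * rewrite ldd_const by (intros ->; discriminate). rewrite Cmod_0.
        apply Rmult_le_pos; [trivial|left; apply exp_pos].
      * intros x [<-|Hx]; [trivial|]. apply HWc; auto.
    + apply not_all_ex_not in Hno. destruct Hno as [b Hb]. apply imply_to_and in Hb.
    destruct Hb as [Hbl Hab].
      destruct (in_split b l Hbl) as (l1 & l2 & ->).
      assert (HP : Permutation (a :: l1 ++ b :: l2) (a :: b :: l1 ++ l2)).
      { apply perm_skip. symmetry. apply Permutation_middle. }
      rewrite (ldd_perm _ _ HP) by trivial. rewrite (weight_sum_perm p _ _ HP).
      apply (Permutation_length) in HP as Hlen. rewrite Hl in Hlen.
      assert (HL' : forall x, In x (a :: b :: l1 ++ l2) -> L x).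
      { intros x Hx. apply HL. now apply (Permutation_in x (Permutation_sym HP)). }
      apply (Permutation_NoDup HP) in Hn. set (t := l1 ++ l2) in *.
      pose proof (ldd_exchange t a b W Hn) as Hex.
      pose proof (comp_apart a b Ha (HL' b ltac:(right; now left)) Hab) as Hsep.
      apply NoDup_cons2 in Hn. destruct Hn as (Hn1 & Hn2 & Hn3 & Hn4). simpl in Hlen.
      assert (Hna : Cmod (ldd (a :: t) W) <= M * exp (Bj * weight_sum p (a :: b :: t))).
      { eapply Rle_trans; [apply IH; [simpl; lia|now constructor|]|].
        - intros x [<-|Hx]; [trivial|]. apply HL'. right; now right.
        - apply Rmult_le_compat_l; trivial. apply exp_mono. simpl.
          pose proof (weight_nonneg p Hp b). nra. }
      assert (Hnb : Cmod (ldd (b :: t) W) <= M * exp (Bj * weight_sum p (a :: b :: t))).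
      { eapply Rle_trans; [apply IH; [simpl; lia|now constructor|]|].
        - intros x Hx. apply HL'. now right.
        - apply Rmult_le_compat_l; trivial. apply exp_mono. simpl.
          pose proof (weight_nonneg p Hp a). nra. }
      set (s := weight_sum p (a :: b :: t)) in *.
      assert (Hs : p a <= s).
      { unfold s. simpl. pose proof (weight_nonneg p Hp b). pose proof (weight_sum_ge0 p t Hp).
      lra. }
      assert (Hm : Cmod (a - b) * Cmod (ldd (a :: b :: t) W) <= 2 * M * exp (Bj * s)).
      { rewrite <- Cmod_mult, <- Hex. eapply Rle_trans; [apply Cmod_minus_le|]. lra. }
      assert (Hsc : del * exp (- (B * D0 * s)) <= Cmod (a - b)).
      { eapply Rle_trans; [|exact Hsep]. unfold scale. apply Rmult_le_compat_l; [lra|].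
        apply exp_mono. nra. }
      pose proof (exp_pos (- (B * D0 * s))). 
      apply Rmult_le_reg_l with (del * exp (- (B * D0 * s))); [nra|].
      apply Rle_trans with (2 * M * exp (Bj * s)).
      * eapply Rle_trans; [|exact Hm]. apply Rmult_le_compat_r; [apply Cmod_ge_0|trivial].
      * apply Req_le. replace ((Bj + B * D0) * s) with (Bj * s + B * D0 * s) by ring.
        rewrite exp_plus, exp_Ropp.
        pose proof (exp_pos (B * D0 * s)). field. split; lra.
Qed.

Lemma layer_interpolating i : discrete L -> (1 <= n)%nat ->
  (forall W, list_X p L n W -> exists f, in_Ap p f /\ forall z, L z -> f z = W z) ->
  interpolating p (layer i).
Proof.
  intros Hd Hn Hext. apply interpolating_iff; trivial. split.
  { apply (discrete_subset L); trivial. now intros z [H _]. }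
  intros w A1 B1 HA1 HB1 Hwb.
  (* The value at the point labelled [i] is spread over its cluster, and 0 over clusters without
     such a point. Growth is kept because points of one cluster are within 1 of each other. *)
  set (W := fun z => match nth_error (class_list z) i with Some y => w y | None => RtoC 0 end).
  destruct (Hext W) as (f & Hf & HfW).
  - replace (list_X p L n W) with (list_X p L (S (n - 1)) W) by (f_equal; lia).
    apply (constant_on_classes_list_X W (A1 * exp (B1 * E0)) (B1 * D0)).
    + pose proof (exp_pos (B1 * E0)). nra.
    + nra.
    + intros z Hz. unfold W. destruct (nth_error (class_list z) i) as [y|] eqn:Ey.
      * assert (Hzy : comp z y) by (apply (class_list_spec z Hz); apply (nth_error_In _ _ Ey)).
        destruct (comp_near z y Hz Hzy) as [HyL Hyz].
        eapply Rle_trans; [apply Hwb; split; [trivial|now rewrite (class_list_eq z y)]|].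
        rewrite Rmult_assoc, <- exp_plus. apply Rmult_le_compat_l; [lra|]. apply exp_mono.
        specialize (Hw y z Hyz). nra.
      * rewrite Cmod_0. pose proof (exp_pos (B1 * E0)). pose proof (exp_pos (B1 * D0 * p z)).
        apply Rmult_le_pos; [apply Rmult_le_pos|]; lra.
    + intros x y Hx Hxy. unfold W. now rewrite (class_list_eq x y Hxy).
  - exists f. split; trivial. intros z [Hz Hzi]. rewrite HfW by trivial. unfold W. now rewrite Hzi.
Qed.
End Clusters.

Theorem theorem1p4 (p : C -> R) (L : C -> Prop) (n : nat)
    (hp : weight p) (hL : discrete L) (hn : (1 <= n)%nat) :
  (forall w : family_on L, Ap_trace p L w <-> in_X p L (n - 1) w)
  <-> union_of_interpolating p n L.
Proof.
  destruct n as [|k]; [lia|]. replace (S k - 1)%nat with k by lia. split.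
  - intros H.
    assert (Hext : forall W, list_X p L (S k) W -> exists f, in_Ap p f /\ forall z, L z ->
      f z = W z).
    { intros W (M & B & HM & HB & HX).
      assert (HW : forall z, L z -> extend (fun x : Defs.point_of L => W (pval x)) z = W z).
      { intros z Hz. exact (extend_pval (fun x : Defs.point_of L => W (pval x)) (exist _ z Hz)). }
      destruct (proj2 (H (fun x => W (pval x)))) as (f & Hf & HfW).
      - apply in_X_list_X; trivial. exists M, B. repeat split; trivial. intros l Hl Hn HLl.
        rewrite (ldd_ext l _ W) by auto. now apply HX.
      - exists f. split; trivial. intros z Hz. exact (HfW (exist _ z Hz)). }
    destruct (sparse_of_trace p L k hp hL Hext) as (eps & B & Heps & HB & Hs).
    destruct (weight_const p hp) as (D0 & E0 & HD0 & HE0 & Hw).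
    assert (Hs' : forall z, L z -> exists nu, (length nu < S k)%nat /\
      forall x, L x -> x <> z -> ~ In x nu -> eps * exp (- (B * p z)) <= Cmod (x - z)).
    { intros z Hz. destruct (Hs z Hz) as (nu & Hnu & H'). exists nu. split; [lia|trivial]. }
    exists (layer p L (S k) eps B D0 E0). split.
    + intros i _. now apply layer_interpolating.
    + intros z. now apply layer_cover.
  - intros H w. split.
    + intros (f & Hf & Hfw). apply in_X_list_X; trivial.
      destruct (Ap_list_X p hp L k f Hf) as (M & B & HM & HB & HX). exists M, B.
      repeat split; trivial. intros l Hl Hn HLl. rewrite (ldd_ext l _ f); [now apply HX|].
      intros z Hz. transitivity (w (exist _ z (HLl z Hz))).
      * exact (extend_pval w (exist _ z (HLl z Hz))).
      * symmetry. exact (Hfw (exist _ z (HLl z Hz))).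
    + intros HX. apply in_X_list_X in HX; trivial.
      destruct (union_of_interpolating_trace p L (S k) (extend w) hp H HX) as (f & Hf & HfW).
      exists f. split; trivial. intros x. unfold restriction. rewrite HfW; [apply extend_pval|].
      exact (proj2_sig x).
Qed.
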